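(* Let $\pi$ be the density of a $\mathcal{N}(\mu,\Gamma)$ distribution on $\mathbb{R}^k$, with $\mu\in\mathbb{R}^k$ and $\Gamma\in\mathbb{R}^{k\times k}$ symmetric positive definite. Then $\Sigma:=\mathrm{Var}_{X\sim\pi}(\nabla\log\pi(X))=\Gamma^{-1}$, and, over all symmetric positive definite $\Lambda\in\mathbb{R}^{k\times k}$, the spectral gap of $G^\Lambda$ is maximised by taking $\Lambda$ (proportional to) the covariance of the target, $\Lambda=\Sigma^{-1}=\Gamma$. The convergence to stationarity is $\frac{\mathrm{Tr}(\Sigma)}{k\,\lambda_1(\Sigma)}$ times faster when using the optimal shaping as opposed to spherical shaping $\Lambda=I$, i.e. the ratio of the spectral gap of $G^{\Gamma}$ to the spectral gap of $G^{I}$ equals $\frac{\mathrm{Tr}(\Sigma)}{k\,\lambda_1(\Sigma)}$, where $\lambda_1(\Sigma)$ is the minimal eigenvalue of $\Sigma$.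
   Context: For symmetric positive definite $\Lambda$, $G^\Lambda$ is the generator (of a reversible diffusion with stationary density $\pi$, regarded in $L^2(\pi)$) $$G^{\Lambda}f=k\Big(\frac{\Lambda}{\Lambda:\Sigma}:\nabla^2f+[\nabla\log\pi]'\frac{\Lambda}{\Lambda:\Sigma}\nabla f\Big),\qquad A:B=\sum_{i,j}A_{ji}B_{ij}.$$ The spectral gap of $G^\Lambda$ is the largest $\rho>0$ such that for all $f$ in the domain $\mathcal{D}(G^\Lambda)$, $$\mathrm{Var}_{X\sim\pi}f(X)\le-\frac1\rho\,\mathbb{E}_{X\sim\pi}\big(f(X)\,[G^\Lambda f](X)\big).$$ The speed of convergence to stationarity is measured by the spectral gap. *)

(* Defs.v *)
From HB Require Import structures.
From mathcomp Require Import all_boot all_order all_algebra.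
From mathcomp Require Import all_classical all_reals all_analysis.
Set Implicit Arguments.
Unset Strict Implicit.
Unset Printing Implicit Defensive.
Import Order.TTheory GRing.Theory Num.Theory.
Import numFieldNormedType.Exports.
Local Open Scope classical_set_scope.
Local Open Scope ring_scope.

Section measure_cons.
Context d (T : measurableType d) (R : realType).

Definition tcons n (p : T * n.-tuple T) : n.+1.-tuple T := [tuple of p.1 :: p.2].

Lemma measurable_tcons n : measurable_fun setT (@tcons n).
Proof. exact: measurable_cons. Qed.

Variables (m1 : {sigma_finite_measure set T -> \bar R}) (n : nat).
Variable m2 : {sigma_finite_measure set (n.-tuple T) -> \bar R}.

Definition measure_cons : set (n.+1.-tuple T) -> \bar R :=
  pushforward (m1 \x m2)%E (@tcons n).

(* Canonical inference cannot supply measurable_tcons to pushforward. *)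
HB.instance Definition _ := Measure.copy measure_cons
  (measure_function_pushforward__canonical__measure_function_Measure
     (m1 \x m2)%E (@measurable_tcons n)).

Lemma measure_cons_sigma_finite : sigma_finite setT measure_cons.
Proof.
have /sigma_finiteP[F [TF ndF Foo]] := sigma_finiteT m1.
have /sigma_finiteP[G [TG ndG Goo]] := sigma_finiteT m2.
pose g (t : n.+1.-tuple T) : T * n.-tuple T := (thead t, [tuple of behead t]).
have mg : measurable_fun setT g.
  apply/measurable_fun_pairP; split; first exact: measurable_tnth.
  exact: measurable_behead.
have tconsK : cancel (@tcons n) g.
  by move=> [x t]; congr pair; apply/val_inj.
exists (fun i => g @^-1` (F i `*` G i)) => [|i].
  rewrite -preimage_bigcup (_ : \bigcup_i _ = setT) ?preimage_setT//.
  rewrite -subTset => -[x t] _.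
  have [i _ Fi] : (\bigcup_i F i) x by rewrite -TF.
  have [j _ Gj] : (\bigcup_i G i) t by rewrite -TG.
  exists (maxn i j) => //; split.
    by move: x Fi; exact/subsetPset/ndF/leq_maxl.
  by move: t Gj; exact/subsetPset/ndG/leq_maxr.
have [[mF Fi] [mG Gi]] := (Foo i, Goo i).
split; first by rewrite -[X in measurable X]setTI; apply: mg => //; exact: measurableX.
rewrite /measure_cons /pushforward -comp_preimage.
rewrite (_ : g \o _ = id) ?preimage_id; last exact/funext.
by rewrite product_measure1E// lte_mul_pinfty// ge0_fin_numE.
Qed.

HB.instance Definition _ := Measure_isSigmaFinite.Build _ _ _ measure_cons
  measure_cons_sigma_finite.

End measure_cons.

(* Lebesgue measure on R^n: the n-fold product measure.  R^n is a type of tuples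
   here, because the library gives tuples (and not matrices) their product
   sigma-algebra. *)
Fixpoint lebesgue_tuple (R : realType) (n : nat) :
    {sigma_finite_measure set (n.-tuple (measurableTypeR R)) -> \bar R} :=
  match n with
  | 0 => @dirac _ (0.-tuple (measurableTypeR R)) [tuple] R
  | n'.+1 => measure_cons (@lebesgue_measure R) (lebesgue_tuple R n')
  end.

Section diffusion.
Variables (R : realType) (k : nat).
Implicit Types (A B Lambda : 'M[R]_k) (p f g : 'cV[R]_k -> R).

Definition vec (t : k.-tuple (measurableTypeR R)) : 'cV[R]_k := \col_i (tnth t i : R).

(* E_{X ~ p} f(X), for a density p with respect to Lebesgue measure. *)
Definition expect p f : R :=
  \int[lebesgue_tuple R k]_t (f (vec t) * p (vec t)).

Definition variance_of p f : R := expect p (fun x => (f x - expect p f) ^+ 2).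

Definition sqnormL2 p f : \bar R :=
  (\int[lebesgue_tuple R k]_t ((f (vec t)) ^+ 2 * p (vec t))%:E)%E.

Definition inL2 p f : Prop :=
  measurable_fun setT (f \o vec) /\ (sqnormL2 p f < +oo)%E.

Definition cvgL2 p (u : nat -> 'cV[R]_k -> R) f : Prop :=
  sqnormL2 p (fun x => u n x - f x) @[n --> \oo] --> 0%E.

Definition unitv (i : 'I_k) : 'cV[R]_k := delta_mx i 0.

Definition grad f (x : 'cV[R]_k) : 'cV[R]_k := \col_i 'D_(unitv i) f x.

Definition hess f (x : 'cV[R]_k) : 'M[R]_k :=
  \matrix_(i, j) 'D_(unitv i) ('D_(unitv j) f) x.

(* C^2 functions with compact support. *)
Definition C2c f : Prop :=
  [/\ exists M : R, forall x : 'cV[R]_k, M < `|x| -> f x = 0,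
      continuous f,
      forall i, (forall x, derivable f x (unitv i)) /\
                continuous ('D_(unitv i) f)
    & forall i j, (forall x, derivable ('D_(unitv j) f) x (unitv i)) /\
                  continuous ('D_(unitv i) ('D_(unitv j) f))].

Definition score p : 'cV[R]_k -> 'cV[R]_k := grad (fun x => ln (p x)).

(* The covariance matrix Sigma = Var_{X ~ p} (grad log p (X)). *)
Definition score_var p : 'M[R]_k :=
  \matrix_(i, j)
    expect p (fun x => (score p x i 0 - expect p (fun y => score p y i 0)) *
                       (score p x j 0 - expect p (fun y => score p y j 0))).

Definition ddot A B : R := \sum_i \sum_j A j i * B i j.

(* G^Lambda as a differential expression, for f of class C^2. *)
Definition gen_expr p Lambda f (x : 'cV[R]_k) : R :=
  let L := (ddot Lambda (score_var p))^-1 *: Lambda in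
  k%:R * (ddot L (hess f x) + ((score p x)^T *m L *m grad f x) 0 0).

(* The graph of the operator G^Lambda on L^2(p): f is in the domain and
   G^Lambda f = g.  As usual for the L^2 generator of a reversible diffusion,
   it is the closure in L^2(p) of the differential expression on compactly
   supported C^2 functions (mollification shows that smooth ones yield the same
   closure).  Elements of L^2(p) are handled through representatives, so g is
   unique up to p-null sets.  sqnormL2 is extended-real valued, so that a
   divergent integral cannot pass for a small distance. *)
Definition gen_graph p Lambda f g : Prop :=
  [/\ inL2 p f, inL2 p g &
      exists phi : nat -> 'cV[R]_k -> R,
        [/\ forall n, C2c (phi n), cvgL2 p phi f
          & cvgL2 p (fun n => gen_expr p Lambda (phi n)) g]].

Definition gap_ineq p Lambda (rho : R) : Prop :=
  forall f g, gen_graph p Lambda f g ->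
    variance_of p f <= - (1 / rho) * expect p (fun x => f x * g x).

Definition is_spectral_gap p Lambda (rho : R) : Prop :=
  [/\ 0 < rho, gap_ineq p Lambda rho
    & forall rho', 0 < rho' -> gap_ineq p Lambda rho' -> rho' <= rho].

Definition spd A : Prop :=
  A^T = A /\ forall x : 'cV[R]_k, x != 0 -> 0 < (x^T *m A *m x) 0 0.

Definition is_min_eigenvalue A (l : R) : Prop :=
  eigenvalue A l /\ forall l', eigenvalue A l' -> l <= l'.

(* The density of N(mu, Gamma); pi is the number. *)
Definition gauss_density (mu : 'cV[R]_k) (Gamma : 'M[R]_k) (x : 'cV[R]_k) : R :=
  (Num.sqrt ((2 * pi) ^+ k * \det Gamma))^-1 *
  expR (- ((x - mu)^T *m invmx Gamma *m (x - mu)) 0 0 / 2).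

End diffusion.

(* Main.v *)
(* Write Gamma = A A^T with A triangular; then X = mu + A Z with Z standard
   normal, and G^Lambda f = kappa (Lambda : hess f - (Gamma^-1 (x - mu))' Lambda grad f)
   with kappa = k / (Lambda : Gamma^-1).  Let m be the least generalised
   eigenvalue of (Lambda, Gamma), Lambda w = m Gamma w.  The spectral gap of
   G^Lambda is kappa m:
   - integration by parts gives - E (f G^Lambda f) = kappa E (grad f' Lambda grad f),
     which is at least kappa m E (grad f' Gamma grad f), hence at least
     kappa m Var f by the Gaussian Poincare inequality; both sides pass to the
     closure in L^2;
   - the linear function w . (x - mu) is in the domain, as a limit of its
     truncations, and is an eigenfunction for - kappa m.
   The Poincare inequality tensorises from dimension one, where it follows from
   Stein's identity.  Since Lambda - m Gamma is positive semidefinite,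
   Lambda : Gamma^-1 >= k m, so the gap is at most 1, its value at Lambda = Gamma;
   at Lambda = I, m is the least eigenvalue of Gamma^-1. *)
Require Import Defs.
From HB Require Import structures.
From mathcomp Require Import all_boot all_order all_algebra.
From mathcomp Require Import all_classical all_reals all_analysis.
From mathcomp Require Import measurable_realfun ring lra.
Set Implicit Arguments.
Unset Strict Implicit.
Unset Printing Implicit Defensive.
Import Order.TTheory GRing.Theory Num.Theory.
Import numFieldNormedType.Exports.
Local Open Scope classical_set_scope.
Local Open Scope ring_scope.

(** The domain of the generator is only known through L^2 limits. The lower bound is therefore
    proved for compactly supported functions, where every integrand is bounded, and transferred
    through the limits of E f^2, E f and E (f g). Sharpness goes the other way: an unbounded
    eigenfunction is approximated so that the functions and their images under the generator both
    converge in L^2. Hence the C^2 cutoff, and pointwise convergence under a uniform polynomial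
    bound as the working notion. Integrability is governed by one weight, exp(|t|^2/8): its square
    is integrable for the standard Gaussian, so a product of two functions below the weight is
    integrable, and the weight exceeds every polynomial up to a constant. Measures on tuples are
    built one coordinate at a time, so the change of variables, Stein's identity and the Poincare
    inequality go by induction on the dimension. Tensorisation rests on projecting F onto sums of a
    function of the head and a function of the tail. The equation for w is read off from a positive
    semidefinite form that vanishes at w. *)

(** * Integration against densities and against iterated product measures *)

(** [g] and the Radon-Nikodym derivative of [nu] have the same integral over every measurable set,
    so they agree almost everywhere. *)
Lemma ge0_integral_density d (T : measurableType d) (R : realType)
    (nu : {finite_measure set T -> \bar R})
    (mu : {sigma_finite_measure set T -> \bar R}) (g : T -> R) (f : T -> \bar R) :
  measurable_fun setT g -> (forall x, 0 <= g x) ->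
  (forall A, measurable A -> nu A = \int[mu]_(x in A) (g x)%:E)%E ->
  measurable_fun setT f -> (forall x, 0 <= f x)%E ->
  (\int[nu]_x f x = \int[mu]_x (f x * (g x)%:E))%E.
Proof.
move=> mg g0 nug mf f0.
have mgE : measurable_fun setT (EFin \o g) by exact/measurable_EFinP.
have nudom : nu `<< mu.
  apply/null_content_dominatesP => A mA muA0; rewrite nug//.
  by apply: null_set_integral => //; exact: measurable_funTS.
rewrite -(Radon_Nikodym_SigmaFinite.change_of_variables nudom)//.
have mrn := Radon_Nikodym_SigmaFinite.f_integrable nudom.
apply: ae_eq_integral => //.
- by apply: emeasurable_funM => //; exact: measurable_int mrn.
- exact: emeasurable_funM.
- apply: ae_eqe_mul2l => /=; apply: integral_ae_eq => //.
  by move=> E _ mE; rewrite -Radon_Nikodym_SigmaFinite.f_integral// nug.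
Qed.

Section measure_cons_integral.
Context d (T : measurableType d) (R : realType) (n : nat).
Variables (m1 : {sigma_finite_measure set T -> \bar R}).
Variable m2 : {sigma_finite_measure set (n.-tuple T) -> \bar R}.

Lemma measurable_tconsP (f : n.+1.-tuple T -> \bar R) :
  measurable_fun setT f -> measurable_fun setT (fun p => f (@tcons _ T n p)).
Proof. by move=> mf; apply: measurableT_comp => //; exact: measurable_tcons. Qed.

Lemma ge0_integral_measure_cons (f : n.+1.-tuple T -> \bar R) :
  measurable_fun setT f -> (forall t, 0 <= f t)%E ->
  (\int[measure_cons m1 m2]_t f t = \int[m1]_x \int[m2]_t f (tcons (x, t)))%E.
Proof.
move=> mf f0.
transitivity (\int[(m1 \x m2)%E]_p f (tcons p))%E.
  rewrite [LHS](ge0_integral_pushforward (@measurable_tcons _ T n))//.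
by rewrite fubini_tonelli1//; exact: measurable_tconsP.
Qed.

Lemma ge0_integral_measure_cons' (f : n.+1.-tuple T -> \bar R) :
  measurable_fun setT f -> (forall t, 0 <= f t)%E ->
  (\int[measure_cons m1 m2]_t f t = \int[m2]_t \int[m1]_x f (tcons (x, t)))%E.
Proof.
move=> mf f0; rewrite ge0_integral_measure_cons//.
by apply: (fubini_tonelli (fun p => f (tcons p))) => //; exact: measurable_tconsP.
Qed.

Lemma integrable_measure_cons (f : n.+1.-tuple T -> \bar R) :
  (measure_cons m1 m2).-integrable setT f ->
  (m1 \x m2)%E.-integrable setT (fun p => f (tcons p)).
Proof.
move=> intf; have mf := measurable_int _ intf.
apply/integrableP; split; first exact: measurable_tconsP.
move/integrableP : intf => [_]; apply: le_lt_trans.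
rewrite [leRHS](ge0_integral_pushforward (@measurable_tcons _ T n))//.
exact: measurableT_comp.
Qed.

Lemma integrable_measure_consP (f : n.+1.-tuple T -> \bar R) :
  (measure_cons m1 m2).-integrable setT f ->
  (\int[measure_cons m1 m2]_t f t = \int[(m1 \x m2)%E]_p f (tcons p))%E.
Proof.
move=> intf; have mf := measurable_int _ intf.
rewrite [LHS](integral_pushforward (@measurable_tcons _ T n))//.
exact: integrable_measure_cons.
Qed.

(** Fubini alone gives integrable slices almost everywhere. Assuming it for every slice makes each
    inner integral finite, so [fine] can be moved inside pointwise. *)
Lemma Rintegral_measure_cons (f : n.+1.-tuple T -> R) :
  (measure_cons m1 m2).-integrable setT (EFin \o f) ->
  (forall x, m2.-integrable setT (fun t => (f (tcons (x, t)))%:E)) ->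
  \int[measure_cons m1 m2]_t f t = \int[m1]_x \int[m2]_t f (tcons (x, t)).
Proof.
move=> intf intx; rewrite /Rintegral integrable_measure_consP//.
rewrite -integral12_prod_meas1; last exact: (integrable_measure_cons intf).
congr fine; apply: eq_integral => x _; rewrite fineK//.
exact: integrable_fin_num.
Qed.

Lemma Rintegral_measure_cons' (f : n.+1.-tuple T -> R) :
  (measure_cons m1 m2).-integrable setT (EFin \o f) ->
  (forall t, m1.-integrable setT (fun x => (f (tcons (x, t)))%:E)) ->
  \int[measure_cons m1 m2]_t f t = \int[m2]_t \int[m1]_x f (tcons (x, t)).
Proof.
move=> intf intx; rewrite /Rintegral integrable_measure_consP//.
rewrite -integral21_prod_meas1; last exact: (integrable_measure_cons intf).
congr fine; apply: eq_integral => x _; rewrite fineK//.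
exact: integrable_fin_num.
Qed.
End measure_cons_integral.

(** * The standard Gaussian measure on tuples and its exponential moments *)

Section gaussian_tuple.
Variable R : realType.
Notation RT := (measurableTypeR R).

Definition gauss1 : probability RT R := normal_prob 0 1.

Fixpoint gauss_tuple (n : nat) :
    {sigma_finite_measure set (n.-tuple RT) -> \bar R} :=
  match n with
  | 0 => @dirac _ (0.-tuple RT) [tuple] R
  | n'.+1 => measure_cons gauss1 (gauss_tuple n')
  end.

Lemma gauss_tuple_setT n : gauss_tuple n setT = 1%E.
Proof.
elim: n => [|n IH] /=; first exact: diracT.
transitivity ((gauss1 \x gauss_tuple n)%E setT) => //.
rewrite -setXTT product_measure1E//= IH mule1.
exact: probability_setT.
Qed.

Lemma ge0_integral_gauss1 (f : RT -> \bar R) :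
  measurable_fun setT f -> (forall x, 0 <= f x)%E ->
  (\int[gauss1]_x f x = \int[lebesgue_measure]_x (f x * (normal_pdf 0 1 x)%:E))%E.
Proof.
move=> mf f0; apply: ge0_integral_density => //.
- exact: measurable_normal_pdf.
- by move=> x; exact: normal_pdf_ge0.
Qed.

(** The integrand times the density is a multiple of exp(x^2/4 - x^2/2) = exp(-x^2/4), hence of the
    normal density of variance 2; the factor is the ratio of the two peaks. *)
Lemma integral_exp_gauss1_lty :
  (\int[gauss1]_x (expR (x ^+ 2 / 8) ^+ 2)%:E < +oo)%E.
Proof.
rewrite ge0_integral_gauss1; first last.
- by move=> x; rewrite lee_fin sqr_ge0.
- apply/measurable_EFinP/measurable_funX/measurableT_comp => //.
  by apply: measurable_funM => //; apply: measurable_funX.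
have s20 : Num.sqrt 2 != 0 :> R by rewrite gt_eqF ?sqrtr_gt0.
pose c : R := normal_peak 1 / normal_peak (Num.sqrt 2).
rewrite [ltLHS](_ : _ = \int[lebesgue_measure]_x
    (c%:E * (normal_pdf 0 (Num.sqrt 2) x)%:E))%E; last first.
  apply: eq_integral => x _; rewrite -!EFinM; congr _%:E.
  rewrite !normal_pdfE ?oner_eq0// /c [in RHS]mulrA divfK; last first.
    by rewrite gt_eqF// normal_peak_gt0.
  rewrite mulrCA; congr (_ * _).
  rewrite /normal_fun -expRM_natl -expRD; congr expR.
  rewrite sqr_sqrtr// subr0 expr1n; by field.
rewrite [ltLHS](_ : _ = c%:E) ?ltry//.
rewrite -[RHS]mule1 -(integral_normal_pdf 0 (Num.sqrt 2)).
exact: (integralZl _ (integrable_normal_pdf 0 (Num.sqrt 2)) c).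
Qed.

(** This is exp(|t|^2/8), written as a product so that it splits along [tcons]. *)
Definition weight n (t : n.-tuple RT) : R := \prod_(i < n) expR (tnth t i ^+ 2 / 8).

Lemma weight_cons n x (t : n.-tuple RT) :
  weight (tcons (x, t)) = expR (x ^+ 2 / 8) * weight t.
Proof.
rewrite /weight big_ord_recl; congr (_ * _); apply: eq_bigr => i _.
by rewrite tnthS.
Qed.

Lemma weight_ge1 n (t : n.-tuple RT) : 1 <= weight t.
Proof.
rewrite /weight; elim/big_ind : _ => //= [x y x1 y1|i _].
  by rewrite -[1]mulr1 ler_pM.
by rewrite -expR0 ler_expR divr_ge0 ?sqr_ge0.
Qed.

Lemma weight_ge0 n (t : n.-tuple RT) : 0 <= weight t.
Proof. exact: le_trans (weight_ge1 t). Qed.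

Lemma measurable_weight n : measurable_fun setT (@weight n).
Proof.
apply: measurable_prod => i _; apply: measurableT_comp => //.
apply: measurable_funM => //; apply: measurable_funX.
exact: measurable_tnth.
Qed.

Lemma integral_weight_lty n :
  (\int[gauss_tuple n]_t ((weight t) ^+ 2)%:E < +oo)%E.
Proof.
have mw m : measurable_fun setT (fun t : m.-tuple RT => ((weight t) ^+ 2)%:E).
  by apply/measurable_EFinP; apply: measurable_funX; exact: measurable_weight.
elim: n => [|n IH].
  rewrite [ltLHS](_ : _ = ((weight (nil_tuple RT)) ^+ 2)%:E) ?ltry//=.
  rewrite [LHS](integral_dirac _ measurableT (mw 0%N)) -[RHS]mul1e; congr (_ * _)%E; exact: diracT.
rewrite /= ge0_integral_measure_cons//; last first.
  by move=> t; rewrite lee_fin sqr_ge0.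
rewrite (eq_integral (fun x : RT => (expR ((x : R) ^+ 2 / 8) ^+ 2)%:E *
    \int[gauss_tuple n]_t (weight t ^+ 2)%:E)%E); last first.
  move=> x _; rewrite -ge0_integralZl//.
  - by apply: eq_integral => t _; rewrite weight_cons exprMn EFinM.
  - exact: mw.
  - by move=> *; rewrite lee_fin sqr_ge0.
rewrite /= ge0_integralZr//=.
- have i0 : (0 <= \int[gauss1]_x (expR (x ^+ 2 / 8) ^+ 2)%:E)%E.
    by apply: integral_ge0 => x _; rewrite lee_fin sqr_ge0.
  apply: lte_mul_pinfty => //; rewrite ge0_fin_numE//.
  exact: integral_exp_gauss1_lty.
- apply/measurable_EFinP; apply: measurable_funX; apply: measurableT_comp => //.
  by apply: measurable_funM => //; apply: measurable_funX.
- by apply: integral_ge0 => x _; rewrite lee_fin sqr_ge0.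
Qed.
End gaussian_tuple.

(** * Stein's identity in dimension one *)

Section stein1.
Variable R : realType.
Notation RT := (measurableTypeR R).
Implicit Types f g : RT -> R.

(** A growth class containing the constants and the identity, and such that the product of two
    members is integrable. Stein's identity needs the latter for x times f. *)
Definition dominated1 (f : RT -> R) :=
  measurable_fun setT f /\ exists C : R, forall x : R, `|f x| <= C * expR (x ^+ 2 / 8).

Lemma measurable_exp_sqr : measurable_fun setT (fun x : RT => expR ((x : R) ^+ 2 / 8) : R).
Proof.
by apply: measurableT_comp => //; apply: measurable_funM => //; exact: measurable_funX.
Qed.

Lemma integrable_exp_sqr_gauss1 :
  (@gauss1 R).-integrable setT (fun x : RT => (expR ((x : R) ^+ 2 / 8) ^+ 2)%:E).
Proof.
apply/integrableP; split.
  by apply/measurable_EFinP; apply: measurable_funX; exact: measurable_exp_sqr.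
under eq_integral do rewrite gee0_abs ?lee_fin ?sqr_ge0//.
exact: integral_exp_gauss1_lty.
Qed.

Lemma dominated1_mul_integrable f g : dominated1 f -> dominated1 g ->
  (@gauss1 R).-integrable setT (fun x => (f x * g x)%:E).
Proof.
move=> [mf [C hC]] [mg [D hD]].
apply: (@le_integrable _ _ _ (@gauss1 R) _ _ _
    (fun x : RT => ((C * D)%:E * (expR ((x : R) ^+ 2 / 8) ^+ 2)%:E)%E)) => //.
- by apply/measurable_EFinP; exact: measurable_funM.
- move=> x _ /=; rewrite lee_fin normrM [leRHS]ger0_norm; last first.
    rewrite mulr_ge0 ?sqr_ge0// mulr_ge0//.
    + by have := le_trans (normr_ge0 _) (hC x); rewrite pmulr_lge0// expR_gt0.
    + by have := le_trans (normr_ge0 _) (hD x); rewrite pmulr_lge0// expR_gt0.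
  by rewrite expr2 mulrACA ler_pM.
- apply: integrableZl => //; exact: integrable_exp_sqr_gauss1.
Qed.

Lemma dominated1_cst (c : R) : dominated1 (cst c).
Proof.
split => //; exists `|c| => x; rewrite -[leLHS]mulr1 ler_wpM2l//.
by rewrite -expR0 ler_expR divr_ge0// sqr_ge0.
Qed.

Lemma dominated1_id : dominated1 id.
Proof.
(* The constant 8 clears the denominator: |x| <= 8 + x^2 = 8 (1 + x^2/8) <= 8 exp(x^2/8). *)
split => //; exists 8 => x; apply: (@le_trans _ _ (8 * (1 + x ^+ 2 / 8))).
  have [x0|x0] := lerP 0 x; [rewrite ger0_norm//|rewrite ltr0_norm//]; nra.
by rewrite ler_wpM2l//; exact: expR_ge1Dx.
Qed.

Lemma dominated1_integrable f : dominated1 f ->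
  (@gauss1 R).-integrable setT (fun x => (f x)%:E).
Proof.
move=> df; have := dominated1_mul_integrable df (dominated1_cst 1).
by apply: eq_integrable => // x _ /=; rewrite mulr1.
Qed.

Lemma is_derive_normal_pdf (x : R) :
  is_derive x 1 (normal_pdf 0 1 : R -> R) (- x * normal_pdf 0 1 x).
Proof.
rewrite normal_pdfE ?oner_eq0// /normal_fun.
apply: is_derive_eq.
rewrite /GRing.scale /= !mulr0 subr0 add0r expr1n; by field.
Qed.

Lemma measurable_normal_pdfE :
  measurable_fun setT (fun x : RT => (normal_pdf 0 1 x)%:E).
Proof. by apply/measurable_EFinP; exact: measurable_normal_pdf. Qed.

Lemma integrable_gauss1 (f : RT -> \bar R) : (gauss1 R).-integrable setT f ->
  (@lebesgue_measure R).-integrable setT (fun x => f x * (normal_pdf 0 1 x)%:E)%E.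
Proof.
move=> /integrableP[mf]; rewrite ge0_integral_gauss1//; last exact: measurableT_comp.
move=> fi; apply/integrableP; split.
  by apply: emeasurable_funM => //; exact: measurable_normal_pdfE.
apply: le_lt_trans fi; rewrite le_eqVlt; apply/orP; left; apply/eqP.
by apply: eq_integral => x _; rewrite abseM [`|_%:E|%E]gee0_abs// lee_fin normal_pdf_ge0.
Qed.

Lemma integral_gauss1 (f : RT -> \bar R) : (gauss1 R).-integrable setT f ->
  (\int[gauss1 R]_x f x = \int[lebesgue_measure]_x (f x * (normal_pdf 0 1 x)%:E))%E.
Proof.
move=> intf; have mf := measurable_int _ intf.
rewrite integralE !ge0_integral_gauss1//; first last.
- exact: measurable_funepos.
- exact: measurable_funeneg.
rewrite -(@integralB _ _ _ (@lebesgue_measure R))//; first last.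
- exact: (integrable_gauss1 (integrable_funeneg measurableT intf)).
- exact: (integrable_gauss1 (integrable_funepos measurableT intf)).
apply: eq_integral => x _.
rewrite [in RHS](funeposneg f) muleBl//.
exact: add_def_funeposneg.
Qed.

(** The boundary terms of the integration by parts; the sign [e] treats both ends at once. *)
Lemma dominated1_mul_pdf_cvg0 (f : RT -> R) (e : R) : dominated1 f -> `|e| = 1 ->
  f (e * n%:R) * normal_pdf 0 1 (e * n%:R : R) @[n --> \oo] --> (0 : R).
Proof.
move=> [_ [C hC]] e1; apply/norm_cvg0P.
have C0 : 0 <= C by have := le_trans (normr_ge0 _) (hC 0); rewrite pmulr_lge0// expR_gt0.
have k0 := normal_peak_ge0 (1 : R).
(* The product decays like exp(n^2/8 - n^2/2) = exp(-3 n^2/8), and exp(3 n^2/8) >= 1 + 3 n^2/8 >= (n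
   + 1)/3 accounts for the factor 3. *)
apply: (@squeeze_cvgr _ _ _ _ (cst 0) (fun n => C * normal_peak 1 * 3 * n.+1%:R^-1)).
- apply: nearW => n; rewrite normr_ge0/= normrM [`|normal_pdf _ _ _|]ger0_norm ?normal_pdf_ge0//.
  rewrite normal_pdfE ?oner_eq0// /normal_fun subr0.
  have en : (e * n%:R) ^+ 2 = n%:R ^+ 2 :> R.
    by rewrite exprMn -[e ^+ 2]real_normK ?num_real// e1 expr1n mul1r.
  rewrite en (_ : - n%:R ^+ 2 / _ = - (n%:R ^+ 2 / 2)); last by rewrite expr1n; field.
  apply: (@le_trans _ _ (C * expR (n%:R ^+ 2 / 8) * (normal_peak 1 * expR (- (n%:R ^+ 2 / 2))))).
    by rewrite ler_wpM2r ?mulr_ge0 ?expR_ge0// -en.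
  rewrite mulrACA -expRD -[leRHS]mulrA ler_wpM2l ?mulr_ge0//.
  rewrite (_ : _ + _ = - (3 * n%:R ^+ 2 / 8)); last by field.
  rewrite expRN (_ : 3 * _^-1 = (n.+1%:R / 3)^-1); last by rewrite invf_div.
  rewrite lef_pV2 ?posrE ?expR_gt0 ?divr_gt0//.
  apply: le_trans (expR_ge1Dx _); rewrite -natr1; set a := n%:R; nra.
- exact: cvg_cst.
- rewrite -[X in _ --> X](mulr0 (C * normal_peak 1 * 3)); apply: cvgM; first exact: cvg_cst.
  exact: cvg_harmonic.
Qed.

Lemma continuous_of_is_derive (f f' : R -> R) :
  (forall x : R, is_derive x 1 f (f' x)) -> continuous f.
Proof.
move=> df x; apply: differentiable_continuous; apply/derivable1_diffP.
by have [] := df x.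
Qed.

(** With p the normal density, (f p)' = (f' - x f) p. Its integral over [-n, n] is a difference of
    boundary terms, which tends to 0, and by dominated convergence it also tends to the integral
    over the line. *)
Lemma stein1 (f f' : R -> R) : dominated1 f -> dominated1 f' ->
  (forall x : R, is_derive x 1 f (f' x)) -> continuous f' ->
  \int[gauss1 R]_x f' x = \int[gauss1 R]_x (x * f x).
Proof.
move=> domf domf' df cf'.
have cf := continuous_of_is_derive df.
have ixf := dominated1_mul_integrable dominated1_id domf.
have if' := dominated1_integrable domf'.
apply/eqP; rewrite -subr_eq0 -RintegralB//; apply/eqP.
set h := fun x : R => f' x - x * f x.
have ih : (gauss1 R).-integrable setT (EFin \o h).
  by have := integrableB measurableT if' ixf; apply: eq_integrable.
rewrite /Rintegral (integral_gauss1 ih).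
pose p : R -> R := normal_pdf 0 1.
pose F : R -> R := fun x => f x * p x.
pose H : R -> R := fun x => h x * p x.
have iH : (@lebesgue_measure R).-integrable setT (EFin \o H).
  by have := integrable_gauss1 ih; apply: eq_integrable.
have mH : measurable_fun setT (fun x : RT => (H x)%:E) by move/integrableP : iH => [].
have cp : continuous p by apply: continuous_normal_pdf; exact: oner_neq0.
have cH : continuous H.
  by move=> x; apply: cvgM (cp x); apply: cvgB (cf' x) _; apply: cvgM (cf x).
have dF (x : R) : is_derive x 1 F (H x).
  have dp := is_derive_normal_pdf x; have dfx := df x.
  by apply: is_derive_eq; rewrite /GRing.scale /= /H /h -/(p x); ring.
have cF := continuous_of_is_derive dF.
pose A (n : nat) : set RT := `[- n%:R, n%:R]%classic.
have FTC (n : nat) : (0 < n)%N ->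
    (\int[lebesgue_measure]_(x in A n) (H x)%:E =
     (F n%:R%R)%:E - (F (- n%:R)%R)%:E)%E.
  move=> n0; apply: continuous_FTC2.
  - by rewrite gtrN// ltr0n.
  - exact: continuous_subspaceT.
  - split => [x _|//|//]; first by have [] := dF x.
    + exact/cvg_at_right_filter/cF.
    + exact/cvg_at_left_filter/cF.
  - by move=> x _; rewrite derive1E; have [] := dF x.
have lim0 : (\int[lebesgue_measure]_(x in A n) (H x)%:E)%E @[n --> \oo] --> 0%E.
  (* The shift discards n = 0, for which the interval is degenerate and [FTC] does not apply. *)
  rewrite -cvg_shiftS /=.
  under eq_fun do rewrite FTC//.
  suff : ((F n.+1%:R%R)%:E - (F (- n.+1%:R)%R)%:E)%E @[n --> \oo] --> (0%:E - 0%:E)%E.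
    by rewrite subee.
  apply: cvgeB => //; apply/fine_cvgP; split; try exact: nearW.
  - have := dominated1_mul_pdf_cvg0 domf (normr1 R).
    rewrite -cvg_shiftS/=; by under eq_fun do rewrite mul1r.
  - have : `|-1| = 1 :> R by rewrite normrN normr1.
    move/(dominated1_mul_pdf_cvg0 domf); rewrite -cvg_shiftS/=.
    by under eq_fun do rewrite mulN1r.
have limH : (\int[lebesgue_measure]_(x in A n) (H x)%:E)%E @[n --> \oo] -->
    (\int[lebesgue_measure]_x (H x)%:E)%E.
  under eq_fun do rewrite integral_mkcond.
  apply: (@dominated_cvg _ _ _ (@lebesgue_measure R) setT measurableT
    _ _ (fun x => `|(H x)%:E|%E)) => //.
  - move=> n; apply/(measurable_restrictT _ (measurable_itv `[- n%:R, n%:R])).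
    by apply: measurable_funTS; exact: mH.
  - move=> x _; apply: cvg_near_cst; near=> n.
    rewrite patchE mem_set// /A /= in_itv/= -ler_norml.
    by near: n; exact: nbhs_infty_ger.
  - exact: integrable_abse.
  - move=> n x _; rewrite patchE; case: ifP => // _.
    by rewrite abse0 abse_ge0.
by rewrite -[RHS]/(fine 0%E); congr fine; apply: cvg_unique limH lim0.
Unshelve. all: by end_near. Qed.
End stein1.

(** * Bounded measurable functions under a measure of total mass one *)

Section bounded_measurable.
Context d (T : measurableType d) (R : realType).
Implicit Types f g : T -> R.

Definition bounded_mfun f :=
  measurable_fun setT f /\ exists B : R, forall t, `|f t| <= B.

Lemma bounded_mfun_cst (c : R) : bounded_mfun (cst c).
Proof. by split => //; exists `|c|. Qed.

Lemma bounded_mfunD f g : bounded_mfun f -> bounded_mfun g ->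
  bounded_mfun (fun t => f t + g t).
Proof.
move=> [mf [B hB]] [mg [C hC]]; split; first exact: measurable_funD.
by exists (B + C) => t; rewrite (le_trans (ler_normD _ _))// lerD.
Qed.

Lemma bounded_mfunM f g : bounded_mfun f -> bounded_mfun g ->
  bounded_mfun (fun t => f t * g t).
Proof.
move=> [mf [B hB]] [mg [C hC]]; split; first exact: measurable_funM.
by exists (B * C) => t; rewrite normrM ler_pM.
Qed.

Lemma bounded_mfunB f g : bounded_mfun f -> bounded_mfun g ->
  bounded_mfun (fun t => f t - g t).
Proof.
move=> [mf [B hB]] [mg [C hC]]; split; first exact: measurable_funB.
by exists (B + C) => t; rewrite (le_trans (ler_normB _ _))// lerD.
Qed.

Lemma bounded_mfunX f n : bounded_mfun f -> bounded_mfun (fun t => f t ^+ n).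
Proof.
move=> [mf [B hB]]; split; first exact: measurable_funX.
by exists (B ^+ n) => t; rewrite normrX lerXn2r// ?nnegrE// (le_trans _ (hB t)).
Qed.

Lemma bounded_mfun_sum (I : Type) (r : seq I) (f : I -> T -> R) :
  (forall i, bounded_mfun (f i)) -> bounded_mfun (fun t => \sum_(i <- r) f i t).
Proof.
move=> bf; elim: r => [|i r IH].
  by under eq_fun do rewrite big_nil; exact: bounded_mfun_cst.
by under eq_fun do rewrite big_cons; exact: bounded_mfunD.
Qed.

Variable mu : {measure set T -> \bar R}.
Hypothesis mu1 : mu setT = 1%E.

Lemma bounded_mfun_integrable f : bounded_mfun f -> mu.-integrable setT (EFin \o f).
Proof.
move=> [mf [B hB]]; apply: (@le_integrable _ _ _ mu _ _ _ (cst B%:E)) => //.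
- exact/measurable_EFinP.
- by move=> t _ /=; rewrite lee_fin (le_trans (hB t))// ler_norm.
- apply/integrableP; split => //; rewrite integral_cst//= mu1 mule1 ltry//.
Qed.

Lemma Rintegral_cst1 (c : R) : \int[mu]_t c = c.
Proof. by rewrite Rintegral_cst// mu1 mulr1. Qed.

Lemma bounded_Rintegral_norm_le f B : bounded_mfun f -> (forall t, `|f t| <= B) ->
  `|\int[mu]_t f t| <= B.
Proof.
move=> bf hB; apply: (le_trans (le_normr_Rintegral _ _)) => //.
  exact: bounded_mfun_integrable.
rewrite -[leRHS]Rintegral_cst1; apply: le_Rintegral => //.
- have := integrable_norm (bounded_mfun_integrable bf); exact.
- exact: bounded_mfun_integrable (bounded_mfun_cst B).
Qed.

Lemma RintegralD1 f g : bounded_mfun f -> bounded_mfun g ->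
  \int[mu]_t (f t + g t) = \int[mu]_t f t + \int[mu]_t g t.
Proof. by move=> bf bg; rewrite RintegralD//; exact: bounded_mfun_integrable. Qed.

Lemma RintegralB1 f g : bounded_mfun f -> bounded_mfun g ->
  \int[mu]_t (f t - g t) = \int[mu]_t f t - \int[mu]_t g t.
Proof. by move=> bf bg; rewrite RintegralB//; exact: bounded_mfun_integrable. Qed.

Lemma RintegralZl1 f (c : R) : bounded_mfun f ->
  \int[mu]_t (c * f t) = c * \int[mu]_t f t.
Proof. by move=> bf; rewrite RintegralZl//; exact: bounded_mfun_integrable. Qed.

Lemma le_Rintegral1 f g : bounded_mfun f -> bounded_mfun g ->
  (forall t, f t <= g t) -> \int[mu]_t f t <= \int[mu]_t g t.
Proof. by move=> bf bg fg; apply: le_Rintegral => //; exact: bounded_mfun_integrable. Qed.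

Lemma Rintegral_sum1 (I : Type) (r : seq I) (f : I -> T -> R) :
  (forall i, bounded_mfun (f i)) ->
  \int[mu]_t (\sum_(i <- r) f i t) = \sum_(i <- r) \int[mu]_t f i t.
Proof.
move=> bf; elim: r => [|i r IH].
  by rewrite big_nil; under eq_Rintegral do rewrite big_nil; rewrite Rintegral_cst1.
rewrite big_cons -IH -RintegralD1//; last exact: bounded_mfun_sum.
by apply: eq_Rintegral => t _; rewrite big_cons.
Qed.

End bounded_measurable.

Lemma is_deriveP (R : numFieldType) (V W : normedModType R) (f : V -> W) (x v : V) (d : W) :
  is_derive x v f d <-> h^-1 *: (f (h *: v + x) - f x) @[h --> 0^'] --> d.
Proof.
split => [[df <-]|cd]; first exact: df.
by apply: DeriveDef; [apply/cvg_ex; exists d|exact: cvg_lim].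
Qed.

(** * The Gaussian Poincare inequality in dimension one *)

Section poincare1.
Variable R : realType.
Notation RT := (measurableTypeR R).

Lemma bounded_mfun_dominated1 (f : RT -> R) : bounded_mfun f -> dominated1 f.
Proof.
move=> [mf [B hB]]; split => //; exists B => x; apply: (le_trans (hB x)).
rewrite ler_peMr ?(le_trans _ (hB x))//.
by rewrite -expR0 ler_expR divr_ge0// sqr_ge0.
Qed.

(* Stein's identity for q = (f - f 0)^2 / x: with k = (f - f 0) / x one has
   q' = 2 k f' - k^2 <= f'^2, and x q = (f - f 0)^2. *)
Lemma poincare1 (f f' : R -> R) (B : R) :
  (exists C, forall x, `|f x| <= C) -> (forall x, `|f' x| <= B) ->
  (forall x : R, is_derive x 1 f (f' x)) -> continuous f' ->
  \int[gauss1 R]_x (f x ^+ 2) - (\int[gauss1 R]_x f x) ^+ 2 <=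
  \int[gauss1 R]_x (f' x ^+ 2).
Proof.
move=> bf bf' df cf'.
have cf := continuous_of_is_derive df.
have P1 : gauss1 R setT = 1%E by exact: probability_setT.
pose u (x : R) : R := f x - f 0.
(* The value at 0 is the limit of the difference quotient, which makes [k] continuous. *)
pose k (x : R) : R := if x == 0 then f' 0 else u x / x.
pose q (x : R) : R := u x ^+ 2 / x.
pose q' (x : R) : R := 2 * k x * f' x - k x ^+ 2.
have du (x : R) : is_derive x 1 u (f' x).
  by have dfx := df x; apply: is_derive_eq; rewrite subr0.
have u0 : u 0 = 0 by rewrite /u subrr.
have cu := continuous_of_is_derive du.
have k_near (x : R) : x != 0 -> \forall y \near x, k y = u y / y.
  move=> x0; have : \forall y \near x, y != 0.
    by apply: open_nbhs_nbhs; split => //; exact: open_neq.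
  by apply: filterS => y /negPf y0; rewrite /k y0.
have k0 : k h @[h --> 0^'] --> f' 0.
  have /is_deriveP := du 0; apply: cvg_trans; apply: near_eq_cvg.
  near=> h; have h0 : h != 0 by near: h; exact: nbhs_dnbhs_neq.
  by rewrite /k (negPf h0) u0 subr0 addr0 /GRing.scale /= mulr1 mulrC.
have ck : continuous k.
  move=> x; have [->|x0] := eqVneq x 0.
    by apply/continuous_withinNx; rewrite [k 0]/k eqxx.
  rewrite /continuous_at [k x]/k (negPf x0).
  have : u y / y @[y --> x] --> u x / x by apply: cvgM; [exact: cu|exact: cvgV].
  apply: cvg_trans; apply: near_eq_cvg; near=> y.
  by near: y; apply: filterS (k_near x x0) => y ->.
have uk (x : R) : u x = x * k x.
  by rewrite /k; case: eqVneq => [->|x0]; rewrite ?u0 ?mul0r// mulrC divfK.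
have dq (x : R) : is_derive x 1 q (q' x).
  have [->|x0] := eqVneq x 0.
    (* Since q 0 = 0, the difference quotient of [q] at 0 is k(h)^2, with limit f'(0)^2 = 2 f'(0)^2
       - f'(0)^2. *)
    apply/is_deriveP; rewrite (_ : q' 0 = f' 0 ^+ 2); last first.
      by rewrite /q' /k eqxx; ring.
    have : k h * k h @[h --> 0^'] --> f' 0 * f' 0 by exact: cvgM.
    apply: cvg_trans; apply: near_eq_cvg; near=> h.
    have h0 : h != 0 by near: h; exact: nbhs_dnbhs_neq.
    rewrite /q u0 expr0n/= mul0r subr0 addr0 /GRing.scale /= mulr1 uk.
    by field.
  have dux := du x; have dV := is_deriveV x0 (is_derive_id x 1).
  apply: is_derive_eq; rewrite /GRing.scale /= /q' /k (negPf x0); by field.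
(* By the mean value theorem a slope of [f] is a value of [f']. *)
have kB (x : R) : `|k x| <= B.
  rewrite /k; case: eqVneq => [_|x0]; first exact: bf'.
  rewrite normrM normfV ler_pdivrMr ?normr_gt0//.
  have cw a b : {within `[a, b], continuous f} by exact: continuous_subspaceT.
  have [x1|x1|x1] := ltgtP x 0; last by rewrite x1 eqxx in x0.
  - have [c _ E] := MVT x1 (fun y _ => df y) (cw _ _).
    by rewrite /u -opprB normrN E normrM sub0r normrN ler_wpM2r.
  - have [c _ E] := MVT x1 (fun y _ => df y) (cw _ _).
    by rewrite /u E normrM subr0 ler_wpM2r.
have cmeas (g : R -> R) : continuous g -> measurable_fun setT (g : RT -> R).
  by move=> cg; exact: continuous_measurable_fun.
have bk : @bounded_mfun _ RT _ k by split; [exact: cmeas|exists B].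
have bf'' : @bounded_mfun _ RT _ f' by split; [exact: cmeas|exists B].
have bff : @bounded_mfun _ RT _ f by split; [exact: cmeas|].
have bu : @bounded_mfun _ RT _ u.
  exact: bounded_mfunB bff (bounded_mfun_cst _ _).
have bq' : @bounded_mfun _ RT _ q'.
  apply: bounded_mfunB; last exact: bounded_mfunX.
  by apply: bounded_mfunM => //; apply: bounded_mfunM => //; exact: bounded_mfun_cst.
(* [q] itself is k^2 x, so it grows at most linearly. *)
have domq : dominated1 q.
  have [_ [C hC]] := @dominated1_id R.
  split; first by apply: cmeas; exact: continuous_of_is_derive dq.
  exists (B ^+ 2 * C) => x; rewrite (_ : q x = k x ^+ 2 * x); last first.
    by rewrite /q uk; have [->|x0] := eqVneq x 0; [rewrite !mul0r mulr0 expr0n mul0r|field].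
  by rewrite normrM -mulrA ler_pM// normrX lerXn2r// nnegrE// (le_trans _ (kB 0)).
have cq' : continuous q'.
  move=> x; apply: cvgB; last by rewrite expr2; apply: cvgM; exact: ck.
  apply: cvgM; [apply: cvgM; [exact: cvg_cst|exact: ck]|exact: cf'].
have := stein1 domq (bounded_mfun_dominated1 bq') dq cq'.
under [in RHS]eq_Rintegral => x _.
  rewrite (_ : x * q x = u x ^+ 2); last first.
    by rewrite /q; have [->|x0] := eqVneq (x : R) 0; [rewrite mul0r u0 expr0n|field].
  over.
move=> E.
(* 2 k f' - k^2 = f'^2 - (f' - k)^2. *)
have uq : \int[gauss1 R]_x (u x ^+ 2) <= \int[gauss1 R]_x (f' x ^+ 2).
  rewrite -E; apply: le_Rintegral1 => //; first exact: bounded_mfunX.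
  by move=> x; rewrite /q'; have := sqr_ge0 (f' x - k x); lra.
(* The variance is at most the mean square distance to any constant, here to f 0. *)
apply: le_trans uq.
set c := f 0.
have -> : \int[gauss1 R]_x (u x ^+ 2) =
    \int[gauss1 R]_x (f x ^+ 2 - (2 * c) * f x + c ^+ 2).
  by apply: eq_Rintegral => x _; rewrite /u -/c; ring.
have bc := bounded_mfun_cst RT; have b2 := bounded_mfunX 2 bff.
have bcf := bounded_mfunM (bc _ (2 * c)) bff.
rewrite (RintegralD1 P1 (bounded_mfunB b2 bcf) (bc _ (c ^+ 2))).
rewrite (RintegralB1 P1 b2 bcf) (RintegralZl1 P1 _ bff) (Rintegral_cst1 P1).
by have := sqr_ge0 (\int[gauss1 R]_x f x - c); lra.
Unshelve. all: by end_near. Qed.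
End poincare1.

(** * Stein's identity and the Poincare inequality for the standard Gaussian in n dimensions *)

Section gauss_tuple_calculus.
Variable R : realType.
Notation RT := (measurableTypeR R).

Definition upd n (t : n.-tuple RT) (i : 'I_n) (s : RT) : n.-tuple RT :=
  [tuple if j == i then s else tnth t j | j < n].

Lemma upd_cons0 n x (t : n.-tuple RT) s : upd (tcons (x, t)) ord0 s = tcons (s, t).
Proof.
apply: eq_from_tnth => j; rewrite tnth_mktuple.
by have [j'|] := unliftP ord0 j; [move=> ->; rewrite !tnthS|move=> ->].
Qed.

Lemma upd_consS n x (t : n.-tuple RT) i s :
  upd (tcons (x, t)) (lift ord0 i) s = tcons (x, upd t i s).
Proof.
apply: eq_from_tnth => j; rewrite tnth_mktuple.
have [j'|] := unliftP ord0 j; last by move=> ->.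
by move=> ->; rewrite !tnthS tnth_mktuple (inj_eq lift_inj).
Qed.

(* F has the partial derivative F' in the direction i, continuous in the i-th
   variable. *)
Definition partial n (i : 'I_n) (F F' : n.-tuple RT -> R) := forall t,
  (forall s : R, is_derive s 1 (fun r : R => F (upd t i r)) (F' (upd t i s))) /\
  continuous (fun s : R => F' (upd t i s)).

Lemma partial_cons0 n (F F' : n.+1.-tuple RT -> R) (t : n.-tuple RT) :
  partial ord0 F F' ->
  (forall s : R, is_derive s 1 (fun r : R => F (tcons (r : RT, t))) (F' (tcons (s : RT, t)))) /\
  continuous (fun s : R => F' (tcons (s : RT, t))).
Proof.
move=> /(_ (tcons (0 : RT, t)))[dF cF']; split.
  move=> s; have := dF s; rewrite upd_cons0.
  by under eq_fun do rewrite upd_cons0.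
by move: cF'; under eq_fun do rewrite upd_cons0.
Qed.

Lemma partial_consS n (F F' : n.+1.-tuple RT -> R) i x : partial (lift ord0 i) F F' ->
  partial i (fun t : n.-tuple RT => F (tcons (x, t))) (fun t => F' (tcons (x, t))).
Proof.
move=> pF t; have [dF cF'] := pF (tcons (x, t)); split.
  move=> s; have := dF s; rewrite upd_consS.
  by under eq_fun do rewrite upd_consS.
by move: cF'; under eq_fun do rewrite upd_consS.
Qed.

Definition dominated n (F : n.-tuple RT -> R) :=
  measurable_fun setT F /\ exists C : R, forall t, `|F t| <= C * weight t.

Lemma dominated_mul_integrable n (F G : n.-tuple RT -> R) :
  dominated F -> dominated G ->
  (gauss_tuple R n).-integrable setT (fun t => (F t * G t)%:E).
Proof.
move=> [mf [C hC]] [mg [D hD]].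
have w0 := lt_le_trans ltr01 (weight_ge1 (nseq_tuple n (0 : RT))).
apply: (@le_integrable _ _ _ (gauss_tuple R n) _ _ _
    (fun t : n.-tuple RT => ((C * D)%:E * (weight t ^+ 2)%:E)%E)) => //.
- by apply/measurable_EFinP; exact: measurable_funM.
- move=> t _ /=; rewrite lee_fin normrM [leRHS]ger0_norm; last first.
    rewrite mulr_ge0 ?sqr_ge0// mulr_ge0//.
    + by have := le_trans (normr_ge0 _) (hC (nseq_tuple n (0 : RT))); rewrite pmulr_lge0.
    + by have := le_trans (normr_ge0 _) (hD (nseq_tuple n (0 : RT))); rewrite pmulr_lge0.
  by rewrite expr2 mulrACA ler_pM.
- apply: integrableZl => //; apply/integrableP; split.
    by apply/measurable_EFinP; apply: measurable_funX; exact: measurable_weight.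
  under eq_integral do rewrite gee0_abs ?lee_fin ?sqr_ge0//.
  exact: integral_weight_lty.
Qed.

Lemma bounded_mfun_dominated n (F : n.-tuple RT -> R) : bounded_mfun F -> dominated F.
Proof.
move=> [mF [B hB]]; split => //; exists B => t; apply: (le_trans (hB t)).
by rewrite ler_peMr ?weight_ge1// (le_trans _ (hB t)).
Qed.

Lemma dominated_integrable n (F : n.-tuple RT -> R) : dominated F ->
  (gauss_tuple R n).-integrable setT (fun t => (F t)%:E).
Proof.
move=> dF; have d1 := bounded_mfun_dominated (bounded_mfun_cst (n.-tuple RT) (1 : R)).
have := dominated_mul_integrable dF d1.
by apply: eq_integrable => // x _ /=; rewrite mulr1.
Qed.

Lemma weight_ge_tnth n (t : n.-tuple RT) i : expR (tnth t i ^+ 2 / 8) <= weight t.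
Proof.
rewrite /weight (bigD1 i)//= ler_peMr ?expR_ge0//.
elim/big_ind : _ => //= [x y x1 y1|j _].
  by rewrite -[1]mulr1 ler_pM.
by rewrite -expR0 ler_expR divr_ge0 ?sqr_ge0.
Qed.

Lemma dominated_tnth n (i : 'I_n) : dominated (fun t : n.-tuple RT => tnth t i : R).
Proof.
split; first exact: measurable_tnth.
have [_ [C hC]] := @dominated1_id R; exists C => t.
apply: (le_trans (hC _)); rewrite ler_wpM2l ?weight_ge_tnth//.
by have := le_trans (normr_ge0 _) (hC 0); rewrite pmulr_lge0// expR_gt0.
Qed.

Lemma measurable_slice2 n (F : n.+1.-tuple RT -> R) (x : RT) : measurable_fun setT F ->
  measurable_fun setT (fun t : n.-tuple RT => F (tcons (x, t))).
Proof.
move=> mF; apply: measurableT_comp => //.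
exact: (measurableT_comp (@measurable_tcons _ RT n) (pair1_measurable x)).
Qed.

Lemma measurable_slice1 n (F : n.+1.-tuple RT -> R) (t : n.-tuple RT) :
  measurable_fun setT F -> measurable_fun setT (fun x : RT => F (tcons (x, t))).
Proof.
move=> mF; apply: measurableT_comp => //.
exact: (measurableT_comp (@measurable_tcons _ RT n) (pair2_measurable t)).
Qed.

Lemma dominated_slice2 n (F : n.+1.-tuple RT -> R) (x : RT) : dominated F ->
  dominated (fun t : n.-tuple RT => F (tcons (x, t))).
Proof.
move=> [mF [C hC]]; split; first exact: measurable_slice2.
exists (C * expR ((x : R) ^+ 2 / 8)) => t.
by rewrite -mulrA -weight_cons.
Qed.

Lemma dominated_slice1 n (F : n.+1.-tuple RT -> R) (t : n.-tuple RT) : dominated F ->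
  dominated1 (fun x : RT => F (tcons (x, t))).
Proof.
move=> [mF [C hC]]; split; first exact: measurable_slice1.
exists (C * weight t) => x.
by rewrite mulrAC -mulrA -weight_cons.
Qed.

(** Induction on n, with the order of integration adapted to the differentiated coordinate. If it
    lies in the tail, the tail is integrated innermost and the induction hypothesis applies to each
    slice; if it is the head, the head is integrated innermost and [stein1] applies. *)
Lemma stein n (i : 'I_n) (F F' : n.-tuple RT -> R) :
  dominated F -> dominated F' -> partial i F F' ->
  \int[gauss_tuple R n]_t F' t = \int[gauss_tuple R n]_t (tnth t i * F t).
Proof.
elim: n => [|n IH] in i F F' *; first by case: i.
move=> dF dF' pF.
have iF' := dominated_integrable dF'.
have ixF := dominated_mul_integrable (dominated_tnth i) dF.
have [j|] := unliftP ord0 i => ij; rewrite ij in pF ixF *.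
- rewrite !Rintegral_measure_cons//; first last.
  + by move=> x; apply: dominated_integrable; exact: dominated_slice2.
  + move=> x; have := dominated_mul_integrable (dominated_tnth j) (dominated_slice2 x dF).
    by apply: eq_integrable => // t _; rewrite tnthS.
  apply: eq_Rintegral => x _.
  rewrite (IH j (fun t => F (tcons (x, t))))//; first last.
  + exact: partial_consS.
  + exact: dominated_slice2.
  + exact: dominated_slice2.
  by apply: eq_Rintegral => t _; rewrite tnthS.
- rewrite !Rintegral_measure_cons'//; first last.
  + by move=> x; apply: dominated1_integrable; exact: dominated_slice1.
  + move=> t; have := dominated1_mul_integrable (@dominated1_id R) (dominated_slice1 t dF).
    by apply: eq_integrable.
  apply: eq_Rintegral => t _; have [dFt cFt] := partial_cons0 t pF.
  by apply: (stein1 _ _ dFt cFt); exact: dominated_slice1.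
Qed.


Lemma bounded_slice2 n (F : n.+1.-tuple RT -> R) (x : RT) : bounded_mfun F ->
  bounded_mfun (fun t : n.-tuple RT => F (tcons (x, t))).
Proof. by move=> [mF [B hB]]; split; [exact: measurable_slice2|exists B]. Qed.

Lemma bounded_slice1 n (F : n.+1.-tuple RT -> R) (t : n.-tuple RT) : bounded_mfun F ->
  bounded_mfun (fun x : RT => F (tcons (x, t))).
Proof. by move=> [mF [B hB]]; split; [exact: measurable_slice1|exists B]. Qed.

Let gauss11 : gauss1 R setT = 1%E. Proof. exact: probability_setT. Qed.

Lemma bounded_gauss_tuple_integrable n (F : n.-tuple RT -> R) : bounded_mfun F ->
  (gauss_tuple R n).-integrable setT (EFin \o F).
Proof. by move=> bF; apply: bounded_mfun_integrable => //; exact: gauss_tuple_setT. Qed.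

Lemma bounded_Rintegral_cons n (F : n.+1.-tuple RT -> R) : bounded_mfun F ->
  \int[gauss_tuple R n.+1]_t F t =
  \int[gauss1 R]_x \int[gauss_tuple R n]_t F (tcons (x, t)).
Proof.
move=> bF; rewrite Rintegral_measure_cons//; first exact: bounded_gauss_tuple_integrable.
by move=> x; apply: bounded_gauss_tuple_integrable; exact: bounded_slice2.
Qed.

Lemma bounded_Rintegral_cons' n (F : n.+1.-tuple RT -> R) : bounded_mfun F ->
  \int[gauss_tuple R n.+1]_t F t =
  \int[gauss_tuple R n]_t \int[gauss1 R]_x F (tcons (x, t)).
Proof.
move=> bF; rewrite Rintegral_measure_cons'//; first exact: bounded_gauss_tuple_integrable.
by move=> t; apply: bounded_mfun_integrable => //; exact: bounded_slice1.
Qed.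

Lemma bounded_partial_integral2 n (F : n.+1.-tuple RT -> R) : bounded_mfun F ->
  bounded_mfun (fun x : RT => \int[gauss_tuple R n]_t F (tcons (x, t))).
Proof.
move=> bF; have [mF [B hB]] := bF; split; last first.
  exists B => x; apply: bounded_Rintegral_norm_le => //; first exact: gauss_tuple_setT.
  exact: bounded_slice2.
have := measurable_fubini_F (integrable_measure_cons (bounded_gauss_tuple_integrable bF)).
by move=> mFF; apply: measurableT_comp mFF.
Qed.

Lemma bounded_partial_integral1 n (F : n.+1.-tuple RT -> R) : bounded_mfun F ->
  bounded_mfun (fun t : n.-tuple RT => \int[gauss1 R]_x F (tcons (x, t))).
Proof.
move=> bF; have [mF [B hB]] := bF; split; last first.
  exists B => x; apply: bounded_Rintegral_norm_le => //.
  exact: bounded_slice1.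
have := measurable_fubini_G (integrable_measure_cons (bounded_gauss_tuple_integrable bF)).
by move=> mFF; apply: measurableT_comp mFF.
Qed.

(** The Efron-Stein inequality for two independent blocks, head and tail. With M and m the two
    conditional means and c the mean, K = M + m - c is the orthogonal projection of F onto sums of a
    function of the head and a function of the tail. The claim is E (F - K)^2 >= 0, where E (F K) =
    E K^2 = E M^2 + E m^2 - c^2. *)
Lemma efron_stein2 n (F : n.+1.-tuple RT -> R) : bounded_mfun F ->
  \int[gauss1 R]_x (\int[gauss_tuple R n]_t F (tcons (x, t))) ^+ 2 +
  \int[gauss_tuple R n]_t (\int[gauss1 R]_x F (tcons (x, t))) ^+ 2 <=
  \int[gauss_tuple R n.+1]_t (F t ^+ 2) + (\int[gauss_tuple R n.+1]_t F t) ^+ 2.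
Proof.
move=> bF.
set M := fun x => \int[gauss_tuple R n]_t F (tcons (x, t)).
set m := fun t => \int[gauss1 R]_x F (tcons (x, t)).
set c := \int[gauss_tuple R n.+1]_t F t.
have P1 := gauss_tuple_setT R n.+1; have Pn1 := gauss_tuple_setT R n.
have bM : bounded_mfun M := bounded_partial_integral2 bF.
have bm : bounded_mfun m := bounded_partial_integral1 bF.
have cM : \int[gauss1 R]_x M x = c by rewrite -bounded_Rintegral_cons.
have cm : \int[gauss_tuple R n]_t m t = c by rewrite -bounded_Rintegral_cons'.
pose M' (t : n.+1.-tuple RT) := M (tnth t ord0).
pose m' (t : n.+1.-tuple RT) := m [tuple of behead t].
have M'E x t : M' (tcons (x, t)) = M x by [].
have m'E x t : m' (tcons (x, t)) = m t by rewrite /m'; congr m; exact: val_inj.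
have bM' : bounded_mfun M'.
  have [mM [B hB]] := bM; split; last by exists B => t; exact: hB.
  by apply: measurableT_comp mM _; exact: measurable_tnth.
have bm' : bounded_mfun m'.
  have [mm [B hB]] := bm; split; last by exists B => t; exact: hB.
  by apply: measurableT_comp mm _; exact: measurable_behead.
have iM' : \int[gauss_tuple R n.+1]_t M' t = c.
  rewrite bounded_Rintegral_cons// -cM; apply: eq_Rintegral => x _.
  by rewrite -[RHS](Rintegral_cst1 Pn1).
have im' : \int[gauss_tuple R n.+1]_t m' t = c.
  rewrite bounded_Rintegral_cons'// -cm; apply: eq_Rintegral => t _.
  by rewrite -[RHS](Rintegral_cst1 gauss11); apply: eq_Rintegral => x _; rewrite m'E.
have iMM : \int[gauss_tuple R n.+1]_t (M' t * M' t) = \int[gauss1 R]_x (M x ^+ 2).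
  rewrite bounded_Rintegral_cons//; last exact: bounded_mfunM.
  by apply: eq_Rintegral => x _; rewrite -[RHS](Rintegral_cst1 Pn1) expr2.
have imm : \int[gauss_tuple R n.+1]_t (m' t * m' t) = \int[gauss_tuple R n]_t (m t ^+ 2).
  rewrite bounded_Rintegral_cons'//; last exact: bounded_mfunM.
  apply: eq_Rintegral => t _; rewrite -[RHS](Rintegral_cst1 gauss11) expr2.
  by apply: eq_Rintegral => x _; rewrite m'E.
(* Independence of head and tail. *)
have iMm : \int[gauss_tuple R n.+1]_t (M' t * m' t) = c * c.
  rewrite bounded_Rintegral_cons//; last exact: bounded_mfunM.
  transitivity (\int[gauss1 R]_x (c * M x)); last by rewrite RintegralZl1// cM.
  apply: eq_Rintegral => x _; rewrite mulrC -cm -RintegralZl1//.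
  by apply: eq_Rintegral => t _; rewrite m'E.
(* Conditioning on the head: [M'] is constant on each slice, over which [F] integrates to [M]. *)
have iFM : \int[gauss_tuple R n.+1]_t (M' t * F t) = \int[gauss1 R]_x (M x ^+ 2).
  rewrite bounded_Rintegral_cons//; last exact: bounded_mfunM.
  apply: eq_Rintegral => x _; rewrite expr2 {2}/M -RintegralZl1//.
  exact: bounded_slice2.
have iFm : \int[gauss_tuple R n.+1]_t (m' t * F t) = \int[gauss_tuple R n]_t (m t ^+ 2).
  rewrite bounded_Rintegral_cons'//; last exact: bounded_mfunM.
  apply: eq_Rintegral => t _; rewrite expr2 {2}/m -RintegralZl1//; last exact: bounded_slice1.
  by apply: eq_Rintegral => x _; rewrite m'E.
have bc := bounded_mfun_cst (n.+1.-tuple RT).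
pose K t := M' t + m' t - c.
have bMm := bounded_mfunD bM' bm'.
have bK : bounded_mfun K := bounded_mfunB bMm (bc _ c).
have b2 := bounded_mfunM (bc _ 2) (bounded_mfunM bM' bm').
have MM := bounded_mfunM bM' bM'; have mm := bounded_mfunM bm' bm'.
have bMF := bounded_mfunM bM' bF; have bmF := bounded_mfunM bm' bF.
have iFK : \int[gauss_tuple R n.+1]_t (K t * F t) =
    \int[gauss1 R]_x (M x ^+ 2) + \int[gauss_tuple R n]_t (m t ^+ 2) - c * c.
  transitivity (\int[gauss_tuple R n.+1]_t ((M' t * F t + m' t * F t) - c * F t)).
    by apply: eq_Rintegral => t _; rewrite /K; ring.
  rewrite RintegralB1//; first last.
  - exact: bounded_mfunM (bc _ c) bF.
  - exact: bounded_mfunD.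
  by rewrite RintegralD1// RintegralZl1// iFM iFm.
have iKK : \int[gauss_tuple R n.+1]_t (K t ^+ 2) =
    \int[gauss1 R]_x (M x ^+ 2) + \int[gauss_tuple R n]_t (m t ^+ 2) - c * c.
  have cMm := bounded_mfunM (bc _ (2 * c)) bMm.
  have S1 := bounded_mfunD MM mm; have S2 := bounded_mfunD S1 b2.
  have S3 := bounded_mfunB S2 cMm.
  transitivity (\int[gauss_tuple R n.+1]_t
      ((M' t * M' t + m' t * m' t + 2 * (M' t * m' t)) - 2 * c * (M' t + m' t) + c * c)).
    by apply: eq_Rintegral => t _; rewrite /K; ring.
  rewrite (RintegralD1 P1 S3 (bc _ (c * c))) (RintegralB1 P1 S2 cMm) (RintegralD1 P1 S1 b2).
  rewrite (RintegralD1 P1 MM mm) (RintegralZl1 P1 2 (bounded_mfunM bM' bm')).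
  rewrite (RintegralZl1 P1 (2 * c) bMm) (RintegralD1 P1 bM' bm') (Rintegral_cst1 P1).
  by rewrite iMM imm iMm iM' im'; ring.
have FF := bounded_mfunX 2 bF; have KK := bounded_mfunX 2 bK.
have KF := bounded_mfunM (bc _ 2) (bounded_mfunM bK bF).
have : 0 <= \int[gauss_tuple R n.+1]_t ((F t ^+ 2 + K t ^+ 2) - 2 * (K t * F t)).
  apply: Rintegral_ge0 => t _; have := sqr_ge0 (F t - K t); lra.
rewrite (RintegralB1 P1 (bounded_mfunD FF KK) KF) (RintegralD1 P1 FF KK).
rewrite (RintegralZl1 P1 2 (bounded_mfunM bK bF)) iKK iFK; lra.
Qed.

Lemma tuple0_Rintegral_sqr (F : 0.-tuple RT -> R) :
  \int[gauss_tuple R 0]_t (F t ^+ 2) - (\int[gauss_tuple R 0]_t F t) ^+ 2 = 0.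
Proof.
have P1 := gauss_tuple_setT R 0.
have E (G : 0.-tuple RT -> R) : \int[gauss_tuple R 0]_t G t = G [tuple].
  rewrite -[RHS](Rintegral_cst1 P1); apply: eq_Rintegral => t _.
  by rewrite (tuple0 t).
by rewrite !E subrr.
Qed.

(** The inequality is applied conditionally: in the head for a fixed tail by [poincare1], and in the
    tail for a fixed head by induction. *)
Lemma gauss_tuple_poincare n (F : n.-tuple RT -> R) (F' : 'I_n -> n.-tuple RT -> R) :
  bounded_mfun F -> (forall i, bounded_mfun (F' i)) -> (forall i, partial i F (F' i)) ->
  \int[gauss_tuple R n]_t (F t ^+ 2) - (\int[gauss_tuple R n]_t F t) ^+ 2 <=
  \sum_i \int[gauss_tuple R n]_t (F' i t ^+ 2).
Proof.
elim: n => [|n IH] in F F' *.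
  by move=> _ _ _; rewrite tuple0_Rintegral_sqr big_ord0.
move=> bF bF' pF; have Pn1 := gauss_tuple_setT R n.
have F2 := bounded_mfunX 2 bF; have F'2 i := bounded_mfunX 2 (bF' i).
have es := efron_stein2 bF.
have bM := bounded_partial_integral2 bF; have bm := bounded_partial_integral1 bF.
have ineq0 : \int[gauss_tuple R n.+1]_t (F t ^+ 2) <=
    \int[gauss_tuple R n]_t (\int[gauss1 R]_x F (tcons (x, t))) ^+ 2 +
    \int[gauss_tuple R n.+1]_t (F' ord0 t ^+ 2).
  rewrite !bounded_Rintegral_cons'// -RintegralD1//; first last.
  - exact: bounded_partial_integral1 (F'2 ord0).
  - exact: bounded_mfunX.
  apply: le_Rintegral1 => //.
  - exact: bounded_partial_integral1 F2.
  - apply: bounded_mfunD; first exact: bounded_mfunX.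
    exact: bounded_partial_integral1 (F'2 ord0).
  move=> t; rewrite -lerBlDl.
  have [_ [B hB]] := bF' ord0; have [dFt cFt] := partial_cons0 t (pF ord0).
  apply: (poincare1 _ _ dFt cFt); last by move=> x; exact: hB.
  by have [_ [C hC]] := bF; exists C => x; exact: hC.
have ineqS : \int[gauss_tuple R n.+1]_t (F t ^+ 2) <=
    \int[gauss1 R]_x (\int[gauss_tuple R n]_t F (tcons (x, t))) ^+ 2 +
    \sum_(i < n) \int[gauss_tuple R n.+1]_t (F' (lift ord0 i) t ^+ 2).
  under eq_bigr => i _ do rewrite bounded_Rintegral_cons//.
  have bS i := bounded_partial_integral2 (F'2 (lift ord0 i)).
  rewrite -(Rintegral_sum1 gauss11)// bounded_Rintegral_cons// -RintegralD1//; first last.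
  - exact: bounded_mfun_sum.
  - exact: bounded_mfunX.
  apply: le_Rintegral1 => //.
  - exact: bounded_partial_integral2 F2.
  - by apply: bounded_mfunD; [exact: bounded_mfunX|exact: bounded_mfun_sum].
  move=> x; rewrite -lerBlDl.
  apply: (IH (fun t => F (tcons (x, t))) (fun i t => F' (lift ord0 i) (tcons (x, t)))).
  - exact: bounded_slice2.
  - by move=> i; exact: bounded_slice2.
  - by move=> i; exact: partial_consS.
(* The sum of [ineq0] and [ineqS] bounds 2 E F^2; by [es] the squared conditional means contribute
   at most E F^2 + (E F)^2, and one E F^2 cancels. *)
rewrite big_ord_recl; lra.
Qed.

End gauss_tuple_calculus.

(** * Affine changes of variables for Lebesgue measure *)

Section lebesgue_affine.
Variable R : realType.
Notation RT := (measurableTypeR R).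
Notation leb := (@lebesgue_measure R).

Let affine (a b : R) (x : RT) : RT := a * x + b.

Let measurable_affine a b : measurable_fun setT (affine a b).
Proof. by apply: measurable_funD => //; exact: measurable_funM. Qed.

(** The image of Lebesgue measure under x -> a x + b, multiplied by a, gives half-open intervals
    their length, so it is Lebesgue measure. A positive slope keeps the open end of an interval on
    the left. *)
Lemma ge0_integral_lebesgue_affine (a b : R) (f : RT -> \bar R) : 0 < a ->
  measurable_fun setT f -> (forall x, 0 <= f x)%E ->
  (\int[leb]_x f x = a%:E * \int[leb]_x f ((a * x + b)%R : R))%E.
Proof.
move=> a0 mf f0.
pose nu : {measure set RT -> \bar R} :=
  measure_function_pushforward__canonical__measure_function_Measure
    leb (measurable_affine a b).
have a0' : 0 <= a by exact: ltW.
pose an : {nonneg R} := NngNum a0'.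
have E A : measurable A -> leb A = mscale an nu A.
  move=> mA; apply: (@lebesgue_measure_unique R (mscale an nu)) => // X [[c d] _ <-].
  pose J : set RT := `](c - b) / a, (d - b) / a]%classic.
  rewrite [RHS](_ : _ = (a%:E * leb J)%E); last first.
    congr (_ * leb _)%E.
    apply/seteqP; split => x /=; rewrite !in_itv/= => /andP[h1 h2]; apply/andP; split.
    - by rewrite bnd_simp ltr_pdivrMr// mulrC ltrBlDr.
    - by rewrite bnd_simp ler_pdivlMr// mulrC lerBrDr.
    - by move: h1; rewrite bnd_simp ltr_pdivrMr// mulrC ltrBlDr.
    - by move: h2; rewrite bnd_simp ler_pdivlMr// mulrC lerBrDr.
  rewrite /J !lebesgue_measure_itv/= !lte_fin ltr_pM2r ?invr_gt0// ltrD2r.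
  case: ifPn => _; last by rewrite mule0.
  rewrite -!EFinB -EFinM; congr _%:E.
  by field; rewrite gt_eqF.
transitivity (\int[mscale an nu]_x f x)%E.
  by apply: eq_measure_integral => A mA _; exact: E.
rewrite ge0_integral_mscale//=; congr (_ * _)%E.
by rewrite [LHS](ge0_integral_pushforward (measurable_affine a b)).
Qed.
End lebesgue_affine.

(** * Cholesky factorisation together with its change of variables *)

Section linear_change_of_variables.
Variable R : realType.
Notation RT := (measurableTypeR R).

Definition affine_tuple n (A : 'M[R]_n) (mu : 'cV[R]_n) (t : n.-tuple RT) : n.-tuple RT :=
  [tuple (mu + A *m vec t) i 0 : RT | i < n].

Lemma vec_affine_tuple n (A : 'M[R]_n) mu (t : n.-tuple RT) :
  vec (affine_tuple A mu t) = mu + A *m vec t.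
Proof. by apply/colP => i; rewrite mxE tnth_mktuple. Qed.

Lemma measurable_affine_tuple n (A : 'M[R]_n) mu : measurable_fun setT (affine_tuple A mu).
Proof.
apply/measurable_fun_tnthP => i.
rewrite (_ : _ \o _ = (fun t : n.-tuple RT => mu i 0 + \sum_j A i j * tnth t j : RT)).
  apply: measurable_funD => //; apply: measurable_sum => j.
  by apply: measurable_funM => //; exact: measurable_tnth.
apply/funext => t /=; rewrite tnth_mktuple !mxE; congr (_ + _).
by apply: eq_bigr => j _; rewrite mxE.
Qed.

Lemma affine_tuple_block n (a : R) (b : 'rV[R]_n) (A : 'M[R]_n) (mu : 'cV[R]_n.+1)
    (x : RT) (t : n.-tuple RT) :
  affine_tuple (block_mx a%:M b 0 A : 'M[R]_(1 + n)) mu (tcons (x, t)) =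
  tcons ((a * x + (mu ord0 0 + (b *m vec t) 0 0) : RT),
         affine_tuple A (\col_i mu (lift ord0 i) 0) t).
Proof.
have l0 : ord0 = lshift n (ord0 : 'I_1) by apply: val_inj.
have E : vec (tcons (x, t)) = col_mx (x%:M : 'M[R]_1) (vec t) :> 'cV[R]_(1 + n).
  apply/colP => j; have [j'|] := unliftP ord0 j => ->.
    by rewrite -rshift1 col_mxEd !mxE rshift1 tnthS.
  by rewrite l0 col_mxEu !mxE eqxx mulr1n.
apply: eq_from_tnth => i; rewrite tnth_mktuple E mxE (mul_block_col a%:M).
have [i'|] := unliftP ord0 i => ->; last first.
  by rewrite [in X in _ + X]l0 col_mxEu !mxE big_ord1 !mxE !eqxx !mulr1n addrCA.
rewrite -[in X in _ + X]rshift1 col_mxEd mul0mx add0r tnthS tnth_mktuple.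
by rewrite [in RHS]mxE; congr (_ + _); rewrite mxE.
Qed.

Lemma spd_dsubmx n (G : 'M[R]_(1 + n)) : spd G -> spd (drsubmx G).
Proof.
move=> [Gs Gp]; split; first by rewrite trmx_drsub Gs.
move=> x x0; have := Gp (col_mx 0 x).
rewrite -{1}[G]submxK tr_col_mx mul_row_block mul_row_col !trmx0 !mul0mx !mulmx0 !add0r.
by apply; rewrite col_mx_eq0 negb_and x0 orbT.
Qed.

(** The Schur complement is the value of the quadratic form at the vector with head 1 and tail [v],
    the choice of tail that cancels the lower block of G applied to the vector. *)
Lemma spd_schur n (G : 'M[R]_(1 + n)) : spd G -> drsubmx G \in unitmx ->
  0 < (ulsubmx G - ursubmx G *m invmx (drsubmx G) *m dlsubmx G) 0 0.
Proof.
move=> [Gs Gp] Gu.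
pose v := - (invmx (drsubmx G) *m dlsubmx G); have := Gp (col_mx 1%:M v).
rewrite -{1}[G]submxK tr_col_mx mul_row_block mul_row_col.
rewrite col_mx_eq0 negb_and [1%:M == 0 :> 'M[R]_1]oner_eq0 /= => /(_ isT).
rewrite trmx1 !mul1mx !mulmx1 /v linearN /= !mulNmx mulmxN trmx_mul.
have -> : (invmx (drsubmx G))^T = invmx (drsubmx G).
  by rewrite trmx_inv trmx_drsub Gs.
have -> : (dlsubmx G)^T = ursubmx G by rewrite trmx_dlsub Gs.
by rewrite -(mulmxA _ _ (drsubmx G)) mulVmx// mulmx1 subrr mul0mx oppr0 addr0.
Qed.

Lemma invmx_gram n (A : 'M[R]_n) : A \in unitmx ->
  invmx (A *m A^T) = invmx A^T *m invmx A.
Proof.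
move=> Au; have AAu : A *m A^T \in unitmx by rewrite unitmx_mul unitmx_tr Au.
have E : (A *m A^T) *m (invmx A^T *m invmx A) = 1%:M.
  by rewrite mulmxA mulmxK ?unitmx_tr// mulmxV.
by rewrite -[RHS](mulKmx AAu) E mulmx1.
Qed.

(* A is upper triangular, so that the change of variables reduces by Fubini to
   affine substitutions in one coordinate at a time. *)
Lemma spd_cholesky n (G : 'M[R]_n) : spd G -> exists A : 'M[R]_n,
  [/\ A *m A^T = G, 0 < \det A & forall mu (h : n.-tuple RT -> \bar R),
    measurable_fun setT h -> (forall t, 0 <= h t)%E ->
    (\int[lebesgue_tuple R n]_t h t =
     (\det A)%:E * \int[lebesgue_tuple R n]_t h (affine_tuple A mu t))%E].
Proof.
elim: n => [|n IH] in G *.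
  move=> _; exists 1%:M; split; first by apply/matrixP; case.
    by rewrite det1.
  move=> mu h mh h0; rewrite det1 mul1e; apply: eq_integral => t _.
  by congr h; apply: eq_from_tnth; case.
move=> spdG; have [A [AG dA IA]] := IH _ (spd_dsubmx (spdG : spd (G : 'M[R]_(1 + n)))).
have Au : A \in unitmx by rewrite unitmxE unitfE gt_eqF.
have Gu : drsubmx (G : 'M[R]_(1 + n)) \in unitmx.
  by rewrite -AG unitmx_mul unitmx_tr Au.
have := spd_schur spdG Gu.
set g := _ 0 0 => g0.
pose b := ursubmx (G : 'M[R]_(1 + n)) *m invmx A^T.
(* [b] solves b A^T = upper right block of G. Then b b^T is what separates the corner of G from its
   Schur complement [g], so the remaining corner entry is the square root of [g]. *)
exists (block_mx (Num.sqrt g)%:M b 0 A : 'M[R]_(1 + n)); split.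
- have bA : b *m A^T = ursubmx (G : 'M[R]_(1 + n)).
    by rewrite /b mulmxKV// unitmx_tr.
  have Gs : (G : 'M[R]_(1 + n))^T = G by case: spdG.
  have ur_tr : (ursubmx (G : 'M[R]_(1 + n)))^T = dlsubmx (G : 'M[R]_(1 + n)).
    by rewrite trmx_ursub Gs.
  have bb : b *m b^T = ursubmx (G : 'M[R]_(1 + n)) *m invmx (A *m A^T) *m
                       dlsubmx (G : 'M[R]_(1 + n)).
    rewrite /b trmx_mul trmx_inv trmxK ur_tr !mulmxA; congr (_ *m _).
    by rewrite -[LHS]mulmxA -invmx_gram.
  rewrite -[RHS](submxK (G : 'M[R]_(1 + n))) (@tr_block_mx _ 1 n 1 n) (@mulmx_block _ 1 n 1 n 1 n).
  rewrite tr_scalar_mx !trmx0 !mul0mx !mulmx0 !add0r ?addr0 bA AG.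
  have -> : A *m b^T = dlsubmx (G : 'M[R]_(1 + n)).
    by rewrite -[RHS]ur_tr -bA [in RHS]trmx_mul trmxK.
  suff -> : (Num.sqrt g)%:M *m (Num.sqrt g)%:M + b *m b^T = ulsubmx (G : 'M[R]_(1 + n)) by [].
  rewrite bb AG -scalar_mxM -expr2 sqr_sqrtr ?ltW//.
  by rewrite /g -mx11_scalar subrK.
- by rewrite (@det_ublock _ 1) det_scalar1 mulr_gt0// sqrtr_gt0.
- move=> mu h mh h0.
  have mhc : measurable_fun setT (fun p => h (@tcons _ RT n p)) by exact: measurable_tconsP.
  pose mu' : 'cV[R]_n := \col_i mu (lift ord0 i) 0.
  pose H (t : n.-tuple RT) := (\int[@lebesgue_measure R]_x h (tcons (x, t)))%E.
  have mH : measurable_fun setT H.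
    by apply: (measurable_fun_fubini_tonelli_G (fun p => h (tcons p))).
  have mha : measurable_fun setT (fun t => h (affine_tuple
      (block_mx (Num.sqrt g)%:M b 0 A : 'M[R]_(1 + n)) mu t)).
    by apply: measurableT_comp => //; exact: measurable_affine_tuple.
  rewrite [LHS](ge0_integral_measure_cons' _ _ mh h0).
  rewrite [X in _ = (_ * X)%E](ge0_integral_measure_cons' _ _ mha)//.
  (* The tail is substituted by induction, as the outer variable. For a fixed tail, the head then
     undergoes a one-dimensional affine substitution whose offset [c] depends on the tail. *)
  rewrite (IA mu' H mH); last by move=> t; exact: integral_ge0.
  rewrite (@det_ublock _ 1) det_scalar1 mulrC EFinM -muleA; congr (_ * _)%E.
  rewrite -ge0_integralZl//; first last.
  + by move=> t _; exact: integral_ge0.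
  + by apply: (measurable_fun_fubini_tonelli_G (fun p => h (affine_tuple
      (block_mx (Num.sqrt g)%:M b 0 A : 'M[R]_(1 + n)) mu (tcons p)))) => //;
    exact: (measurable_tconsP mha).
  apply: eq_integral => t _.
  pose c : R := mu ord0 0 + (b *m vec t) 0 0.
  have sg0 : 0 < Num.sqrt g by rewrite sqrtr_gt0.
  have mht : measurable_fun setT (fun x : RT => h (tcons (x, affine_tuple A mu' t))).
    apply: (measurableT_comp mhc); exact: pair2_measurable.
  rewrite /H (ge0_integral_lebesgue_affine c sg0 mht)//; congr (_ * _)%E.
  by apply: eq_integral => x _; rewrite affine_tuple_block.
Qed.
End linear_change_of_variables.

(** * The density N(mu, G) as the image of the standard Gaussian under t -> mu + A t *)

Section gauss_density_integral.
Variable R : realType.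
Notation RT := (measurableTypeR R).

Lemma measurable_prod_normal_pdf n :
  measurable_fun setT (fun t : n.-tuple RT => \prod_(i < n) normal_pdf 0 1 (tnth t i)).
Proof.
apply: measurable_prod => i _.
by apply: (measurableT_comp (measurable_normal_pdf 0 1)); exact: measurable_tnth.
Qed.

Lemma prod_normal_pdf_ge0 n (t : n.-tuple RT) :
  0 <= \prod_(i < n) normal_pdf 0 1 (tnth t i) :> R.
Proof. by apply: prodr_ge0 => i _; exact: normal_pdf_ge0. Qed.

Lemma ge0_integral_gauss_tuple n (h : n.-tuple RT -> \bar R) :
  measurable_fun setT h -> (forall t, 0 <= h t)%E ->
  (\int[gauss_tuple R n]_t h t =
   \int[lebesgue_tuple R n]_t (h t * (\prod_(i < n) normal_pdf 0 1 (tnth t i))%:E))%E.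
Proof.
elim: n => [|n IH] in h *.
  by move=> mh h0; apply: eq_integral => t _; rewrite big_ord0 mule1.
move=> mh h0; rewrite [LHS](ge0_integral_measure_cons _ _ mh h0).
have mhp : measurable_fun setT
    (fun t : n.+1.-tuple RT => h t * (\prod_(i < n.+1) normal_pdf 0 1 (tnth t i))%:E)%E.
  by apply: emeasurable_funM => //; apply/measurable_EFinP; exact: measurable_prod_normal_pdf.
rewrite [RHS](ge0_integral_measure_cons _ _ mhp); last first.
  by move=> t; rewrite mule_ge0// lee_fin prod_normal_pdf_ge0.
have mhs (x : RT) : measurable_fun setT (fun t : n.-tuple RT => h (tcons (x, t))).
  by apply: (measurableT_comp (measurable_tconsP mh)); exact: pair1_measurable.
rewrite ge0_integral_gauss1; first last.
- by move=> x; apply: integral_ge0.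
- by apply: (measurable_fun_fubini_tonelli_F (fun p => h (tcons p))) => //;
    exact: measurable_tconsP.
apply: eq_integral => x _; rewrite IH// -ge0_integralZr//; first last.
- by rewrite lee_fin normal_pdf_ge0.
- by move=> t _; rewrite mule_ge0// lee_fin prod_normal_pdf_ge0.
- by apply: emeasurable_funM => //; apply/measurable_EFinP; exact: measurable_prod_normal_pdf.
apply: eq_integral => t _; rewrite -muleA; congr (_ * _)%E.
rewrite -EFinM big_ord_recl mulrC; congr (_ * _)%:E.
by apply: eq_bigr => i _; rewrite tnthS.
Qed.

Lemma sqrtrX (x : R) n : 0 <= x -> Num.sqrt (x ^+ n) = Num.sqrt x ^+ n.
Proof.
by move=> x0; elim: n => [|n IH]; rewrite ?expr0 ?sqrtr1// !exprS sqrtrM// IH.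
Qed.

Variables (k : nat) (mu : 'cV[R]_k) (G A : 'M[R]_k).
Hypothesis (AG : A *m A^T = G) (detA : 0 < \det A).
Hypothesis change_of_variables : forall mu (h : k.-tuple RT -> \bar R),
    measurable_fun setT h -> (forall t, 0 <= h t)%E ->
    (\int[lebesgue_tuple R k]_t h t =
     (\det A)%:E * \int[lebesgue_tuple R k]_t h (affine_tuple A mu t))%E.

Lemma gauss_density_ge0 x : 0 <= gauss_density mu G x.
Proof. by rewrite mulr_ge0 ?expR_ge0// invr_ge0 sqrtr_ge0. Qed.

(** In the coordinates x = mu + A t the quadratic form becomes |t|^2, and det G = (det A)^2 with det
    A > 0, so the Jacobian cancels against the root of det G. *)
Lemma gauss_density_affine (t : k.-tuple RT) :
  \det A * gauss_density mu G (vec (affine_tuple A mu t)) =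
  \prod_(i < k) normal_pdf 0 1 (tnth t i).
Proof.
have Au : A \in unitmx by rewrite unitmxE unitfE gt_eqF.
have -> : gauss_density mu G (vec (affine_tuple A mu t)) =
    (Num.sqrt (2 * pi) ^+ k * \det A)^-1 * expR (- (\sum_(i < k) tnth t i ^+ 2) / 2).
  rewrite /gauss_density vec_affine_tuple addrAC subrr add0r.
  rewrite -AG det_mulmx det_tr -expr2 sqrtrM ?exprn_ge0 ?mulr_ge0 ?pi_ge0//.
  have -> : ((A *m vec t)^T *m invmx (A *m A^T) *m (A *m vec t)) 0 0 = \sum_(i < k) tnth t i ^+ 2.
    rewrite invmx_gram// trmx_mul !mulmxA mulmxK ?unitmx_tr//.
    by rewrite mulmxKV// mxE; apply: eq_bigr => i _; rewrite !mxE expr2.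
  by rewrite sqrtr_sqr gtr0_norm// sqrtrX// mulr_ge0 ?pi_ge0.
rewrite invfM mulrA (mulrCA (\det A)) mulfV ?gt_eqF// mulr1.
under [in RHS]eq_bigr do rewrite normal_pdfE ?oner_eq0// /normal_fun /normal_peak.
rewrite big_split/= prodr_const card_ord -exprVn; congr (_ * _).
  by congr (_^-1 ^+ _); congr Num.sqrt; rewrite expr1n mul1r mulr_natl.
rewrite -expR_sum; congr expR; rewrite mulNr mulr_suml -sumrN.
by apply: eq_bigr => i _; rewrite subr0 expr1n mulNr.
Qed.

Lemma measurable_gauss_density : measurable_fun setT (gauss_density mu G \o @vec R k).
Proof.
apply: measurable_funM => //; apply: measurableT_comp => //.
apply: measurable_funM => //; apply: measurable_funN.
rewrite (_ : (fun _ => _) = (fun t : k.-tuple RT =>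
    \sum_j (\sum_i (tnth t i - mu i 0) * invmx G i j) * (tnth t j - mu j 0))).
  apply: measurable_sum => j; apply: measurable_funM; last first.
    by apply: measurable_funB => //; exact: measurable_tnth.
  apply: measurable_sum => i; apply: measurable_funM => //.
  by apply: measurable_funB => //; exact: measurable_tnth.
apply/funext => t; rewrite mxE; apply: eq_bigr => j _; rewrite !mxE; congr (_ * _).
by apply: eq_bigr => i _; rewrite !mxE.
Qed.

Lemma ge0_integral_gauss_density (h : k.-tuple RT -> \bar R) :
  measurable_fun setT h -> (forall t, 0 <= h t)%E ->
  (\int[lebesgue_tuple R k]_t (h t * (gauss_density mu G (vec t))%:E) =
   \int[gauss_tuple R k]_t h (affine_tuple A mu t))%E.
Proof.
move=> mh h0; have mp := measurable_gauss_density.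
have ma := measurable_affine_tuple A mu.
rewrite (change_of_variables mu); first last.
- by move=> t; rewrite mule_ge0// lee_fin gauss_density_ge0.
- by apply: emeasurable_funM => //; apply/measurable_EFinP.
rewrite ge0_integral_gauss_tuple//; last exact: measurableT_comp.
rewrite -ge0_integralZl//; first last.
- by rewrite lee_fin ltW.
- by move=> t _; rewrite mule_ge0// lee_fin gauss_density_ge0.
- have mhp : measurable_fun setT (fun t => h t * (gauss_density mu G (vec t))%:E)%E.
    by apply: emeasurable_funM => //; apply/measurable_EFinP.
  exact: (measurableT_comp mhp ma).
apply: eq_integral => t _.
by rewrite muleCA -EFinM gauss_density_affine.
Qed.
(** Multiplication by the nonnegative density commutes with positive and negative parts, so the
    formula holds for every measurable [h], divergent integrals included. *)
Lemma integral_gauss_density (h : k.-tuple RT -> R) : measurable_fun setT h ->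
  (\int[lebesgue_tuple R k]_t (h t * gauss_density mu G (vec t))%:E =
   \int[gauss_tuple R k]_t (h (affine_tuple A mu t))%:E)%E.
Proof.
move=> mh; have mhE : measurable_fun setT (EFin \o h) by exact/measurable_EFinP.
rewrite integralE [in RHS]integralE; congr (_ - _)%E.
  transitivity (\int[lebesgue_tuple R k]_t
      ((EFin \o h)^\+ t * (gauss_density mu G (vec t))%:E))%E.
    apply: eq_integral => t _; rewrite !funeposE /= -!EFin_max -EFinM.
    by rewrite maxr_pMl ?gauss_density_ge0// mul0r.
  rewrite ge0_integral_gauss_density//; last exact: measurable_funepos.
  by apply: eq_integral => t _; rewrite !funeposE.
transitivity (\int[lebesgue_tuple R k]_t
    ((EFin \o h)^\- t * (gauss_density mu G (vec t))%:E))%E.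
  apply: eq_integral => t _; rewrite !funenegE /= -?EFinN -!EFin_max -EFinM.
  by rewrite maxr_pMl ?gauss_density_ge0// mul0r mulNr.
rewrite ge0_integral_gauss_density//; last exact: measurable_funeneg.
by apply: eq_integral => t _; rewrite !funenegE.
Qed.

Lemma expect_gauss_density (f : 'cV[R]_k -> R) : measurable_fun setT (f \o @vec R k) ->
  expect (gauss_density mu G) f = \int[gauss_tuple R k]_t f (mu + A *m vec t).
Proof.
move=> mf; rewrite /expect /Rintegral (integral_gauss_density mf).
by congr fine; apply: eq_integral => t _; rewrite /= vec_affine_tuple.
Qed.

Lemma sqnormL2_gauss_density (f : 'cV[R]_k -> R) : measurable_fun setT (f \o @vec R k) ->
  sqnormL2 (gauss_density mu G) f = (\int[gauss_tuple R k]_t (f (mu + A *m vec t) ^+ 2)%:E)%E.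
Proof.
move=> mf; rewrite /sqnormL2.
rewrite (integral_gauss_density (h := fun t => f (vec t) ^+ 2)); last first.
  exact: measurable_funX.
by apply: eq_integral => t _; rewrite vec_affine_tuple.
Qed.
End gauss_density_integral.

(** * Topology of column vectors: measurability and compactness *)

Section column_topology.
Variable R : realType.
Notation RT := (measurableTypeR R).

Lemma mx_norm_ltP m n (x : 'M[R]_(m, n)) (e : R) : 0 < e ->
  `|x| < e <-> forall i j, `|x i j| < e.
Proof.
move=> e0; rewrite /Num.Def.normr/= mx_normrE; split.
  by move=> /bigmax_ltP[_ h] i j; exact: (h (i, j)).
by move=> h; apply/bigmax_ltP; split => // -[i j] _; exact: h.
Qed.

Lemma ler_mx_norm m n (x : 'M[R]_(m, n)) i j : `|x i j| <= `|x|.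
Proof.
rewrite [leRHS]/Num.Def.normr/= mx_normrE; apply: (le_bigmax _ (fun ij => `|x ij.1 ij.2|) (i, j)).
Qed.

Variable k : nat.
Implicit Types f : 'cV[R]_k -> R.

(** Continuity refers to the sup norm on columns, measurability to the product sigma-algebra on
    tuples. The two meet because an open set is a countable union of boxes with rational centre and
    radius 1/(m + 1), each cut out by finitely many conditions on coordinates. *)
Lemma continuous_measurable_vec f : continuous f -> measurable_fun setT (f \o @vec R k).
Proof.
move=> cf; apply: (measurability _ (RGenOpens.measurableE R)) => _ [_ [a [b ->]] <-].
set U : set R := `]a, b[%classic; have oU : open U by exact: interval_open.
rewrite setTI comp_preimage.
have oO : open (f @^-1` U) by apply: open_comp => // x _; exact: cf.
pose box (q : 'cV[rat]_k * nat) : set 'cV[R]_k :=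
  [set x | forall i, `|x i 0 - ratr (q.1 i 0)| < q.2.+1%:R^-1].
pose S := [set q | box q `<=` f @^-1` U].
have -> : f @^-1` U = \bigcup_(q in S) box q.
  apply/seteqP; split => [x Ux|x [q Sq]]; last exact: Sq.
  have /nbhs_ballP[e /= e0 He] : nbhs x (f @^-1` U) by apply: open_nbhs_nbhs.
  have [m] : exists m, m.+1%:R^-1 < e / 2.
    have /ltr_add_invr[m] : 0 < e / 2 by rewrite divr_gt0.
    by rewrite add0r; exists m.
  move=> me.
  have m0 : (0 : R) < m.+1%:R^-1 by rewrite invr_gt0 ltr0n.
  have /(_ _)/cid2-/all_sig2[q _ qP] i : exists2 q : rat, True & `|x i 0 - ratr q| < m.+1%:R^-1.
    have : x i 0 - m.+1%:R^-1 < x i 0 + m.+1%:R^-1 by rewrite ltrD2l gtrN.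
    move=> /rat_in_itvoo[q]; rewrite in_itv/= => q12.
    by exists q => //; rewrite distrC ltr_distl.
  exists (\col_i q i, m); last by move=> i /=; rewrite mxE.
  move=> y /= yq; apply: He; rewrite mx_norm_ball /ball_/=.
  apply/mx_norm_ltP => // i j; rewrite !mxE ord1.
  have := qP i; have := yq i; rewrite mxE distrC => h1 h2.
  have := ltrD h2 h1; rewrite /= => h.
  have -> : x i 0 - y i 0 = (x i 0 - ratr (q i)) + (ratr (q i) - y i 0) by rewrite addrA subrK.
  apply: le_lt_trans (ler_normD _ _) _; apply: (lt_trans h).
  by rewrite [ltRHS](splitr e) ltrD.
rewrite preimage_bigcup bigcup_mkcond; apply: countable_bigcupT_measurable.
  exact: countableP.
move=> q; case: ifP => // _.
rewrite (_ : _ @^-1` _ = \bigcap_(i in [set: 'I_k])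
    ((fun t : k.-tuple RT => `|(tnth t i : R) - ratr (q.1 i 0)|) @^-1` `]-oo, q.2.+1%:R^-1[%classic)).
  apply: fin_bigcap_measurable => // i _.
  rewrite -[X in measurable X]setTI.
  have mg : measurable_fun setT (fun t : k.-tuple RT => `|(tnth t i : R) - ratr (q.1 i 0)|).
    apply: measurableT_comp => //; apply: measurable_funB => //; exact: measurable_tnth.
  by apply: mg => //; exact: measurable_itv.
apply/seteqP; split => [t h i _|t h i].
  by have := h i; rewrite mxE /= in_itv.
by have := h i I; rewrite mxE /= in_itv.
Qed.

Lemma mx_norm_tr m n (x : 'M[R]_(m, n)) : `|x^T| = `|x|.
Proof.
apply/eqP; rewrite eq_le; apply/andP; split.
  rewrite [leLHS]/Num.Def.normr/= mx_normrE; apply/bigmax_leP; split => // -[i j] _ /=.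
  by rewrite mxE ler_mx_norm.
rewrite [leLHS]/Num.Def.normr/= mx_normrE; apply/bigmax_leP; split => // -[i j] _ /=.
by have := ler_mx_norm x^T j i; rewrite mxE.
Qed.

Lemma continuous_trmx m n : continuous (@trmx R m n).
Proof.
move=> x P /nbhs_ballP[e /= e0 HP]; apply/nbhs_ballP; exists e => //= y.
rewrite mx_norm_ball /ball_/= => h; apply: HP.
by rewrite mx_norm_ball /ball_/= -linearB/= mx_norm_tr.
Qed.

(** Transported from row vectors by transposition, which is an isometry for the sup norm. *)
Lemma bounded_closed_compact_cV (A : set 'cV[R]_k) : bounded_set A -> closed A -> compact A.
Proof.
move=> bA cA; rewrite (_ : A = trmx @` (trmx @^-1` A)); last first.
  apply/seteqP; split => [x Ax|_ [y Ay <-]]; last exact: Ay.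
  by exists x^T; rewrite /= trmxK.
apply: continuous_compact.
  by apply: continuous_subspaceT; exact: continuous_trmx.
apply: bounded_closed_compact.
  have [M [Mr MA]] := bA; exists M; split => // N MN x Ax.
  by rewrite /= -(mx_norm_tr x); exact: (MA N MN).
by apply: preimage_closed => // x _; exact: continuous_trmx.
Qed.

Lemma continuous_compact_support_bounded f : continuous f ->
  (exists M : R, forall x, M < `|x| -> f x = 0) -> exists B : R, forall x, `|f x| <= B.
Proof.
move=> cf [M hM]; pose A : set 'cV[R]_k := [set x | `|x| <= `|M|].
have A0 : A 0 by rewrite /A/= normr0.
have cA : compact A.
  apply: bounded_closed_compact_cV.
    by exists `|M|; split; [exact: num_real|move=> N MN x /= /le_trans; apply; exact: ltW].
  rewrite (_ : A = (fun x : 'cV[R]_k => `|x|) @^-1` [set y | y <= `|M|])//.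
  by apply: preimage_closed => [x _|]; [exact: norm_continuous|exact: closed_le].
have cnf : {within A, continuous (fun x => `|f x|)}.
  apply: continuous_subspaceT => x.
  by apply: (@cvg_comp _ _ _ f (fun y : R => `|y|)); [exact: cf|exact: norm_continuous].
have [c _ hc] := compact_EVT_max (ex_intro _ _ A0) cA cnf.
exists `|f c| => x; have [xA|xA] := leP `|x| `|M|; first by apply: hc; rewrite inE.
by rewrite hM ?normr0// (le_lt_trans _ xA)// ler_norm.
Qed.
End column_topology.

Section continuous_real_functions.
Context (R : realType) (T : topologicalType).
Implicit Types f g : T -> R.

Lemma continuous_addf f g : continuous f -> continuous g ->
  continuous (fun x => f x + g x).
Proof. by move=> cf cg x; exact: (continuousD (cf x) (cg x)). Qed.

Lemma continuous_mulf f g : continuous f -> continuous g ->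
  continuous (fun x => f x * g x).
Proof. by move=> cf cg x; exact: (continuousM (cf x) (cg x)). Qed.

Lemma continuous_scalef (c : R) f : continuous f -> continuous (fun x => c * f x).
Proof. by move=> cf; apply: continuous_mulf => //; exact: cst_continuous. Qed.

Lemma continuous_sumf (I : Type) (r : seq I) (F : I -> T -> R) :
  (forall i, continuous (F i)) -> continuous (fun x => \sum_(i <- r) F i x).
Proof.
move=> cF; elim: r => [|i r IH].
  by under eq_fun do rewrite big_nil; exact: cst_continuous.
by under eq_fun do rewrite big_cons; exact: continuous_addf.
Qed.

End continuous_real_functions.

Lemma MVT0 (R : realType) (f f' : R -> R) (h : R) :
  (forall s : R, is_derive s 1 f (f' s)) ->
  exists2 c, `|c| <= `|h| & f h - f 0 = f' c * h.
Proof.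
move=> df; have cw a b : {within `[a, b], continuous f}.
  by apply: continuous_subspaceT; exact: continuous_of_is_derive df.
have [h0|h0|->] := ltgtP h 0; last by exists 0; rewrite ?mulr0 ?subrr.
- have [c /[!in_itv]/= /andP[c1 c2] E] := MVT h0 (fun y _ => df y) (cw _ _).
  exists c; last by rewrite -opprB E; ring.
  by rewrite !ltr0_norm// lerN2 ltW.
- have [c /[!in_itv]/= /andP[c1 c2] E] := MVT h0 (fun y _ => df y) (cw _ _).
  exists c; last by rewrite E subr0.
  by rewrite !gtr0_norm// ltW.
Qed.

(** * Directional derivatives and calculus of C^1 functions *)

Section directional_derivative.
Variables (R : realType) (V : normedModType R).
Implicit Types (f g : V -> R) (x y v w : V).

(** Makes one-variable tools, the mean value theorem and the chain rule, available along a line. *)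
Lemma is_derive_line f x v (s d : R) :
  is_derive (s *: v + x) v f d <-> is_derive s 1 (fun r : R => f (r *: v + x)) d.
Proof.
rewrite !is_deriveP; have -> : (fun h : R => h^-1 *: (f (h *: v + (s *: v + x)) - f (s *: v + x))) =
  (fun h : R => h^-1 *: (f ((h *: 1 + s) *: v + x) - f (s *: v + x))); last by [].
by apply/funext => h; rewrite scaler1 scalerDl addrA.
Qed.

Lemma continuous_line x v : continuous (fun r : R => r *: v + x).
Proof.
by move=> r; apply: cvgD; [apply: cvgZr_tmp; exact: cvg_id|exact: cvg_cst].
Qed.

Lemma is_derive_scale f x v (c d : R) : is_derive x v f d -> is_derive x (c *: v) f (c * d).
Proof.
move=> df; rewrite -[x]add0r -(scale0r (c *: v)); apply/is_derive_line.
have : is_derive (c * 0) 1 (fun r : R => f (r *: v + x)) d.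
  by apply/is_derive_line; rewrite mulr0 scale0r add0r.
move=> dl; have dm : is_derive (0 : R) 1 (fun r : R => c * r) c.
  by apply: is_derive_eq; rewrite /GRing.scale /= mulr1.
have := @is_derive1_comp R _ _ _ _ _ dl dm.
rewrite [d * c]mulrC; congr is_derive; apply/funext => r /=.
by rewrite scalerA [r * c]mulrC.
Qed.

(** The increment along h (v + w) splits into a move by h v followed by a move by h w. The first
    gives [d]; by the mean value theorem the quotient of the second is a value of [g] at a point
    that tends to x. *)
Lemma is_derive_addv f x v w (d : R) (g : V -> R) : is_derive x v f d ->
  (forall y, is_derive y w f (g y)) -> continuous g ->
  is_derive x (v + w) f (d + g x).
Proof.
move=> dv dw cg; apply/is_deriveP.
have -> : (fun h : R => h^-1 *: (f (h *: (v + w) + x) - f x)) =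
    (fun h => h^-1 *: (f (h *: v + x) - f x) +
              h^-1 *: (f (h *: w + (h *: v + x)) - f (h *: v + x))).
  apply/funext => h; rewrite -scalerDr [h *: (v + w)]scalerDr; congr (_ *: _).
  have -> : h *: v + h *: w + x = h *: w + (h *: v + x) by rewrite addrCA addrA.
  by rewrite [RHS]addrC subrKA.
apply: cvgD; first exact/is_deriveP.
apply/cvgrPdist_lt => e e0.
have /cvgrPdist_lt/(_ e e0)/nbhs_ballP[r /= r0 Hr] := cg x.
near=> h.
have h0 : h != 0 by near: h; exact: nbhs_dnbhs_neq.
have dl s := (is_derive_line f (h *: v + x) w s _).1 (dw (s *: w + (h *: v + x))).
have [c ch] := MVT0 h dl; rewrite scale0r add0r => ->.
rewrite /GRing.scale /= mulrCA mulVf// mulr1.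
apply: Hr; rewrite -ball_normE /=.
have -> : x - (c *: w + (h *: v + x)) = - (c *: w + h *: v).
  by rewrite addrA opprD addrCA subrr addr0.
rewrite normrN (le_lt_trans (ler_normD _ _))// !normrZ.
have N0 : 0 < `|w| + `|v| + 1 by rewrite ltr_wpDl// addr_ge0.
have hr : `|h| < r / (`|w| + `|v| + 1).
  near: h; apply: dnbhs0_lt; exact: divr_gt0.
move: hr; rewrite ltr_pdivlMr// => hr; apply: le_lt_trans hr.
have := ler_wpM2r (normr_ge0 w) ch; have := normr_ge0 h; lra.
Unshelve. all: by end_near. Qed.

End directional_derivative.

Section C1_functions.
Variables (R : realType) (k : nat).
Notation RT := (measurableTypeR R).
Implicit Types f g : 'cV[R]_k -> R.

Definition C1 f (df : 'I_k -> 'cV[R]_k -> R) :=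
  [/\ continuous f, forall i x, is_derive x (unitv R i) f (df i x)
    & forall i, continuous (df i)].

(** The coordinates of [v] are added one at a time by [is_derive_addv], the newly added direction
    being the one with a continuous derivative. *)
Lemma is_derive_C1 f df x v : C1 f df ->
  is_derive x v f (\sum_i v i 0 * df i x).
Proof.
move=> [cf Df cdf].
have -> : v = \sum_i v i 0 *: unitv R i.
  rewrite [LHS]matrix_sum_delta; apply: eq_bigr => i _.
  by rewrite big_ord1 /unitv.
rewrite (eq_bigr (fun i => v i 0 * df i x)); last first.
  move=> i _; rewrite summxE (bigD1 i)//= big1 => [|j ji]; rewrite !mxE ?eqxx.
    by rewrite addr0 mulr1.
  by rewrite eq_sym (negPf ji) mulr0.
elim: (index_enum 'I_k) => [|i r IH]; first by rewrite !big_nil; exact: is_derive0.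
rewrite !big_cons addrC [v i 0 * _ + _]addrC.
apply: (is_derive_addv (g := fun y => v i 0 * df i y) IH).
  by move=> y; exact: (is_derive_scale (v i 0) (Df i y)).
exact: continuous_scalef.
Qed.

Lemma C1M f g df dg : C1 f df -> C1 g dg ->
  C1 (fun x => f x * g x) (fun i x => df i x * g x + f x * dg i x).
Proof.
move=> [cf Df cdf] [cg Dg cdg]; split.
- exact: continuous_mulf.
- move=> i x; have dfx := Df i x; have dgx := Dg i x.
  by apply: is_derive_eq; rewrite /GRing.scale /=; ring.
- by move=> i; apply: continuous_addf; exact: continuous_mulf.
Qed.

Lemma vec_upd (t : k.-tuple RT) i s :
  vec (upd t i s) = (s : R) *: unitv R i + vec (upd t i (0 : R)).
Proof.
apply/colP => j; rewrite !mxE !tnth_mktuple.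
by case: eqVneq => _; rewrite ?andbT ?mulr1 ?mulr0 ?addr0 ?add0r.
Qed.

(** Varying coordinate i of t moves the argument along column i of A. *)
Lemma C1_partial f df (A : 'M[R]_k) mu i : C1 f df ->
  partial i (fun t => f (mu + A *m vec t)) (fun t => \sum_j A j i * df j (mu + A *m vec t)).
Proof.
move=> C1f; have [cf Df cdf] := C1f => t.
pose x0 := mu + A *m vec (upd t i (0 : R)).
have E (s : R) : mu + A *m vec (upd t i s) = s *: (A *m unitv R i) + x0.
  by rewrite vec_upd mulmxDr -scalemxAr addrCA.
have col j : (A *m unitv R i) j 0 = A j i.
  rewrite mxE (bigD1 i)//= big1 => [|l li]; rewrite !mxE ?eqxx ?mulr1 ?addr0//.
  by rewrite (negPf li) mulr0.
move: (A *m unitv R i) E col => w E col; split => [s|].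
  rewrite (_ : (fun r : R => _) = (fun r => f (r *: w + x0))); last first.
    by apply/funext => r; rewrite E.
  apply: (is_derive_line f x0 w s _).1; rewrite E.
  have := is_derive_C1 (s *: w + x0) w C1f.
  by under eq_bigr do rewrite col.
rewrite (_ : (fun s : R => _) = (fun s => \sum_j A j i * df j (s *: w + x0))); last first.
  by apply/funext => r; rewrite E.
apply: continuous_sumf => j; apply: continuous_scalef => s.
apply: (@continuous_comp _ _ _ (fun s : R => s *: w + x0) (df j)).
  exact: continuous_line.
exact: cdf.
Qed.

End C1_functions.

(** * Compactly supported functions and the class [C2c] *)

Section compact_support.
Variables (R : realType) (k : nat).
Notation RT := (measurableTypeR R).
Implicit Types f g : 'cV[R]_k -> R.

Definition ccs f := continuous f /\ exists M : R, forall x, M < `|x| -> f x = 0.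

Lemma ccs_mulr f g : ccs f -> continuous g -> ccs (fun x => f x * g x).
Proof.
move=> [cf [M hM]] cg; split; first exact: continuous_mulf.
by exists M => x xM; rewrite hM// mul0r.
Qed.

Lemma ccs_sum (I : Type) (r : seq I) (F : I -> 'cV[R]_k -> R) :
  (forall i, ccs (F i)) -> ccs (fun x => \sum_(i <- r) F i x).
Proof.
move=> cF; split; first by apply: continuous_sumf => i; case: (cF i).
elim: r => [|i r [M hM]]; first by exists 0 => x _; rewrite big_nil.
have [_ [N hN]] := cF i; exists (Num.max M N) => x; rewrite gt_max => /andP[xM xN].
by rewrite big_cons hM// hN// addr0.
Qed.

Lemma ccs_bounded f : ccs f -> exists B : R, forall x, `|f x| <= B.
Proof. by move=> [cf sf]; exact: continuous_compact_support_bounded. Qed.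

Lemma continuous_measurable_affine (A : 'M[R]_k) mu f : continuous f ->
  measurable_fun setT (fun t : k.-tuple RT => f (mu + A *m vec t)).
Proof.
move=> cf; rewrite (_ : (fun t => _) = (f \o @vec R k) \o affine_tuple A mu); last first.
  by apply/funext => t /=; rewrite vec_affine_tuple.
apply: measurableT_comp; first exact: continuous_measurable_vec.
exact: measurable_affine_tuple.
Qed.

Lemma ccs_bounded_mfun (A : 'M[R]_k) mu f : ccs f ->
  bounded_mfun (fun t : k.-tuple RT => f (mu + A *m vec t)).
Proof.
move=> cf; split; first by apply: continuous_measurable_affine; case: cf.
by have [B hB] := ccs_bounded cf; exists B.
Qed.

Lemma compact_support_derive f v (M : R) : (forall x, M < `|x| -> f x = 0) ->
  forall x, M < `|x| -> 'D_v f x = 0.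
Proof.
move=> hM x xM.
have oN : open [set y : 'cV[R]_k | M < `|y|].
  rewrite (_ : [set y | _] = (fun x : 'cV[R]_k => `|x|) @^-1` [set y | M < y])//.
  by apply: open_comp => [y _|]; [exact: norm_continuous|exact: open_gt].
have f0 : \near x, f x = cst 0 x.
  by apply: filterS (open_nbhs_nbhs (conj oN xM)) => y /hM.
by rewrite (near_eq_derive v f0) derive_cst.
Qed.

Lemma C1_lin (I : Type) (r : seq I) (c : I -> R) (f : I -> 'cV[R]_k -> R) df :
  (forall j, C1 (f j) (df j)) ->
  C1 (fun x => \sum_(j <- r) c j * f j x) (fun i x => \sum_(j <- r) c j * df j i x).
Proof.
move=> Cf; split.
- by apply: continuous_sumf => j; apply: continuous_scalef; case: (Cf j).
- move=> i x; elim: r => [|j r IH].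
    under eq_fun do rewrite big_nil; rewrite big_nil; exact: is_derive_cst.
  under eq_fun do rewrite big_cons; rewrite big_cons.
  have [_ /(_ i x) dfj _] := Cf j.
  have dcf : is_derive x (unitv R i) (fun x => c j * f j x) (c j * df j i x).
    exact: (is_deriveZ (c j) dfj).
  exact: is_deriveD.
- move=> i; apply: continuous_sumf => j; apply: continuous_scalef.
  by have [_ _] := Cf j.
Qed.

Section C2c_facts.
Variable phi : 'cV[R]_k -> R.
Hypothesis Cphi : C2c phi.
Notation d j := ('D_(unitv R j) phi).
Notation dd i j := ('D_(unitv R i) ('D_(unitv R j) phi)).

Lemma C2c_C1 : C1 phi (fun j => d j).
Proof.
have [_ cf Df _] := Cphi; split => // i; last by have [] := Df i.
by move=> x; apply: derivableP; have [] := Df i.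
Qed.

Lemma C2c_C1_partial j : C1 (d j) (fun i => dd i j).
Proof.
have [_ _ Df DDf] := Cphi; split => [|i x|i].
- by have [] := Df j.
- by apply: derivableP; have [] := DDf i j.
- by have [] := DDf i j.
Qed.

Lemma C2c_ccs : [/\ ccs phi, forall j, ccs (d j) & forall i j, ccs (dd i j)].
Proof.
have [[M hM] cf Df DDf] := Cphi; split; first by split => //; exists M.
  move=> j; split; first by have [] := Df j.
  by exists M; exact: compact_support_derive.
move=> i j; split; first by have [] := DDf i j.
by exists M; do 2 apply: compact_support_derive.
Qed.

End C2c_facts.
End compact_support.

Lemma Rintegral_sum d (T : measurableType d) (R : realType) (mu : {measure set T -> \bar R})
    (I : Type) (r : seq I) (f : I -> T -> R) :
  (forall i, mu.-integrable setT (fun t => (f i t)%:E)) ->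
  \int[mu]_t (\sum_(i <- r) f i t) = \sum_(i <- r) \int[mu]_t f i t.
Proof.
move=> intf.
suff [] : mu.-integrable setT (fun t => (\sum_(i <- r) f i t)%:E) /\
  \int[mu]_t (\sum_(i <- r) f i t) = \sum_(i <- r) \int[mu]_t f i t by [].
elim: r => [|i r [IH1 IH2]].
  rewrite big_nil; split.
    by under eq_fun do rewrite big_nil; exact: integrable0.
  by under eq_Rintegral do rewrite big_nil; rewrite /Rintegral integral0.
split.
  by under eq_fun do rewrite big_cons EFinD; exact: integrableD.
rewrite big_cons -IH2 -(RintegralD measurableT (intf i) IH1).
by apply: eq_Rintegral => t _; rewrite big_cons.
Qed.

(** * Dirichlet form and Poincare inequality in the original coordinates *)

Section dirichlet.
Variables (R : realType) (k : nat) (mu : 'cV[R]_k) (G A L : 'M[R]_k).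
Hypotheses (AG : A *m A^T = G) (Au : A \in unitmx) (Lsym : L^T = L).
Notation RT := (measurableTypeR R).
Variable phi : 'cV[R]_k -> R.
Hypothesis Cphi : C2c phi.
Notation d j := ('D_(unitv R j) phi).
Notation dd i j := ('D_(unitv R i) ('D_(unitv R j) phi)).
Notation E f := (\int[gauss_tuple R k]_t f (mu + A *m vec t)).

(** The generator without its factor k / (Lambda : Sigma), with the score replaced by its Gaussian
    value - G^-1 (x - mu). *)
Definition gauss_gen (f : 'cV[R]_k -> R) (x : 'cV[R]_k) : R :=
  ddot L (hess f x) - ((x - mu)^T *m invmx G *m L *m grad f x) 0 0.

Lemma mx_formE (u v : 'cV[R]_k) (M : 'M[R]_k) :
  (u^T *m M *m v) 0 0 = \sum_i \sum_j u i 0 * M i j * v j 0.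
Proof.
rewrite mxE exchange_big /=; apply: eq_bigr => j _; rewrite mxE mulr_suml.
by apply: eq_bigr => i _; rewrite mxE.
Qed.

Lemma continuous_coord (i : 'I_k) : continuous (fun x : 'cV[R]_k => x i 0).
Proof. exact: coord_continuous. Qed.

Lemma continuous_gauss_gen : continuous (gauss_gen phi).
Proof.
have [_ cd cdd] := C2c_ccs Cphi.
have -> : gauss_gen phi = (fun x => \sum_i \sum_j L j i * dd i j x +
    -1 * \sum_i \sum_j (x i 0 - mu i 0) * (invmx G *m L) i j * d j x).
  apply/funext => x; rewrite /gauss_gen /ddot mulN1r; congr (_ - _).
    by apply: eq_bigr => i _; apply: eq_bigr => j _; rewrite mxE.
  rewrite -(mulmxA _ (invmx G)) mx_formE.
  by apply: eq_bigr => i _; apply: eq_bigr => j _; rewrite !mxE.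
apply: continuous_addf.
  apply: continuous_sumf => i; apply: continuous_sumf => j; apply: continuous_scalef.
  by case: (cdd i j).
apply: continuous_scalef; apply: continuous_sumf => i; apply: continuous_sumf => j.
apply: continuous_mulf; last by case: (cd j).
apply: continuous_mulf; last exact: cst_continuous.
by apply: continuous_addf; [exact: continuous_coord|exact: cst_continuous].
Qed.

Lemma ccs_gauss_gen : ccs (gauss_gen phi).
Proof.
split; first exact: continuous_gauss_gen.
have [[M hM] _ _ _] := Cphi; exists M => x xM.
have hd j : d j x = 0 by exact: (compact_support_derive _ hM xM).
have hdd i j : dd i j x = 0.
  exact: (compact_support_derive _ (compact_support_derive (unitv R j) hM) xM).
rewrite /gauss_gen; have -> : hess phi x = 0 by apply/matrixP => i j; rewrite !mxE hdd.
have -> : grad phi x = 0 by apply/colP => i; rewrite !mxE hd.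
rewrite mulmx0 mxE subr0 /ddot big1// => i _.
by rewrite big1// => j _; rewrite mxE mulr0.
Qed.

Lemma ccs_dirichlet (M : 'M[R]_k) : ccs (fun x => ((grad phi x)^T *m M *m grad phi x) 0 0).
Proof.
have [_ cd cdd] := C2c_ccs Cphi.
rewrite (_ : (fun x => _) = (fun x => \sum_i \sum_j d i x * (M i j * d j x))); last first.
  apply/funext => x; rewrite mx_formE; apply: eq_bigr => i _; apply: eq_bigr => j _.
  by rewrite !mxE mulrA.
apply: ccs_sum => i; apply: ccs_sum => j; apply: ccs_mulr => //.
by apply: continuous_scalef; case: (cd j).
Qed.

(* Gaussian integration by parts for the vector field A^-1 L (phi grad phi),
   in the standard coordinates x = mu + A t. *)
Lemma gauss_dirichlet :
  E (fun x => phi x * gauss_gen phi x) =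
  - E (fun x => ((grad phi x)^T *m L *m grad phi x) 0 0).
Proof.
have [cphi cd cdd] := C2c_ccs Cphi.
have P1 := gauss_tuple_setT R k.
(* The field is V = B (phi grad phi). Differentiating in t brings in a factor A, and A B = L
   restores the matrix of the generator. *)
pose B := invmx A *m L.
have ABL : A *m B = L by rewrite mulKVmx.
pose V i x := \sum_j B i j * (phi x * d j x).
pose dV i l x := \sum_j B i j * (d l x * d j x + phi x * dd l j x).
have C1V i : C1 (V i) (dV i).
  apply: (@C1_lin _ _ _ _ (B i) (fun j x => phi x * d j x)
    (fun j l x => d l x * d j x + phi x * dd l j x)).
  by move=> j; apply: C1M; [exact: C2c_C1|exact: C2c_C1_partial].
have ccsV i : ccs (V i).
  apply: ccs_sum => j; under eq_fun do rewrite mulrCA.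
  by apply: ccs_mulr => //; apply: continuous_scalef; case: (cd j).
have ccsdV i l : ccs (dV i l).
  apply: ccs_sum => j; split.
    apply: continuous_scalef; have [_ _] := C1M (C2c_C1 Cphi) (C2c_C1_partial Cphi j).
    exact.
  have [[M hM] _ _ _] := Cphi; exists M => x xM.
  by rewrite hM// mul0r addr0 (compact_support_derive _ hM xM) mul0r mulr0.
pose F i (t : k.-tuple RT) := V i (mu + A *m vec t).
pose F' i (t : k.-tuple RT) := \sum_l A l i * dV i l (mu + A *m vec t).
have bF i : bounded_mfun (F i) by exact: ccs_bounded_mfun.
have bF' i : bounded_mfun (F' i).
  apply: (@ccs_bounded_mfun _ _ _ _ (fun x => \sum_l A l i * dV i l x)).
  apply: ccs_sum => l; under eq_fun do rewrite mulrC.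
  by apply: ccs_mulr => //; exact: cst_continuous.
have domF i := bounded_mfun_dominated (bF i); have domF' i := bounded_mfun_dominated (bF' i).
have izF i := dominated_mul_integrable (dominated_tnth R i) (domF i).
have iF' i := dominated_integrable (domF' i).
have stF i := stein (domF i) (domF' i) (C1_partial A mu i (C1V i)).
have : \int[gauss_tuple R k]_t (\sum_i (F' i t - tnth t i * F i t)) = 0.
  rewrite Rintegral_sum; last first.
    by move=> i; under eq_fun do rewrite EFinB; exact: integrableB.
  apply: big1 => i _; rewrite (RintegralB measurableT (iF' i) (izF i)).
  by apply/eqP; rewrite subr_eq0; apply/eqP; exact: stF.
have bpg := ccs_bounded_mfun A mu (ccs_mulr cphi continuous_gauss_gen).
have bD := ccs_bounded_mfun A mu (ccs_dirichlet L).
(* div V - t . V is the quantity that Stein's identity integrates to 0. The product rule splits it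
   into phi times the generator plus the energy, because t' B = (x - mu)' G^-1 L. *)
have pointwise t : \sum_i (F' i t - tnth t i * F i t) =
    phi (mu + A *m vec t) * gauss_gen phi (mu + A *m vec t) +
    ((grad phi (mu + A *m vec t))^T *m L *m grad phi (mu + A *m vec t)) 0 0.
  rewrite /F' /F; set x := mu + A *m vec t.
  have -> : \sum_i (\sum_l A l i * dV i l x - tnth t i * V i x) =
      \sum_l \sum_j L l j * (d l x * d j x + phi x * dd l j x) -
      phi x * ((vec t)^T *m B *m grad phi x) 0 0.
    rewrite sumrB; congr (_ - _).
      rewrite exchange_big /=; apply: eq_bigr => l _.
      under eq_bigr do rewrite mulr_sumr.
      rewrite exchange_big /=; apply: eq_bigr => j _.
      rewrite -[in RHS]ABL mxE mulr_suml; apply: eq_bigr => i _.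
      by rewrite mulrA.
    rewrite mx_formE mulr_sumr; apply: eq_bigr => i _.
    rewrite !mulr_sumr; apply: eq_bigr => j _; rewrite !mxE; ring.
  rewrite /gauss_gen.
  have -> : (x - mu)^T *m invmx G *m L = (vec t)^T *m B.
    rewrite /x addrAC subrr add0r -AG invmx_gram// trmx_mul !mulmxA.
    by rewrite mulmxK// unitmx_tr.
  rewrite mulrBr addrAC; congr (_ - _).
  rewrite mx_formE /ddot mulr_sumr -big_split /=; apply: eq_bigr => i _.
  rewrite mulr_sumr -big_split /=; apply: eq_bigr => j _.
  by rewrite !mxE -[in L j i]Lsym mxE; ring.
under eq_Rintegral do rewrite pointwise.
rewrite (RintegralD1 P1 bpg bD) => /eqP; rewrite addr_eq0 => /eqP.
exact.
Qed.

(** The gradient in the coordinates t is A^T grad phi, of squared length grad phi' A A^T grad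
    phi. *)
Lemma gauss_poincare :
  E (fun x => phi x ^+ 2) - (E phi) ^+ 2 <=
  E (fun x => ((grad phi x)^T *m G *m grad phi x) 0 0).
Proof.
have [cphi cd cdd] := C2c_ccs Cphi.
have P1 := gauss_tuple_setT R k.
pose F' i (t : k.-tuple RT) := \sum_j A j i * d j (mu + A *m vec t).
have bF' i : bounded_mfun (F' i).
  apply: (@ccs_bounded_mfun _ _ _ _ (fun x => \sum_l A l i * d l x)).
  apply: ccs_sum => l; under eq_fun do rewrite mulrC.
  by apply: ccs_mulr => //; exact: cst_continuous.
have pF i := C1_partial A mu i (C2c_C1 Cphi).
apply: le_trans (gauss_tuple_poincare (ccs_bounded_mfun A mu cphi) bF' pF) _.
rewrite -(Rintegral_sum1 P1); last by move=> i; exact: bounded_mfunX.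
rewrite le_eqVlt; apply/orP; left; apply/eqP.
apply: eq_Rintegral => t _; rewrite /F'; set x := mu + A *m vec t.
transitivity (((A^T *m grad phi x)^T *m (A^T *m grad phi x)) 0 0).
  rewrite mxE; apply: eq_bigr => i _; rewrite !mxE expr2.
  by congr (_ * _); apply: eq_bigr => j _; rewrite !mxE.
by rewrite trmx_mul trmxK !mulmxA -(mulmxA _ A) AG.
Qed.
End dirichlet.

(** * Square-integrable functions and continuity of the inner product *)

Section L2.
Context d (T : measurableType d) (R : realType).
Variable mu : {measure set T -> \bar R}.
Implicit Types f g : T -> R.

Definition L2 f := measurable_fun setT f /\ (\int[mu]_t (f t ^+ 2)%:E < +oo)%E.

Lemma L2_sqr_integrable f : L2 f -> mu.-integrable setT (fun t => (f t ^+ 2)%:E).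
Proof.
move=> [mf fi]; apply/integrableP; split.
  by apply/measurable_EFinP; exact: measurable_funX.
by under eq_integral do rewrite gee0_abs ?lee_fin ?sqr_ge0//.
Qed.

Lemma L2_mul_integrable f g : L2 f -> L2 g -> mu.-integrable setT (fun t => (f t * g t)%:E).
Proof.
move=> Lf Lg; have [[mf _] [mg _]] := (Lf, Lg).
apply: (@le_integrable _ _ _ mu _ _ _ (fun t => ((f t ^+ 2)%:E + (g t ^+ 2)%:E)%E)) => //.
- by apply/measurable_EFinP; exact: measurable_funM.
- move=> t _ /=; rewrite lee_fin normrM [leRHS]ger0_norm ?addr_ge0 ?sqr_ge0//.
  rewrite -[f t ^+ 2]real_normK ?num_real// -[g t ^+ 2]real_normK ?num_real//.
  have := sqr_ge0 (`|f t| - `|g t|); have := mulr_ge0 (normr_ge0 (f t)) (normr_ge0 (g t)).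
  nra.
- by apply: integrableD => //; exact: L2_sqr_integrable.
Qed.

Lemma integrable_sqr_L2 f : measurable_fun setT f ->
  mu.-integrable setT (fun t => (f t ^+ 2)%:E) -> L2 f.
Proof.
move=> mf /integrableP[_ fi]; split => //; apply: le_lt_trans fi.
rewrite le_eqVlt; apply/orP; left; apply/eqP; apply: eq_integral => t _.
by rewrite gee0_abs ?lee_fin ?sqr_ge0.
Qed.

Lemma L2D f g : L2 f -> L2 g -> L2 (fun t => f t + g t).
Proof.
move=> Lf Lg; have [[mf _] [mg _]] := (Lf, Lg).
apply: integrable_sqr_L2; first exact: measurable_funD.
have fg := L2_mul_integrable Lf Lg.
have := integrableD measurableT (integrableD measurableT (L2_sqr_integrable Lf)
  (L2_sqr_integrable Lg)) (integrableD measurableT fg fg).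
by apply: eq_integrable => // t _; rewrite -!EFinD; congr _%:E; ring.
Qed.

Lemma L2Z (c : R) f : L2 f -> L2 (fun t => c * f t).
Proof.
move=> Lf; have [mf _] := Lf.
apply: integrable_sqr_L2; first exact: measurable_funM.
have := integrableZl measurableT (c ^+ 2) (L2_sqr_integrable Lf).
by apply: eq_integrable => // t _; rewrite exprMn EFinM.
Qed.

Lemma L2B f g : L2 f -> L2 g -> L2 (fun t => f t - g t).
Proof.
move=> Lf /(L2Z (-1)) Lg; have := L2D Lf Lg.
by under eq_fun do rewrite mulN1r.
Qed.

Lemma cauchy_schwarz_Rintegral f g : L2 f -> L2 g ->
  (\int[mu]_t (f t * g t)) ^+ 2 <= \int[mu]_t (f t ^+ 2) * \int[mu]_t (g t ^+ 2).
Proof.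
move=> Lf Lg; set B := \int[mu]_t (f t * g t).
set A := \int[mu]_t (f t ^+ 2); set C := \int[mu]_t (g t ^+ 2).
have fg := L2_mul_integrable Lf Lg.
have f2 := L2_sqr_integrable Lf; have g2 := L2_sqr_integrable Lg.
have quad s : 0 <= A + 2 * s * B + s ^+ 2 * C.
  have <- : \int[mu]_t ((f t + s * g t) ^+ 2) = A + 2 * s * B + s ^+ 2 * C.
    transitivity (\int[mu]_t (f t ^+ 2 + 2 * s * (f t * g t) + s ^+ 2 * (g t ^+ 2))).
      by apply: eq_Rintegral => t _; ring.
    have i1 := integrableZl measurableT (2 * s) fg.
    have i2 := integrableZl measurableT (s ^+ 2) g2.
    rewrite (RintegralD measurableT (integrableD measurableT f2 i1) i2).
    rewrite (RintegralD measurableT f2 i1).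
    by rewrite (RintegralZl _ measurableT fg) (RintegralZl _ measurableT g2).
  by apply: Rintegral_ge0 => t _; exact: sqr_ge0.
have C0 : 0 <= C by apply: Rintegral_ge0 => t _; exact: sqr_ge0.
have [C1|C1] := eqVneq C 0.
  have [->|B0] := eqVneq B 0; first by rewrite C1 mulr0 expr0n.
  (* If C = 0 the polynomial is affine in s; this s would give it the value -1, so B = 0. *)
  have := quad (- (A + 1) / (2 * B)).
  rewrite C1 mulr0 addr0 (_ : 2 * _ * B = - (A + 1)); first lra.
  by field.
have Cp : 0 < C by rewrite lt_neqAle eq_sym C1.
(* The minimiser of the quadratic polynomial. *)
have := quad (- B / C); rewrite (_ : _ + _ + _ = (A * C - B ^+ 2) / C); last by field.
by rewrite pmulr_lge0 ?invr_gt0// subr_ge0.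
Qed.

Lemma cauchy_schwarz_cvg0 (u v : nat -> T -> R) :
  (forall n, L2 (u n)) -> (forall n, L2 (v n)) ->
  \int[mu]_t (u n t ^+ 2) @[n --> \oo] --> (0 : R) ->
  (exists l : R, \int[mu]_t (v n t ^+ 2) @[n --> \oo] --> l) ->
  \int[mu]_t (u n t * v n t) @[n --> \oo] --> (0 : R).
Proof.
move=> Lu Lv u0 [l vl]; apply/norm_cvg0P.
apply: (@squeeze_cvgr _ _ _ _ (cst 0)
  (fun n => Num.sqrt (\int[mu]_t (u n t ^+ 2) * \int[mu]_t (v n t ^+ 2)))).
- apply: nearW => n; rewrite normr_ge0 /= -sqrtr_sqr ler_wsqrtr//.
  exact: cauchy_schwarz_Rintegral.
- exact: cvg_cst.
- rewrite -[X in _ --> X]sqrtr0 -[X in Num.sqrt X](mul0r l).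
  apply: (@cvg_comp _ _ _ _ Num.sqrt); last exact: sqrt_continuous.
  exact: cvgM.
Qed.

(** With a = u - f and b = v - g, one has u v = a b + a g + b f + f g, and Cauchy-Schwarz sends the
    first three integrals to 0. *)
Lemma L2_cvg_mul (u v : nat -> T -> R) (f g : T -> R) :
  (forall n, L2 (u n)) -> (forall n, L2 (v n)) -> L2 f -> L2 g ->
  (\int[mu]_t ((u n t - f t) ^+ 2)%:E)%E @[n --> \oo] --> 0%E ->
  (\int[mu]_t ((v n t - g t) ^+ 2)%:E)%E @[n --> \oo] --> 0%E ->
  \int[mu]_t (u n t * v n t) @[n --> \oo] --> \int[mu]_t (f t * g t).
Proof.
move=> Lu Lv Lf Lg /fine_cvg uf /fine_cvg vg.
pose a n t := u n t - f t; pose b n t := v n t - g t.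
have La n : L2 (a n) by exact: L2B. have Lb n : L2 (b n) by exact: L2B.
have cst_cvg (h : T -> R) : exists l : R, \int[mu]_t (h t ^+ 2) @[n --> \oo] --> l.
  by eexists; exact: cvg_cst.
have c1 := cauchy_schwarz_cvg0 La Lb uf (ex_intro _ 0 vg).
have c2 := cauchy_schwarz_cvg0 La (fun=> Lg) uf (cst_cvg g).
have c3 := cauchy_schwarz_cvg0 Lb (fun=> Lf) vg (cst_cvg f).
have -> : (fun n => \int[mu]_t (u n t * v n t)) =
    (fun n => \int[mu]_t (a n t * b n t) + \int[mu]_t (a n t * g t) +
              \int[mu]_t (b n t * f t) + \int[mu]_t (f t * g t)).
  apply/funext => n.
  have i1 := L2_mul_integrable (La n) (Lb n).
  have i2 := L2_mul_integrable (La n) Lg.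
  have i3 := L2_mul_integrable (Lb n) Lf.
  have i4 := L2_mul_integrable Lf Lg.
  rewrite -(RintegralD measurableT i1 i2).
  rewrite -(RintegralD measurableT (integrableD measurableT i1 i2) i3).
  rewrite -(RintegralD measurableT (integrableD measurableT (integrableD measurableT i1 i2) i3) i4).
  by apply: eq_Rintegral => t _; rewrite /a /b; ring.
rewrite -[X in _ --> X]add0r -{1}[0]addr0 -{1}[0]addr0.
by apply: cvgD; [apply: cvgD; [exact: cvgD|]|exact: cvg_cst].
Qed.
End L2.

(** * Gaussian moments and the score *)

Section moments.
Variables (R : realType) (k : nat).
Notation RT := (measurableTypeR R).

(** Stein's identity for the constant function 1. *)
Lemma gauss_tuple_mean (i : 'I_k) : \int[gauss_tuple R k]_t (tnth t i : R) = 0.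
Proof.
have P1 := gauss_tuple_setT R k.
have d1 := bounded_mfun_dominated (bounded_mfun_cst (k.-tuple RT) (1 : R)).
have d0 := bounded_mfun_dominated (bounded_mfun_cst (k.-tuple RT) (0 : R)).
have p10 : partial i (cst 1 : k.-tuple RT -> R) (cst 0).
  by move=> t; split => [s|]; [exact: is_derive_cst|exact: cst_continuous].
have := stein d1 d0 p10; rewrite Rintegral_cst1// => ->.
by apply: eq_Rintegral => t _; rewrite mulr1.
Qed.

(** Stein's identity in direction i for the function t_j. *)
Lemma gauss_tuple_cov (i j : 'I_k) :
  \int[gauss_tuple R k]_t (tnth t i * tnth t j : R) = (i == j)%:R.
Proof.
have P1 := gauss_tuple_setT R k.
have d0 := bounded_mfun_dominated (bounded_mfun_cst (k.-tuple RT) ((i == j)%:R : R)).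
have pj : partial i (fun t : k.-tuple RT => tnth t j : R) (cst (i == j)%:R).
  move=> t; split => [s|]; last exact: cst_continuous.
  rewrite (_ : (fun r => _) = (fun r : R => if j == i then r else tnth t j)); last first.
    by apply/funext => r; rewrite tnth_mktuple.
  rewrite [i == j]eq_sym; case: eqVneq => _; [exact: is_derive_id|exact: is_derive_cst].
by have := stein (dominated_tnth R j) d0 pj; rewrite Rintegral_cst1// => <-.
Qed.

Lemma gauss_tuple_mul_integrable (i j : 'I_k) :
  (gauss_tuple R k).-integrable setT (fun t => (tnth t i * tnth t j : R)%:E).
Proof. exact: dominated_mul_integrable (dominated_tnth R i) (dominated_tnth R j). Qed.

Lemma gauss_tuple_linear_mean (c : 'I_k -> R) :
  \int[gauss_tuple R k]_t (\sum_i c i * tnth t i) = 0.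
Proof.
have it (i : 'I_k) := dominated_integrable (dominated_tnth R i).
rewrite Rintegral_sum; last first.
  by move=> i; under eq_fun do rewrite EFinM; exact: integrableZl.
by apply: big1 => i _; rewrite (RintegralZl _ measurableT (it i)) gauss_tuple_mean mulr0.
Qed.

Lemma gauss_tuple_linear_cov (c e : 'I_k -> R) :
  \int[gauss_tuple R k]_t ((\sum_i c i * tnth t i) * (\sum_j e j * tnth t j)) =
  \sum_i c i * e i.
Proof.
have it i j := gauss_tuple_mul_integrable i j.
have itc i j : (gauss_tuple R k).-integrable setT
    (fun t => ((c i * e j) * (tnth t i * tnth t j) : R)%:E).
  by under eq_fun do rewrite EFinM; exact: integrableZl.
transitivity (\int[gauss_tuple R k]_t
    (\sum_(ij : 'I_k * 'I_k) (c ij.1 * e ij.2) * (tnth t ij.1 * tnth t ij.2))).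
  apply: eq_Rintegral => t _.
  rewrite mulr_suml -(pair_bigA _ (fun i j => c i * e j * (tnth t i * tnth t j)))/=.
  by apply: eq_bigr => i _; rewrite mulr_sumr; apply: eq_bigr => j _; rewrite mulrACA.
rewrite Rintegral_sum; last by move=> ij; exact: itc.
rewrite -(pair_bigA _ (fun i j => \int[gauss_tuple R k]_t (c i * e j * (tnth t i * tnth t j))))/=.
apply: eq_bigr => i _; rewrite (bigD1 i)//= big1 => [|j ji].
  by rewrite (RintegralZl _ measurableT (it i i)) gauss_tuple_cov eqxx mulr1 addr0.
by rewrite (RintegralZl _ measurableT (it i j)) gauss_tuple_cov eq_sym (negPf ji) mulr0.
Qed.
End moments.

Section score.
Variables (R : realType) (k : nat) (mu : 'cV[R]_k) (G : 'M[R]_k).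
Hypothesis (Gs : G^T = G) (detG : 0 < \det G).
Notation RT := (measurableTypeR R).

Lemma C1_coord (i : 'I_k) :
  C1 (fun x : 'cV[R]_k => x i 0 - mu i 0) (fun l _ => (i == l)%:R).
Proof.
split.
- by apply: continuous_addf; [exact: continuous_coord|exact: cst_continuous].
- move=> l x.
  have dl : is_derive (0 : R) 1 (fun r : R => r * (i == l)%:R + (x i 0 - mu i 0)) (i == l)%:R.
    by apply: is_derive_eq; rewrite /GRing.scale /= mulr1 mulr0 add0r addr0.
  rewrite -[x]add0r -(scale0r (unitv R l)).
  apply: (is_derive_line (fun x : 'cV[R]_k => x i 0 - mu i 0) x (unitv R l) 0 _).2.
  rewrite (_ : (fun r => _) = (fun r : R => r * (i == l)%:R + (x i 0 - mu i 0)))//.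
  by apply/funext => r; rewrite !mxE andbT addrA.
- by move=> l; exact: cst_continuous.
Qed.

Lemma C1_eq (f g : 'cV[R]_k -> R) df dg : C1 f df -> f =1 g -> (forall i, df i =1 dg i) -> C1 g dg.
Proof.
move=> Cf fg dfg; have -> : g = f by apply/funext => x; rewrite fg.
by have -> : dg = df by apply/funext => i; apply/funext => x; rewrite dfg.
Qed.

Lemma C1_quad (M : 'M[R]_k) : M^T = M ->
  C1 (fun x => ((x - mu)^T *m M *m (x - mu)) 0 0) (fun l x => 2 * (M *m (x - mu)) l 0).
Proof.
move=> Ms.
have C1y i j := C1M (C1_coord i) (C1_coord j).
have C1i i := C1_lin (index_enum 'I_k) (fun j => M i j) (C1y i).
have := C1_lin (index_enum 'I_k) (fun=> 1) C1i.
move/C1_eq; apply.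
  move=> x; rewrite mx_formE; apply: eq_bigr => i _; rewrite mul1r.
  by apply: eq_bigr => j _; rewrite !mxE; ring.
move=> l x.
have -> : \sum_i 1 * (\sum_j M i j * ((i == l)%:R * (x j 0 - mu j 0) + (x i 0 - mu i 0) * (j == l)%:R))
   = \sum_j M l j * (x j 0 - mu j 0) + \sum_i M i l * (x i 0 - mu i 0).
  under eq_bigr do rewrite mul1r.
  under eq_bigr do under eq_bigr do rewrite mulrDr.
  under eq_bigr do rewrite big_split/=.
  rewrite big_split/=; congr (_ + _).
    rewrite (bigD1 l)//= [X in _ + X]big1 ?addr0 => [|i il].
      by apply: eq_bigr => j _; rewrite eqxx mul1r.
    by apply: big1 => j _; rewrite (negPf il) mul0r mulr0.
  apply: eq_bigr => i _; rewrite (bigD1 l)//= big1 ?addr0 => [|j jl].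
    by rewrite eqxx mulr1.
  by rewrite (negPf jl) !mulr0.
rewrite mulr_natl mulr2n mxE; congr (_ + _); apply: eq_bigr => i _; rewrite !mxE//.
by rewrite -[in M i l]Ms mxE.
Qed.

(** The logarithm of the density is a constant minus half the quadratic form, whose gradient is 2
    G^-1 (x - mu) by symmetry. *)
Lemma score_gauss_density x : score (gauss_density mu G) x = - (invmx G *m (x - mu)).
Proof.
have Ms : (invmx G)^T = invmx G by rewrite trmx_inv Gs.
have [_ Dq _] := C1_quad Ms.
pose c : R := (Num.sqrt ((2 * pi) ^+ k * \det G))^-1.
have c0 : 0 < c.
  by rewrite invr_gt0 sqrtr_gt0 mulr_gt0// exprn_gt0// mulr_gt0// pi_gt0.
pose q (x : 'cV[R]_k) := ((x - mu)^T *m invmx G *m (x - mu)) 0 0.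
apply/colP => i; rewrite mxE.
have -> : (fun x => ln (gauss_density mu G x)) = (fun x => - 2^-1 * q x + ln c).
  apply/funext => y; rewrite /gauss_density -/c -/(q y) lnM ?posrE ?expR_gt0//.
  by rewrite expRK addrC; congr (_ + _); rewrite mulNr mulNr mulrC.
have Dqx : is_derive x (unitv R i) q _ := Dq i x.
have D1 := is_deriveD (is_deriveZ (- 2^-1) Dqx) (is_derive_cst (ln c) x (unitv R i)).
have -> : 'D_(unitv R i) (fun x0 : 'cV[R]_k => - 2^-1 * q x0 + ln c) x =
   - 2^-1 *: (2 * (invmx G *m (x - mu)) i 0) + 0 := @derive_val _ _ _ _ _ _ _ D1.
by rewrite addr0 [RHS]mxE /GRing.scale /=; set s := _ i 0; field.
Qed.

End score.

(** * The gap inequality on the whole domain of the generator *)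

Section gap.
Variables (R : realType) (k : nat) (mu : 'cV[R]_k) (G A : 'M[R]_k).
Hypotheses (AG : A *m A^T = G) (detA : 0 < \det A).
Hypothesis change_of_variables : forall mu (h : k.-tuple (measurableTypeR R) -> \bar R),
    measurable_fun setT h -> (forall t, 0 <= h t)%E ->
    (\int[lebesgue_tuple R k]_t h t =
     (\det A)%:E * \int[lebesgue_tuple R k]_t h (affine_tuple A mu t))%E.
Notation RT := (measurableTypeR R).
Notation p := (gauss_density mu G).

Let Au : A \in unitmx. Proof. by rewrite unitmxE unitfE gt_eqF. Qed.
Let Gs : G^T = G. Proof. by rewrite -AG trmx_mul trmxK. Qed.
Let detG : 0 < \det G. Proof. by rewrite -AG det_mulmx det_tr mulr_gt0. Qed.

Lemma continuous_expect (f : 'cV[R]_k -> R) : continuous f ->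
  expect p f = \int[gauss_tuple R k]_t f (mu + A *m vec t).
Proof.
by move=> cf; apply: expect_gauss_density => //; exact: continuous_measurable_vec.
Qed.

Lemma continuous_score i : continuous (fun x => score p x i 0).
Proof.
rewrite (_ : (fun x : 'cV[R]_k => _) = (fun x => \sum_j (- invmx G i j) * (x j 0 - mu j 0))).
  apply: continuous_sumf => j; apply: continuous_scalef.
  by apply: continuous_addf; [exact: continuous_coord|exact: cst_continuous].
apply/funext => x; rewrite score_gauss_density// !mxE -sumrN.
by apply: eq_bigr => j _; rewrite !mxE mulNr.
Qed.

Lemma score_affine (t : k.-tuple RT) i :
  score p (mu + A *m vec t) i 0 = \sum_l (- invmx A^T i l) * tnth t l.
Proof.
rewrite score_gauss_density// addrAC subrr add0r -AG invmx_gram//.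
rewrite -mulmxA mulKmx// !mxE -sumrN.
by apply: eq_bigr => l _; rewrite mxE mulNr.
Qed.

Lemma score_mean i : expect p (fun x => score p x i 0) = 0.
Proof.
rewrite continuous_expect; last exact: continuous_score.
under eq_Rintegral do rewrite score_affine.
exact: gauss_tuple_linear_mean.
Qed.

(** In standard coordinates the score is - A^-T t, centred and linear, so its covariance is A^-T
    A^-1 = G^-1. *)
Lemma score_var_gauss_density : score_var p = invmx G.
Proof.
apply/matrixP => i j; rewrite mxE !score_mean.
rewrite continuous_expect; last first.
  by apply: continuous_mulf; apply: continuous_addf;
    [exact: continuous_score|exact: cst_continuous|exact: continuous_score|exact: cst_continuous].
transitivity (\int[gauss_tuple R k]_t ((\sum_l (- invmx A^T i l) * tnth t l) *
    (\sum_l (- invmx A^T j l) * tnth t l))).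
  by apply: eq_Rintegral => t _; rewrite !subr0 !score_affine.
rewrite gauss_tuple_linear_cov -AG invmx_gram// mxE; apply: eq_bigr => l _.
by rewrite mulrNN -trmx_inv !mxE.
Qed.

Lemma gen_expr_gauss Lambda f x :
  gen_expr p Lambda f x = k%:R / ddot Lambda (invmx G) * gauss_gen mu G Lambda f x.
Proof.
rewrite /gen_expr score_var_gauss_density score_gauss_density// -mulrA; congr (_ * _).
set c := (ddot _ _)^-1; rewrite /gauss_gen mulrBr; congr (_ + _).
  rewrite /ddot mulr_sumr; apply: eq_bigr => i _; rewrite mulr_sumr.
  by apply: eq_bigr => j _; rewrite !mxE mulrA.
rewrite linearN /= trmx_mul trmx_inv Gs -scalemxAr !mulNmx -scalemxAl.
by rewrite mxE mulNmx mxE mulrN.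
Qed.

Lemma inL2_L2 f : inL2 p f -> L2 (gauss_tuple R k) (fun t => f (mu + A *m vec t)).
Proof.
move=> [mf]; rewrite (sqnormL2_gauss_density mu AG detA change_of_variables)// => fi; split => //.
rewrite (_ : (fun t => _) = (f \o @vec R k) \o affine_tuple A mu); last first.
  by apply/funext => t /=; rewrite vec_affine_tuple.
by apply: measurableT_comp => //; exact: measurable_affine_tuple.
Qed.

Lemma ccs_L2 f : ccs f -> L2 (gauss_tuple R k) (fun t => f (mu + A *m vec t)).
Proof.
move=> cf; have bf := ccs_bounded_mfun A mu cf.
apply: integrable_sqr_L2; first by case: bf.
have := dominated_integrable (bounded_mfun_dominated (bounded_mfunX 2 bf)).
by apply: eq_integrable.
Qed.

Lemma variance_of_L2 f : inL2 p f -> variance_of p f =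
  \int[gauss_tuple R k]_t (f (mu + A *m vec t) * f (mu + A *m vec t)) -
  (\int[gauss_tuple R k]_t f (mu + A *m vec t)) ^+ 2.
Proof.
move=> Lf; have Lh := inL2_L2 Lf; have [mf _] := Lf.
have P1 := gauss_tuple_setT R k.
have L1 : L2 (gauss_tuple R k) (cst 1).
  apply: integrable_sqr_L2 => //.
  have := dominated_integrable (bounded_mfun_dominated (bounded_mfun_cst (k.-tuple RT) (1 : R))).
  by apply: eq_integrable => // t _; rewrite expr1n.
have ih : (gauss_tuple R k).-integrable setT (fun t => (f (mu + A *m vec t))%:E).
  by have := L2_mul_integrable Lh L1; apply: eq_integrable => // t _; rewrite mulr1.
rewrite /variance_of; set c := expect p f.
have cE : c = \int[gauss_tuple R k]_t f (mu + A *m vec t).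
  by rewrite /c (expect_gauss_density mu AG detA change_of_variables).
rewrite (expect_gauss_density mu AG detA change_of_variables); last first.
  by apply: measurable_funX; apply: measurable_funB.
have i2 := L2_mul_integrable Lh Lh.
have i1 := integrableZl measurableT (2 * c) ih.
have ic := integrableZl measurableT (c ^+ 2) (L2_mul_integrable L1 L1).
transitivity (\int[gauss_tuple R k]_t ((f (mu + A *m vec t) * f (mu + A *m vec t)
    - (2 * c) * f (mu + A *m vec t)) + c ^+ 2 * (cst 1 t * cst 1 t))).
  by apply: eq_Rintegral => t _ /=; ring.
rewrite (RintegralD measurableT (integrableB measurableT i2 i1) ic).
rewrite (RintegralB measurableT i2 i1) (RintegralZl _ measurableT ih).
rewrite (RintegralZl _ measurableT (L2_mul_integrable L1 L1)) -cE.
under [X in _ + _ * X]eq_Rintegral do rewrite /= mulr1.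
by rewrite Rintegral_cst1//; ring.
Qed.

Lemma expect_mul (f g : 'cV[R]_k -> R) : measurable_fun setT (f \o @vec R k) ->
  measurable_fun setT (g \o @vec R k) ->
  expect p (fun x => f x * g x) =
  \int[gauss_tuple R k]_t (f (mu + A *m vec t) * g (mu + A *m vec t)).
Proof.
move=> mf mg; rewrite (expect_gauss_density mu AG detA change_of_variables)//.
exact: measurable_funM.
Qed.

Lemma ccs_gen_expr Lambda phi : C2c phi -> ccs (gen_expr p Lambda phi).
Proof.
move=> Cphi; rewrite (_ : gen_expr p Lambda phi = (fun x => gauss_gen mu G Lambda phi x *
    (k%:R / ddot Lambda (invmx G)))); last first.
  by apply/funext => x; rewrite gen_expr_gauss mulrC.
by apply: ccs_mulr; [exact: ccs_gauss_gen|exact: cst_continuous].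
Qed.

Lemma gap_ineq_C2c Lambda (m : R) phi : (0 < k)%N -> Lambda^T = Lambda ->
  0 < ddot Lambda (invmx G) -> 0 < m ->
  (forall u : 'cV[R]_k, m * (u^T *m G *m u) 0 0 <= (u^T *m Lambda *m u) 0 0) ->
  C2c phi ->
  \int[gauss_tuple R k]_t (phi (mu + A *m vec t) * phi (mu + A *m vec t)) -
  (\int[gauss_tuple R k]_t phi (mu + A *m vec t)) ^+ 2 <=
  - (1 / (k%:R * m / ddot Lambda (invmx G))) *
  \int[gauss_tuple R k]_t (phi (mu + A *m vec t) * gen_expr p Lambda phi (mu + A *m vec t)).
Proof.
move=> k0 Ls D0 m0 mle Cphi; set D := ddot _ _ in D0 *.
have P1 := gauss_tuple_setT R k.
have [cphi _ _] := C2c_ccs Cphi.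
have bpg := ccs_bounded_mfun A mu (ccs_mulr cphi (@continuous_gauss_gen _ _ mu G Lambda _ Cphi)).
have bDL := ccs_bounded_mfun A mu (ccs_dirichlet Cphi Lambda).
have bDG := ccs_bounded_mfun A mu (ccs_dirichlet Cphi G).
have -> : \int[gauss_tuple R k]_t (phi (mu + A *m vec t) * gen_expr p Lambda phi (mu + A *m vec t)) =
   k%:R / D * - \int[gauss_tuple R k]_t ((grad phi (mu + A *m vec t))^T *m Lambda *m
     grad phi (mu + A *m vec t)) 0 0.
  rewrite -(gauss_dirichlet mu AG Au Ls Cphi) -(RintegralZl1 P1 _ bpg).
  by apply: eq_Rintegral => t _; rewrite gen_expr_gauss -/D; ring.
have k0' : (k%:R : R) != 0 by rewrite pnatr_eq0 -lt0n.
(* The factor k / D occurs both in rho and in the generator; what remains is 1/m, exactly what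
   compares the energy of G with that of Lambda. *)
rewrite mulrN mulrNN mulrA (_ : 1 / _ * _ = m^-1); last first.
  by field; rewrite k0' !gt_eqF.
apply: le_trans (gauss_poincare mu AG Cphi) _.
rewrite -(RintegralZl1 P1 _ bDL); apply: (le_Rintegral1 P1 bDG).
  exact: bounded_mfunM (bounded_mfun_cst _ _) bDL.
by move=> t; rewrite mulrC ler_pdivlMr// mulrC.
Qed.

Lemma gap_ineq_gauss Lambda (m : R) : (0 < k)%N -> Lambda^T = Lambda ->
  0 < ddot Lambda (invmx G) -> 0 < m ->
  (forall u : 'cV[R]_k, m * (u^T *m G *m u) 0 0 <= (u^T *m Lambda *m u) 0 0) ->
  gap_ineq p Lambda (k%:R * m / ddot Lambda (invmx G)).
Proof.
move=> k0 Ls D0 m0 mle f g [Lf Lg [phi [Cphi phif gphig]]].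
set rho := k%:R * m / _.
have P1 := gauss_tuple_setT R k.
have [[mf _] [mg _]] := (Lf, Lg).
have L2f := inL2_L2 Lf; have L2g := inL2_L2 Lg.
have L2phi n := ccs_L2 (let: And3 h _ _ := C2c_ccs (Cphi n) in h).
have L2gphi n := ccs_L2 (ccs_gen_expr Lambda (Cphi n)).
have L21 : L2 (gauss_tuple R k) (cst 1).
  apply: integrable_sqr_L2 => //.
  have := dominated_integrable (bounded_mfun_dominated (bounded_mfun_cst (k.-tuple RT) (1 : R))).
  by apply: eq_integrable => // t _; rewrite expr1n.
have cv (u : nat -> 'cV[R]_k -> R) h : (forall n, ccs (u n)) ->
    measurable_fun setT (h \o @vec R k) -> cvgL2 p u h ->
    (\int[gauss_tuple R k]_t ((u n (mu + A *m vec t) - h (mu + A *m vec t)) ^+ 2)%:E)%E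
      @[n --> \oo] --> 0%E.
  move=> cu mh; rewrite /cvgL2; under eq_fun => n.
    rewrite (sqnormL2_gauss_density mu AG detA change_of_variables); last first.
      apply: measurable_funB => //; apply: continuous_measurable_vec.
      by case: (cu n).
    over.
  by [].
have phif' := cv _ _ (fun n => let: And3 h _ _ := C2c_ccs (Cphi n) in h) mf phif.
have gphig' := cv _ _ (fun n => ccs_gen_expr Lambda (Cphi n)) mg gphig.
have one' : (\int[gauss_tuple R k]_t ((cst 1 t - cst 1 t : R) ^+ 2)%:E)%E @[n --> \oo] --> 0%E.
  under eq_fun do under eq_integral do rewrite subrr expr0n.
  by rewrite integral0; exact: cvg_cst.
(* Limits of the second moment, of the mean (as a product with the constant 1), and of the pairing
   with the generator; both sides of the inequality are continuous in these three numbers. *)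
have c1 := L2_cvg_mul L2phi L2phi L2f L2f phif' phif'.
have c2 := L2_cvg_mul L2phi (fun=> L21) L2f L21 phif' one'.
have c3 := L2_cvg_mul L2phi L2gphi L2f L2g phif' gphig'.
rewrite variance_of_L2// expect_mul//.
have mul1E (h : 'cV[R]_k -> R) : \int[gauss_tuple R k]_t (h (mu + A *m vec t) * cst 1 t) =
    \int[gauss_tuple R k]_t h (mu + A *m vec t).
  by apply: eq_Rintegral => t _; rewrite mulr1.
rewrite mul1E in c2.
move: c1 c2 c3;
set u1 := (fun n : nat => _); set u2 := (fun n : nat => _); set u3 := (fun n : nat => _).
move=> c1 c2 c3.
have lhs : u1 n - u2 n * u2 n @[n --> \oo] -->
    \int[gauss_tuple R k]_t (f (mu + A *m vec t) * f (mu + A *m vec t)) -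
    \int[gauss_tuple R k]_t f (mu + A *m vec t) * \int[gauss_tuple R k]_t f (mu + A *m vec t).
  by apply: cvgB => //; exact: cvgM.
have rhs : - (1 / rho) * u3 n @[n --> \oo] -->
    - (1 / rho) * \int[gauss_tuple R k]_t (f (mu + A *m vec t) * g (mu + A *m vec t)).
  by apply: cvgM => //; exact: cvg_cst.
rewrite expr2; apply: (ler_cvg_to lhs rhs); apply: nearW => n.
rewrite /u1 /u2 /u3 mul1E -expr2; exact: gap_ineq_C2c.
Qed.

End gap.

(** * Polynomially bounded sequences and their L^2 convergence *)

Section tame.
Variables (R : realType) (k : nat).
Notation RT := (measurableTypeR R).
Implicit Types (F : nat -> k.-tuple RT -> R) (f : k.-tuple RT -> R).

Definition growth (t : k.-tuple RT) : R := 1 + \sum_i tnth t i ^+ 2.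

Lemma growth_ge1 t : 1 <= growth t.
Proof. by rewrite lerDl sumr_ge0// => i _; exact: sqr_ge0. Qed.

Lemma growth_ge0 t : 0 <= growth t.
Proof. exact: le_trans (growth_ge1 t). Qed.

(* F_n tends to f pointwise, with a polynomial bound uniform in n *)
Definition tame F f := (exists C N, 0 <= C /\ forall n t, `|F n t| <= C * growth t ^+ N) /\
  forall t, F n t @[n --> \oo] --> f t.

(** With s = |t|^2 and M = 8 (N + 1), 1 + s <= M (1 + s/M) <= M exp(s/M); raising this to the power
    N + 1 turns exp(s/M) into exp(s/8). The exponent N + 1 keeps M positive when N = 0. *)
Lemma growth_exp_weight N : exists C : R, forall t, growth t ^+ N <= C * weight t.
Proof.
pose M : R := 8 * N.+1%:R.
have M1 : 0 < M by rewrite mulr_gt0.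
exists (M ^+ N.+1) => t.
have -> : weight t = expR ((\sum_i tnth t i ^+ 2) / 8).
  by rewrite /weight -expR_sum mulr_suml.
set s := \sum_i _; have s0 : 0 <= s by apply: sumr_ge0 => i _; exact: sqr_ge0.
have g1 : growth t = 1 + s by [].
apply: (@le_trans _ _ (growth t ^+ N.+1)).
  by rewrite exprS ler_peMl ?growth_ge1// exprn_ge0// growth_ge0.
have -> : expR (s / 8) = expR (s / M) ^+ N.+1.
  have a0 : N.+1%:R != 0 :> R by rewrite pnatr_eq0.
  rewrite -expRM_natl; congr expR; rewrite /M.
  by move: N.+1%:R a0 => a a0; field.
rewrite -exprMn lerXn2r// ?nnegrE ?growth_ge0//.
  by rewrite mulr_ge0 ?expR_ge0// ltW.
rewrite g1; apply: (@le_trans _ _ (M * (1 + s / M))).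
  rewrite mulrDr mulr1 [M * _]mulrC divfK ?gt_eqF// lerD2r.
  by rewrite /M -natrM ler1n.
by rewrite ler_pM2l//; exact: expR_ge1Dx.
Qed.

Lemma tame_cst f : (exists C N, 0 <= C /\ forall t, `|f t| <= C * growth t ^+ N) -> tame (fun=> f) f.
Proof. by move=> [C [N [C0 h]]]; split => [|t]; [exists C, N|exact: cvg_cst]. Qed.

Lemma tame_const (c : R) : tame (fun _ _ => c) (fun=> c).
Proof. by apply: tame_cst; exists `|c|, 0%N; split => // t; rewrite expr0 mulr1. Qed.

Lemma tame_seq (u : nat -> R) (l : R) : (forall n, `|u n| <= 1) ->
  u n @[n --> \oo] --> l -> tame (fun n _ => u n) (fun=> l).
Proof.
by move=> u1 ul; split => // ; exists 1, 0%N; split => // n t; rewrite expr0 mulr1.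
Qed.

Lemma tameD F G f g : tame F f -> tame G g ->
  tame (fun n t => F n t + G n t) (fun t => f t + g t).
Proof.
move=> [[C [N [C0 hC]]] Ff] [[D [M [D0 hD]]] Gg]; split; last first.
  by move=> t; apply: cvgD; [exact: Ff|exact: Gg].
exists (C + D), (N + M)%N; split; first exact: addr_ge0.
move=> n t; apply: (le_trans (ler_normD _ _)); rewrite mulrDl lerD//.
  apply: (le_trans (hC n t)); rewrite ler_wpM2l// ler_weXn2l ?growth_ge1//.
  exact: leq_addr.
apply: (le_trans (hD n t)); rewrite ler_wpM2l// ler_weXn2l ?growth_ge1//.
exact: leq_addl.
Qed.

Lemma tameM F G f g : tame F f -> tame G g ->
  tame (fun n t => F n t * G n t) (fun t => f t * g t).
Proof.
move=> [[C [N [C0 hC]]] Ff] [[D [M [D0 hD]]] Gg]; split; last first.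
  by move=> t; apply: cvgM; [exact: Ff|exact: Gg].
exists (C * D), (N + M)%N; split; first exact: mulr_ge0.
by move=> n t; rewrite normrM exprD mulrACA ler_pM.
Qed.

Lemma tame_sum (I : Type) (r : seq I) (F : I -> nat -> k.-tuple RT -> R)
    (f : I -> k.-tuple RT -> R) :
  (forall i, tame (F i) (f i)) ->
  tame (fun n t => \sum_(i <- r) F i n t) (fun t => \sum_(i <- r) f i t).
Proof.
move=> tF; elim: r => [|i r IH].
  under eq_fun do under eq_fun do rewrite big_nil.
  by under [X in tame _ X]eq_fun do rewrite big_nil; exact: tame_const.
under eq_fun do under eq_fun do rewrite big_cons.
by under [X in tame _ X]eq_fun do rewrite big_cons; exact: tameD.
Qed.

Lemma tame_coord i : tame (fun _ t => tnth t i : R) (fun t => tnth t i : R).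
Proof.
apply: tame_cst; exists 1, 1%N; split => // t; rewrite mul1r expr1.
apply: (@le_trans _ _ (1 + tnth t i ^+ 2)).
  by rewrite -[_ ^+ 2]real_normK ?num_real//; have := sqr_ge0 (`|tnth t i| - 2^-1); nra.
by rewrite lerD2l (bigD1 i)//= lerDl sumr_ge0// => j _; exact: sqr_ge0.
Qed.

Lemma tame_weight F f : tame F f -> exists C : R, 0 <= C /\
  (forall n t, `|F n t| <= C * weight t) /\ (forall t, `|f t| <= C * weight t).
Proof.
move=> [[C [N [C0 hC]]] Ff]; have [D hD] := growth_exp_weight N.
have bF n t : `|F n t| <= C * D * weight t.
  by apply: (le_trans (hC n t)); rewrite -mulrA ler_wpM2l.
exists (C * D); split; last split => //.
  have := le_trans (normr_ge0 _) (bF 0%N (nseq_tuple k (0 : RT))).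
  by rewrite pmulr_lge0// (lt_le_trans ltr01)// weight_ge1.
move=> t; have nF : `|F n t| @[n --> \oo] --> `|f t| by apply: cvg_norm; exact: Ff.
have cB : C * D * weight t @[_ --> \oo] --> C * D * weight t by exact: cvg_cst.
by apply: (ler_cvg_to nF cB); apply: nearW => n; exact: bF.
Qed.

(** Dominated convergence with majorant (2 C weight)^2, where C bounds the sequence and its limit
    alike. *)
Lemma tame_L2_cvg F f : (forall n, measurable_fun setT (F n)) -> measurable_fun setT f ->
  tame F f ->
  (\int[gauss_tuple R k]_t ((F n t - f t) ^+ 2)%:E)%E @[n --> \oo] --> 0%E.
Proof.
move=> mF mf tF; have [C [C0 [hF hf]]] := tame_weight tF; have [_ Ff] := tF.
have -> : 0%E = (\int[gauss_tuple R k]_t ((fun=> 0%E) t : \bar R))%E by rewrite integral0.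
have iw : (gauss_tuple R k).-integrable setT (fun t => ((2 * C * weight t) * (2 * C * weight t))%:E).
  have dw : dominated (fun t : k.-tuple RT => 2 * C * weight t).
    split; first by apply: measurable_funM => //; exact: measurable_weight.
    by exists (2 * C) => t; rewrite ger0_norm// !mulr_ge0// weight_ge0.
  exact: dominated_mul_integrable.
apply: (@dominated_cvg _ _ _ (gauss_tuple R k) setT measurableT _ _
    (fun t => ((2 * C * weight t) * (2 * C * weight t))%:E)) => //.
- by move=> n; apply/measurable_EFinP; apply: measurable_funX; exact: measurable_funB.
- move=> t _; apply: cvg_EFin; first exact: nearW.
  have Fft : F n t - f t @[n --> \oo] --> f t - f t.
    by apply: cvgB; [exact: Ff|exact: cvg_cst].
  rewrite subrr in Fft; rewrite -[X in _ --> X](mulr0 (0 : R)).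
  by under eq_fun do rewrite /= expr2; exact: cvgM.
- move=> n t _; rewrite /= lee_fin normrX -expr2 lerXn2r ?nnegrE//.
    by rewrite !mulr_ge0// weight_ge0.
  apply: (le_trans (ler_normB _ _)).
  by have := lerD (hF n t) (hf t); lra.
Qed.
End tame.

(** * Smoothness of powers of the positive part *)

Section positive_part.
Variable R : realType.

Definition pos (s : R) : R := Num.max 0 s.

Lemma pos_ge0 s : 0 <= pos s. Proof. by rewrite le_max lexx. Qed.

Lemma pos_le1 s : s <= 1 -> pos s <= 1.
Proof. by move=> s1; rewrite ge_max ler01. Qed.

Lemma pos_mulr s : s * pos s = pos s ^+ 2.
Proof. by rewrite /pos; case: ltP => s0; rewrite ?mulr0 ?expr0n// expr2. Qed.

Lemma continuous_pos : continuous pos.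
Proof.
move=> s; apply/cvgrPdist_lt => e e0; near=> t.
apply: (@le_lt_trans _ _ `|s - t|).
  rewrite /pos /Num.max; case: ltrP => s0; case: ltrP => t0; rewrite ?subrr ?normr0//.
  - by rewrite subr0 !gtr0_norm//; lra.
  - by rewrite sub0r normrN gtr0_norm// ler0_norm; lra.
near: t; exact: cvgr_dist_lt.
Unshelve. all: by end_near. Qed.

(** The first-order remainder is at most h^2 in absolute value, whatever the signs of s and s +
    h. *)
Lemma is_derive_pos2 (s : R) : is_derive s 1 (fun r => pos r ^+ 2) (2 * pos s).
Proof.
apply/is_deriveP; apply/cvgrPdist_le => e e0; near=> h.
have h0 : h != 0 by near: h; exact: nbhs_dnbhs_neq.
have he : `|h| < e by near: h; exact: dnbhs0_lt.
rewrite /GRing.scale /= mulr1.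
have -> : 2 * pos s - h^-1 * (pos (h + s) ^+ 2 - pos s ^+ 2) =
   - (h^-1 * (pos (h + s) ^+ 2 - pos s ^+ 2 - 2 * h * pos s)) by field.
rewrite normrN normrM normfV ler_pdivrMl ?normr_gt0//.
apply: (@le_trans _ _ (`|h| * `|h|)); last by rewrite ler_wpM2l// ltW.
rewrite -expr2 real_normK ?num_real// ler_norml /pos /Num.max.
by case: ltrP => s0; case: ltrP => t0; apply/andP; split; nra.
Unshelve. all: by end_near. Qed.

(** The cube equals r times the square of the positive part, so the product rule applies. *)
Lemma is_derive_pos3 (s : R) : is_derive s 1 (fun r => pos r ^+ 3) (3 * pos s ^+ 2).
Proof.
rewrite (_ : (fun r => _) = (fun r : R => r * pos r ^+ 2)); last first.
  by apply/funext => r; rewrite [in RHS]expr2 mulrA pos_mulr -exprSr.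
have dp := is_derive_pos2 s.
apply: (is_derive_eq (is_deriveM (is_derive_id s 1) dp)).
by rewrite /GRing.scale /= mulr1 -pos_mulr; ring.
Qed.

End positive_part.

(** * Compactly supported C^2 truncations of a linear function *)

Section cutoff.
Variables (R : realType) (k : nat).

Lemma C1_comp (h : 'cV[R]_k -> R) dh (r r' : R -> R) : C1 h dh ->
  (forall s : R, is_derive s 1 r (r' s)) -> continuous r' ->
  C1 (fun x => r (h x)) (fun i x => r' (h x) * dh i x).
Proof.
move=> [ch Dh cdh] Dr cr'; have cr := continuous_of_is_derive Dr; split.
- by move=> x; apply: (@continuous_comp _ _ _ h r); [exact: ch|exact: cr].
- move=> i x; rewrite -[x in is_derive x]add0r -(scale0r (unitv R i)).
  apply: (is_derive_line (fun x => r (h x)) x (unitv R i) 0 _).2.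
  have Dl : is_derive (0 : R) 1 (fun s : R => h (s *: unitv R i + x)) (dh i x).
    by apply: (is_derive_line h x (unitv R i) 0 _).1; rewrite scale0r add0r.
  have := @is_derive1_comp R r _ _ _ _ (Dr _) Dl.
  by rewrite scale0r add0r.
- move=> i; apply: continuous_mulf; last exact: cdh.
  by move=> x; apply: (@continuous_comp _ _ _ h r'); [exact: ch|exact: cr'].
Qed.

Lemma C1D (f g : 'cV[R]_k -> R) df dg : C1 f df -> C1 g dg ->
  C1 (fun x => f x + g x) (fun i x => df i x + dg i x).
Proof.
move=> [cf Df cdf] [cg Dg cdg]; split.
- exact: continuous_addf.
- by move=> i x; exact: is_deriveD.
- by move=> i; exact: continuous_addf.
Qed.

Lemma C1_cst (c : R) : C1 (fun _ : 'cV[R]_k => c) (fun _ _ => 0).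
Proof.
split; [exact: cst_continuous|by move=> i x; exact: is_derive_cst|].
by move=> i; exact: cst_continuous.
Qed.

Lemma C2c_of_C1 (f : 'cV[R]_k -> R) df ddf :
  (exists M : R, forall x, M < `|x| -> f x = 0) -> C1 f df ->
  (forall j, C1 (df j) (fun i => ddf i j)) ->
  [/\ C2c f, forall j, 'D_(unitv R j) f = df j &
      forall i j, 'D_(unitv R i) ('D_(unitv R j) f) = ddf i j].
Proof.
move=> sf [cf Df cdf] Cdf.
have DE j : 'D_(unitv R j) f = df j.
  by apply/funext => x; apply: (@derive_val _ _ _ _ _ _ _ (Df j x)).
have DDE i j : 'D_(unitv R i) ('D_(unitv R j) f) = ddf i j.
  rewrite DE; apply/funext => x; have [_ Ddf _] := Cdf j.
  by apply: (@derive_val _ _ _ _ _ _ _ (Ddf i x)).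
split => //; split => //.
  move=> i; rewrite DE; split => // x; exact: (@ex_derive _ _ _ _ _ _ _ (Df i x)).
move=> i j; rewrite DDE DE; have [_ Ddf cddf] := Cdf j.
by split => // x; exact: (@ex_derive _ _ _ _ _ _ _ (Ddf i x)).
Qed.

Variables (mu w : 'cV[R]_k).
Notation y x i := (x i 0 - mu i 0).

Definition lin (x : 'cV[R]_k) : R := \sum_i w i 0 * y x i.

Definition cut (c : R) (x : 'cV[R]_k) : R := 1 - c * \sum_i y x i ^+ 2.

(* For c > 0 the support is compact, and the cube makes the truncation C^2; it
   tends to lin when c tends to 0. *)
Definition trunc (c : R) (x : 'cV[R]_k) : R := lin x * pos (cut c x) ^+ 3.

Lemma C1_lin_fun : C1 lin (fun l _ => w l 0).
Proof.
have := C1_lin (index_enum 'I_k) (fun i => w i 0) (C1_coord mu).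
move/C1_eq; apply => // l x; rewrite (bigD1 l)//= big1 ?addr0 ?eqxx ?mulr1// => i il.
by rewrite (negPf il) mulr0.
Qed.

Lemma C1_cut c : C1 (cut c) (fun l x => - (2 * c) * y x l).
Proof.
have C1y i := C1M (C1_coord mu i) (C1_coord mu i).
have := C1D (C1_cst 1) (C1_lin (index_enum 'I_k) (fun=> - c) C1y).
move/C1_eq; apply => [x|l x].
  rewrite /cut mulr_sumr -sumrN; congr (_ + _); by apply: eq_bigr => i _ /=; rewrite expr2 mulNr.
rewrite add0r (bigD1 l)//= big1 => [|i il]; first by rewrite eqxx mul1r mulr1; ring.
by rewrite (negPf il) mul0r mulr0 addr0 mulr0.
Qed.

Definition dtrunc c l x : R :=
  w l 0 * pos (cut c x) ^+ 3 + lin x * (3 * pos (cut c x) ^+ 2 * (- (2 * c) * y x l)).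

(** The second derivative, first in direction l and then in direction i. Every summand keeps an
    explicit factor c, so it vanishes in the limit c -> 0. *)
Definition ddtrunc c i l x : R :=
  w l 0 * (3 * pos (cut c x) ^+ 2 * (- (2 * c) * y x i)) +
  w i 0 * (3 * pos (cut c x) ^+ 2 * (- (2 * c) * y x l)) +
  lin x * (3 * (2 * pos (cut c x) * (- (2 * c) * y x i)) * (- (2 * c) * y x l) +
           3 * pos (cut c x) ^+ 2 * (- (2 * c) * (l == i)%:R)).

Let c2 : continuous (fun s : R => 2 * pos s).
Proof. by apply: continuous_scalef; exact: continuous_pos. Qed.

Let c3 : continuous (fun s : R => 3 * pos s ^+ 2).
Proof.
apply: continuous_scalef; apply: continuous_of_is_derive => s; exact: is_derive_pos2.
Qed.

Lemma C1_trunc c : C1 (trunc c) (dtrunc c).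
Proof.
have := C1M C1_lin_fun (C1_comp (C1_cut c) (@is_derive_pos3 R) c3).
by move/C1_eq; apply.
Qed.

Lemma C1_dtrunc c l : C1 (dtrunc c l) (fun i => ddtrunc c i l).
Proof.
have P3 := C1_comp (C1_cut c) (@is_derive_pos3 R) c3.
have P2 := C1_comp (C1_cut c) (@is_derive_pos2 R) c2.
have T1 := C1M (C1_cst (w l 0)) P3.
have T2 := C1M (C1M (C1_cst 3) P2) (C1M (C1_cst (- (2 * c))) (C1_coord mu l)).
have := C1D T1 (C1M C1_lin_fun T2).
by move/C1_eq; apply => // i x; rewrite /ddtrunc; ring.
Qed.

Lemma trunc_support c : 0 < c -> exists M : R, forall x, M < `|x| -> trunc c x = 0.
Proof.
(* Where the cutoff is positive, y_i^2 < 1/c, and |y_i| <= y_i^2 + 1/4; the constant 2 leaves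
   room. *)
move=> c0; exists (`|mu| + 2 + c^-1) => x xM.
suff : cut c x <= 0.
  by move=> h0; rewrite /trunc /pos max_l// expr0n mulr0.
rewrite leNgt; apply/negP => h0.
suff : `|x| < `|mu| + 2 + c^-1 by rewrite ltNge (ltW xM).
have ci : 0 < c^-1 by rewrite invr_gt0.
apply/mx_norm_ltP => [|i j]; first by have := normr_ge0 mu; lra.
have yi : y x i ^+ 2 < c^-1.
  have : \sum_i y x i ^+ 2 < c^-1.
    by move: h0; rewrite /cut subr_gt0 mulrC -ltr_pdivlMr// div1r.
  apply: le_lt_trans; rewrite (bigD1 i)//= lerDl sumr_ge0// => l _; exact: sqr_ge0.
have := ler_mx_norm mu i 0; rewrite ord1 => mi.
have -> : x i 0 = mu i 0 + y x i by rewrite addrC subrK.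
apply: (le_lt_trans (ler_normD _ _)).
move: yi; rewrite -[_ ^+ 2]real_normK ?num_real// => yi.
by have := sqr_ge0 (`|y x i| - 2^-1); nra.
Qed.

End cutoff.

(** * The linear eigenfunction and the upper bound on the gap *)

Section sharpness.
Variables (R : realType) (k : nat) (mu : 'cV[R]_k) (G A : 'M[R]_k).
Hypotheses (AG : A *m A^T = G) (detA : 0 < \det A).
Hypothesis change_of_variables : forall mu (h : k.-tuple (measurableTypeR R) -> \bar R),
    measurable_fun setT h -> (forall t, 0 <= h t)%E ->
    (\int[lebesgue_tuple R k]_t h t =
     (\det A)%:E * \int[lebesgue_tuple R k]_t h (affine_tuple A mu t))%E.
Notation RT := (measurableTypeR R).
Notation p := (gauss_density mu G).
Notation pt t := (mu + A *m vec t).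
Variables (w : 'cV[R]_k) (Lambda : 'M[R]_k) (m : R).
Hypothesis Lw : Lambda *m w = m *: (G *m w).

Let Au : A \in unitmx. Proof. by rewrite unitmxE unitfE gt_eqF. Qed.
Let Gu : G \in unitmx. Proof. by rewrite -AG unitmx_mul unitmx_tr Au. Qed.

Lemma tame_eq F f (F' : nat -> k.-tuple RT -> R) (f' : k.-tuple RT -> R) :
  tame F f -> (forall n t, F n t = F' n t) -> (forall t, f t = f' t) -> tame F' f'.
Proof.
move=> tF FF ff; have -> : F' = F by apply/funext => n; apply/funext => t; rewrite FF.
by have -> : f' = f by apply/funext => t; rewrite ff.
Qed.

Lemma tameX n F (f : k.-tuple RT -> R) : tame F f ->
  tame (fun n' t => F n' t ^+ n) (fun t => f t ^+ n).
Proof.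
move=> tF; elim: n => [|n IH]; first exact: (tame_eq (tame_const k 1)).
by apply: (tame_eq (tameM tF IH)) => *; rewrite exprS.
Qed.

Lemma affine_coord t i : pt t i 0 - mu i 0 = \sum_j A i j * tnth t j.
Proof.
rewrite mxE addrAC subrr add0r mxE.
by apply: eq_bigr => j _; rewrite mxE.
Qed.

Lemma tame_affine_coord i : tame (fun _ t => pt t i 0 - mu i 0) (fun t => pt t i 0 - mu i 0).
Proof.
apply: (tame_eq (tame_sum (index_enum 'I_k)
  (fun j => tameM (tame_const k (A i j)) (tame_coord R j)))) => *; exact/esym/affine_coord.
Qed.

Lemma tame_lin : tame (fun _ t => lin mu w (pt t)) (fun t => lin mu w (pt t)).
Proof.
exact: (tame_sum (index_enum 'I_k)
  (fun j => tameM (tame_const k (w j 0)) (tame_affine_coord j))).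
Qed.

Let c (n : nat) : R := n.+1%:R^-1.

Let c_gt0 n : 0 < c n. Proof. by rewrite invr_gt0 ltr0n. Qed.

Lemma tame_c : tame (fun n (_ : k.-tuple RT) => c n) (fun=> 0).
Proof.
apply: tame_seq; last exact: cvg_harmonic.
by move=> n; rewrite gtr0_norm// invf_le1 ?ltr0n// ler1n.
Qed.

Lemma tame_pos_cut : tame (fun n t => pos (cut mu (c n) (pt t))) (fun=> 1).
Proof.
split.
  exists 1, 0%N; split => // n t; rewrite expr0 mulr1 ger0_norm ?pos_ge0//.
  apply: pos_le1; rewrite /cut gerBl; apply: mulr_ge0; first exact: ltW.
  by apply: sumr_ge0 => i _; exact: sqr_ge0.
move=> t; set q := \sum_i (pt t i 0 - mu i 0) ^+ 2.
have -> : (1 : R) = pos (1 - 0 * q) by rewrite mul0r subr0 /pos max_r.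
apply: (@cvg_comp _ _ _ (fun n => 1 - c n * q) (@pos R)); last exact: continuous_pos.
apply: cvgB; first exact: cvg_cst.
by apply: cvgM; [exact: cvg_harmonic|exact: cvg_cst].
Qed.

Lemma tame_trunc : tame (fun n t => trunc mu w (c n) (pt t)) (fun t => lin mu w (pt t)).
Proof.
apply: (tame_eq (tameM tame_lin (tameX 3 tame_pos_cut))) => // t.
by rewrite expr1n mulr1.
Qed.

Let tame2c := tameM (tame_const k (-1)) (tameM (tame_const k 2) tame_c).

Lemma tame_dtrunc l : tame (fun n t => dtrunc mu w (c n) l (pt t)) (fun=> w l 0).
Proof.
have cy := tameM tame2c (tame_affine_coord l).
have p2 := tameM (tame_const k 3) (tameX 2 tame_pos_cut).
apply: (tame_eq (tameD (tameM (tame_const k (w l 0)) (tameX 3 tame_pos_cut))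
  (tameM tame_lin (tameM p2 cy)))) => [n t|t]; last by ring.
by rewrite /dtrunc mulN1r.
Qed.

Lemma tame_ddtrunc i l : tame (fun n t => ddtrunc mu w (c n) i l (pt t)) (fun=> 0).
Proof.
have cyi := tameM tame2c (tame_affine_coord i).
have cyl := tameM tame2c (tame_affine_coord l).
have cil := tameM tame2c (tame_const k (l == i)%:R).
have p2 := tameM (tame_const k 3) (tameX 2 tame_pos_cut).
have p1 := tameM (tame_const k 2) tame_pos_cut.
have T1 := tameM (tame_const k (w l 0)) (tameM p2 cyi).
have T2 := tameM (tame_const k (w i 0)) (tameM p2 cyl).
have T3 := tameM (tameM (tame_const k 3) (tameM p1 cyi)) cyl.
apply: (tame_eq (tameD (tameD T1 T2) (tameM tame_lin (tameD T3 (tameM p2 cil)))))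
  => [n t|t]; last by ring.
by rewrite /ddtrunc !mulN1r.
Qed.

Lemma trunc_C2c n : [/\ C2c (trunc mu w (c n)),
  forall j, 'D_(unitv R j) (trunc mu w (c n)) = dtrunc mu w (c n) j &
  forall i j, 'D_(unitv R i) ('D_(unitv R j) (trunc mu w (c n))) = ddtrunc mu w (c n) i j].
Proof.
apply: (@C2c_of_C1 _ _ _ _ (ddtrunc mu w (c n))).
- exact: trunc_support.
- exact: C1_trunc.
- exact: C1_dtrunc.
Qed.

Let kappa : R := k%:R / ddot Lambda (invmx G).

(** Second derivatives of the truncations tend to 0 and gradients tend to w, so only the drift -(x -
    mu)' G^-1 Lambda w survives. *)
Lemma tame_gen_trunc : tame (fun n t => gen_expr p Lambda (trunc mu w (c n)) (pt t))
  (fun t => - (kappa * m) * lin mu w (pt t)).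
Proof.
have t1 := tame_sum (index_enum 'I_k) (fun i => tame_sum (index_enum 'I_k) (fun j =>
  tameM (tame_const k (Lambda j i)) (tame_ddtrunc i j))).
have t2 := tame_sum (index_enum 'I_k) (fun i => tame_sum (index_enum 'I_k) (fun j =>
  tameM (tameM (tame_affine_coord i) (tame_const k ((invmx G *m Lambda) i j)))
    (tame_dtrunc j))).
apply: (tame_eq (tameM (tame_const k kappa)
  (tameD t1 (tameM (tame_const k (-1)) t2)))) => [n t|t].
  rewrite (gen_expr_gauss mu AG detA change_of_variables); congr (_ * _).
  have [_ D1' D2'] := trunc_C2c n.
  have D1 j x : 'D_(unitv R j) (trunc mu w (c n)) x = dtrunc mu w (c n) j x.
    exact: (congr1 (@^~ x) (D1' j)).
  have D2 i j x : 'D_(unitv R i) ('D_(unitv R j) (trunc mu w (c n))) x =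
      ddtrunc mu w (c n) i j x.
    exact: (congr1 (@^~ x) (D2' i j)).
  rewrite /gauss_gen mulN1r; congr (_ - _).
    by apply: eq_bigr => i _; apply: eq_bigr => j _; rewrite [hess _ _ _ _]mxE D2.
  rewrite -(mulmxA _ (invmx G)) mx_formE.
  by apply: eq_bigr => i _; apply: eq_bigr => j _; rewrite [grad _ _ _ _]mxE D1 [(_ - mu) _ _]mxE [(- mu) _ _]mxE.
rewrite big1 ?add0r => [|i _]; last by rewrite big1// => j _; rewrite mulr0.
rewrite mulN1r mulrN mulNr -[in RHS]mulrA; congr (- (kappa * _)).
rewrite /lin mulr_sumr; apply: eq_bigr => i _.
transitivity ((pt t i 0 - mu i 0) * ((invmx G *m Lambda) *m w) i 0).
  by rewrite [(_ *m _ *m w) i 0]mxE mulr_sumr; apply: eq_bigr => j _; rewrite mulrA.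
(* The generalised eigenvector equation gives G^-1 Lambda w = m w. *)
by rewrite -mulmxA Lw -scalemxAr mulKmx// [(m *: w) i 0]mxE mulrCA [w i 0 * _]mulrC.
Qed.

Lemma tame_inL2 (f : 'cV[R]_k -> R) : continuous f ->
  tame (fun _ t => f (pt t)) (fun t => f (pt t)) -> inL2 p f.
Proof.
move=> cf tf; have mf := continuous_measurable_vec cf; split => //.
rewrite (sqnormL2_gauss_density mu AG detA change_of_variables)//.
have [C [C0 [_ hC]]] := tame_weight tf.
have df : dominated (fun t => f (pt t)).
  by split; [exact: continuous_measurable_affine|exists C].
have /integrableP[_] := dominated_mul_integrable df df.
apply: le_lt_trans; rewrite le_eqVlt; apply/orP; left; apply/eqP.
by apply: eq_integral => t _; rewrite -expr2 gee0_abs// lee_fin sqr_ge0.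
Qed.

Lemma continuous_lin : continuous (lin mu w).
Proof. by have [] := C1_lin_fun mu w. Qed.

Lemma lin_gen_graph : gen_graph p Lambda (lin mu w) (fun x => - (kappa * m) * lin mu w x).
Proof.
have cg : continuous (fun x => - (kappa * m) * lin mu w x).
  by apply: continuous_scalef; exact: continuous_lin.
have Llin : inL2 p (lin mu w) by apply: tame_inL2; [exact: continuous_lin|exact: tame_lin].
have Lg : inL2 p (fun x => - (kappa * m) * lin mu w x).
  by apply: tame_inL2 => //; exact: tameM (tame_const k _) tame_lin.
split => //; exists (fun n => trunc mu w (c n)).
have Ct n : C2c (trunc mu w (c n)) by have [] := trunc_C2c n.
split => //; rewrite /cvgL2.
- under eq_fun => n.
    rewrite (sqnormL2_gauss_density mu AG detA change_of_variables); last first.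
      apply: measurable_funB; apply: continuous_measurable_vec; last exact: continuous_lin.
      by have [] := C1_trunc mu w (c n).
    over.
  apply: tame_L2_cvg; [|exact: (continuous_measurable_affine A mu continuous_lin)|exact: tame_trunc].
  by move=> n; apply: continuous_measurable_affine; have [] := C1_trunc mu w (c n).
- have cgen n : continuous (gen_expr p Lambda (trunc mu w (c n))).
    by have [] := ccs_gen_expr mu AG detA change_of_variables Lambda (Ct n).
  under eq_fun => n.
    rewrite (sqnormL2_gauss_density mu AG detA change_of_variables); last first.
      by apply: measurable_funB;
        [exact: (continuous_measurable_vec (cgen n))|exact: (continuous_measurable_vec cg)].
    over.
  apply: tame_L2_cvg;
    [|exact: (continuous_measurable_affine A mu cg)|exact: tame_gen_trunc].
  by move=> n; exact: (continuous_measurable_affine A mu (cgen n)).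
Qed.

Lemma lin_affine t : lin mu w (pt t) = \sum_j (A^T *m w) j 0 * tnth t j.
Proof.
rewrite /lin; under eq_bigr do rewrite affine_coord mulr_sumr.
rewrite exchange_big /=; apply: eq_bigr => j _; rewrite mxE mulr_suml.
by apply: eq_bigr => i _; rewrite !mxE; ring.
Qed.

(** For the linear eigenfunction, of mean 0 and variance s = |A^T w|^2, the gap inequality reads s
    <= (kappa m / rho) s. *)
Lemma gap_ineq_le (rho : R) : w != 0 -> 0 < rho -> gap_ineq p Lambda rho ->
  rho <= k%:R * m / ddot Lambda (invmx G).
Proof.
move=> w0 rho0 /(_ _ _ lin_gen_graph).
have [Llin _ _] := lin_gen_graph.
have [mlin _] := Llin.
rewrite (variance_of_L2 AG detA change_of_variables)//.
rewrite (expect_mul mu AG detA change_of_variables)//; last exact: measurable_funM.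
have mean0 : \int[gauss_tuple R k]_t lin mu w (pt t) = 0.
  by under eq_Rintegral do rewrite lin_affine; exact: gauss_tuple_linear_mean.
pose s := \sum_i (A^T *m w) i 0 * (A^T *m w) i 0.
have var : \int[gauss_tuple R k]_t (lin mu w (pt t) * lin mu w (pt t)) = s.
  by under eq_Rintegral do rewrite lin_affine; exact: gauss_tuple_linear_cov.
have L2l := inL2_L2 AG detA change_of_variables Llin.
have ill := L2_mul_integrable L2l L2l.
have -> : \int[gauss_tuple R k]_t (lin mu w (pt t) * (- (kappa * m) * lin mu w (pt t))) =
    - (kappa * m) * s.
  rewrite -var -(RintegralZl _ measurableT ill).
  by apply: eq_Rintegral => t _; ring.
rewrite mean0 var expr0n subr0 [- _ * s]mulNr mulrNN mulrA.
(* Dividing by s is legitimate: A^T is invertible and w is nonzero. *)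
have s0 : 0 < s.
  have Aw0 : A^T *m w != 0.
    by apply: contra w0 => /eqP Aw; rewrite -(mulKmx (_ : A^T \in unitmx) w) ?unitmx_tr// Aw mulmx0.
  rewrite lt_neqAle; apply/andP; split; last by apply: sumr_ge0 => i _; rewrite -expr2 sqr_ge0.
  apply: contra Aw0; rewrite eq_sym psumr_eq0 => [/allP h|i _]; last by rewrite -expr2 sqr_ge0.
  apply/eqP/colP => i; rewrite [RHS]mxE; apply/eqP.
  by have := h i (mem_index_enum i); rewrite mulf_eq0 orbb.
rewrite -[X in X <= _]mul1r ler_pM2r// mul1r ler_pdivlMl// mulr1.
by rewrite /kappa mulrAC.
Qed.

End sharpness.

(** * Generalised eigenvalues and trace estimates *)

Section quadratic_forms.
Variables (R : realType) (k : nat).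
Implicit Types (M G : 'M[R]_k) (u v : 'cV[R]_k).
Notation form M u := ((u^T *m M *m u) 0 0).

Lemma ddot_trace (A B : 'M[R]_k) : ddot A B = \tr (A *m B).
Proof.
rewrite /ddot exchange_big /=; apply: eq_bigr => j _.
by rewrite mxE.
Qed.

Lemma form_sym M u v : M^T = M -> u^T *m M *m v = v^T *m M *m u.
Proof.
move=> Ms; have trE (X : 'M[R]_1) : X^T = X by apply/matrixP => i j; rewrite !ord1 mxE.
by rewrite -[LHS]trE !trmx_mul trmxK Ms mulmxA.
Qed.

Lemma formD M u v : M^T = M ->
  form M (u + v) = form M u + 2 * (v^T *m M *m u) 0 0 + form M v.
Proof.
move=> Ms; rewrite [(u + v)^T]raddfD /= !mulmxDl !mulmxDr (form_sym u v Ms).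
set a := u^T *m M *m u; set b := v^T *m M *m u; set c := v^T *m M *m v.
by rewrite !mxE; ring.
Qed.

Lemma formZ M (c : R) u : form M (c *: u) = c ^+ 2 * form M u.
Proof. by rewrite [(c *: u)^T]linearZ /= -!scalemxAl -scalemxAr scalerA mxE expr2. Qed.

Lemma form_lincomb M G (m : R) u : form (M - m *: G) u = form M u - m * form G u.
Proof.
rewrite mulmxBr mulmxBl -scalemxAr -scalemxAl mxE; congr (_ + _).
by rewrite mxE; congr (- _); rewrite mxE.
Qed.

Lemma form_id u : (u^T *m u) 0 0 = \sum_i u i 0 ^+ 2.
Proof. by rewrite mxE; apply: eq_bigr => i _; rewrite mxE expr2. Qed.

Lemma form_id_eq0 u : (u^T *m u) 0 0 = 0 -> u = 0.
Proof.
rewrite form_id => /eqP; rewrite psumr_eq0 => [/allP h|i _]; last exact: sqr_ge0.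
by apply/colP => i; apply/eqP; rewrite mxE; have := h i (mem_index_enum i); rewrite sqrf_eq0.
Qed.

(** With v = M u, a = |v|^2 and b the form at v, the form at u + s v is 2 s a + s^2 b, which is
    negative for a small negative s unless a = 0. *)
Lemma psd_kernel M u : M^T = M -> (forall v, 0 <= form M v) -> form M u = 0 -> M *m u = 0.
Proof.
move=> Ms Mp Mu; pose v := M *m u.
have vMu : v^T *m M *m u = v^T *m v by rewrite -mulmxA.
apply: form_id_eq0; rewrite -/v; set a := _ 0 0.
have a0 : 0 <= a by rewrite /a form_id sumr_ge0// => i _; exact: sqr_ge0.
have b0 := Mp v; set b := form M v in b0.
have b1 : b + 1 != 0 by rewrite gt_eqF// ltr_wpDl.
(* Dividing by b + 1 instead of b covers b = 0; the value is - a^2 (b + 2) / (b + 1)^2. *)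
have := Mp (u + (- a / (b + 1)) *: v).
rewrite formD// Mu add0r formZ -/b [(_ *: v)^T]linearZ /= -!scalemxAl vMu [in X in 2 * X]mxE -/a.
have -> : 2 * (- a / (b + 1) * a) + (- a / (b + 1)) ^+ 2 * b =
   - (a ^+ 2 * (b + 2)) / (b + 1) ^+ 2 by field.
rewrite pmulr_lge0 ?invr_gt0 ?exprn_gt0 ?ltr_wpDl// oppr_ge0 => h.
have a2 : a ^+ 2 * (b + 2) = 0.
  by apply/eqP; rewrite eq_le h mulr_ge0 ?sqr_ge0// addr_ge0.
by move/eqP: a2; rewrite mulf_eq0 sqrf_eq0 => /orP[/eqP//|]; rewrite gt_eqF// ltr_wpDl.
Qed.

Lemma continuous_form M : continuous (fun u => form M u).
Proof.
rewrite (_ : (fun u => _) = (fun u => \sum_i \sum_j u i 0 * M i j * u j 0)); last first.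
  by apply/funext => u; rewrite mx_formE.
apply: continuous_sumf => i; apply: continuous_sumf => j.
apply: continuous_mulf; last exact: continuous_coord.
by apply: continuous_mulf; [exact: continuous_coord|exact: cst_continuous].
Qed.

(* The minimiser of the quotient form M / form G on the unit sphere. *)
Lemma spd_min_eigen M G : (0 < k)%N -> spd M -> spd G -> exists (m : R) (w : 'cV[R]_k),
  [/\ 0 < m, w != 0, M *m w = m *: (G *m w) & forall u, m * form G u <= form M u].
Proof.
move=> k0 [Ms Mp] [Gs Gp].
(* This is the sphere of the sup norm; the quotient is homogeneous of degree 0, so its minimum there
   is its minimum over all nonzero vectors. *)
pose S : set 'cV[R]_k := [set u | `|u| = 1].
have nz u : `|u| = 1 -> u != 0 by move=> u1; rewrite -normr_eq0 u1 oner_eq0.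
pose i0 : 'I_k := Ordinal k0.
have S0 : S !=set0.
  have d0 : unitv R i0 != 0.
    by apply/eqP => /colP/(_ i0); rewrite !mxE !eqxx => /eqP; rewrite oner_eq0.
  exists (`|unitv R i0|^-1 *: unitv R i0).
  by rewrite /S/= normrZ normfV normr_id mulVf// normr_eq0.
have cS : compact S.
  apply: bounded_closed_compact_cV.
    by exists 1; split; [exact: num_real|move=> N N1 x /= ->; exact: ltW].
  rewrite (_ : S = (fun x : 'cV[R]_k => `|x|) @^-1` [set 1]); last by [].
  by apply: preimage_closed => [x _|]; [exact: norm_continuous|exact: closed_eq].
have gp u : `|u| = 1 -> 0 < form G u by move=> u1; apply/Gp/nz.
have cF : {within S, continuous (fun u => form M u / form G u)}.
  apply: continuous_in_subspaceT => u; rewrite inE => Su.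
  apply: (continuousM (@continuous_form M u)).
  by apply: (@continuousV _ _ _ u _ (@continuous_form G u)); rewrite gt_eqF// gp.
have [w wS Fmin] := compact_EVT_min S0 cS cF.
move: wS; rewrite inE => w1.
pose m := form M w / form G w; exists m, w.
have mle u : m * form G u <= form M u.
  have [->|u0] := eqVneq u 0; first by rewrite !mulmx0 mxE mulr0.
  have nu : 0 < `|u| by rewrite normr_gt0.
  have u1 : `|(`|u|^-1 *: u)| = 1 by rewrite normrZ normfV normr_id mulVf ?gt_eqF.
  have := Fmin (`|u|^-1 *: u); rewrite inE => /(_ u1).
  rewrite !formZ -mulf_div divff ?mul1r ?expf_neq0 ?invr_eq0 ?gt_eqF//.
  by rewrite ler_pdivlMr ?Gp.
split; [by rewrite divr_gt0 ?gp// Mp ?nz|exact: nz| |exact: mle].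
(* M - m G is positive semidefinite and its form vanishes at the minimiser, which therefore lies in
   its kernel; this replaces differentiating the quotient. *)
apply/eqP; rewrite -subr_eq0 scalemxAl -mulmxBl; apply/eqP/psd_kernel.
- by rewrite linearB linearZ /= Ms Gs.
- by move=> v; rewrite form_lincomb subr_ge0 mle.
- by rewrite form_lincomb /m divfK ?subrr// gt_eqF ?gp.
Qed.

(** The trace is the sum of the values of the form at the columns of B. *)
Lemma psd_trace_ge0 (M B : 'M[R]_k) : (forall u, 0 <= form M u) -> 0 <= \tr (M *m (B *m B^T)).
Proof.
move=> Mp; rewrite mulmxA mxtrace_mulC mulmxA /mxtrace sumr_ge0// => i _.
have := Mp (col i B); congr (_ <= _).
by rewrite tr_col -row_mul !mxE; apply: eq_bigr => j _; rewrite !mxE.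
Qed.

(** With G = A A^T, the difference is the trace of (M - m G) G^-1, and G^-1 = B B^T for B = A^-T. *)
Lemma ddot_invmx_ge M A (m : R) : 0 < \det A ->
  (forall u, m * form (A *m A^T) u <= form M u) -> k%:R * m <= ddot M (invmx (A *m A^T)).
Proof.
move=> detA mM; have uA : A \in unitmx by rewrite unitmxE unitfE gt_eqF.
have uG : A *m A^T \in unitmx by rewrite unitmx_mul unitmx_tr uA.
rewrite ddot_trace -subr_ge0.
have -> : \tr (M *m invmx (A *m A^T)) - k%:R * m =
    \tr ((M - m *: (A *m A^T)) *m invmx (A *m A^T)).
  rewrite mulmxBl -scalemxAl mulmxV// raddfB /= mxtraceZ mxtrace1.
  by rewrite mulrC.
have -> : invmx (A *m A^T) = (invmx A)^T *m (invmx A)^T^T by rewrite invmx_gram// trmxK trmx_inv.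
by apply: psd_trace_ge0 => u; rewrite form_lincomb subr_ge0.
Qed.

End quadratic_forms.

(** * Spectral gaps of the Gaussian target and the comparison of shapings *)

Section gauss_gap.
Variables (R : realType) (k : nat) (mu : 'cV[R]_k) (Gamma : 'M[R]_k).
Hypotheses (k_gt0 : (0 < k)%N) (Gamma_spd : spd Gamma).
Implicit Types (Lambda : 'M[R]_k) (w u : 'cV[R]_k).
Let p := gauss_density mu Gamma.

(** The comparison of forms makes the constant admissible, the vector w makes it optimal, and the
    trace estimate bounds it by 1. *)
Lemma gauss_density_gap Lambda (m : R) w : Lambda^T = Lambda -> 0 < m -> w != 0 ->
    Lambda *m w = m *: (Gamma *m w) ->
    (forall u, m * (u^T *m Gamma *m u) 0 0 <= (u^T *m Lambda *m u) 0 0) ->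
  is_spectral_gap p Lambda (k%:R * m / ddot Lambda (invmx Gamma)) /\
  k%:R * m / ddot Lambda (invmx Gamma) <= 1.
Proof.
move=> Ls m0 w0 Lw mle; have [A [AG detA cov]] := spd_cholesky Gamma_spd.
have km : 0 < k%:R * m by rewrite mulr_gt0 ?ltr0n.
have kd : k%:R * m <= ddot Lambda (invmx Gamma).
  by move: mle; rewrite -AG; exact: ddot_invmx_ge.
have d0 := lt_le_trans km kd; split; last by rewrite ler_pdivrMr// mul1r.
split; [by rewrite divr_gt0| |].
- exact: (gap_ineq_gauss AG detA cov).
- by move=> rho rho0; exact: (gap_ineq_le AG detA cov Lw).
Qed.

Lemma is_spectral_gap_unique (q : 'cV[R]_k -> R) Lambda (r s : R) :
  is_spectral_gap q Lambda r -> is_spectral_gap q Lambda s -> r = s.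
Proof.
move=> [r0 gr rmax] [s0 gs smax]; apply/eqP.
by rewrite eq_le rmax// smax.
Qed.

Lemma gauss_density_has_gap Lambda : spd Lambda ->
  exists r, is_spectral_gap p Lambda r /\ r <= 1.
Proof.
move=> Ls; have [m [w [m0 w0 Lw mle]]] := spd_min_eigen k_gt0 Ls Gamma_spd.
by eexists; apply: (gauss_density_gap Ls.1 m0 w0 Lw mle).
Qed.

Lemma spd_scale (c : R) : 0 < c -> spd (c *: Gamma).
Proof.
move=> c0; have [Gs Gp] := Gamma_spd; split; first by rewrite linearZ /= Gs.
by move=> u u0; rewrite -scalemxAr -scalemxAl mxE mulr_gt0// Gp.
Qed.

Lemma spd1 : spd (1%:M : 'M[R]_k).
Proof.
split=> [|u u0]; first by rewrite trmx1.
rewrite mulmx1 lt_neqAle; apply/andP; split; last first.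
  by rewrite form_id sumr_ge0// => i _; exact: sqr_ge0.
by apply: contra_neq u0 => /esym/form_id_eq0.
Qed.

Lemma spd_unitmx : Gamma \in unitmx.
Proof.
have [A [<- detA _]] := spd_cholesky Gamma_spd.
by rewrite unitmx_mul unitmx_tr unitmxE unitfE gt_eqF.
Qed.

(** Every vector is a generalised eigenvector with value c, so any nonzero one serves, and the gap
    is k c / (c k). *)
Lemma gauss_density_gap_scale (c : R) : 0 < c -> is_spectral_gap p (c *: Gamma) 1.
Proof.
move=> c0; have [Gs Gp] := Gamma_spd.
have w0 : unitv R (Ordinal k_gt0) != 0.
  by apply/eqP => /colP/(_ (Ordinal k_gt0)); rewrite !mxE !eqxx => /eqP; rewrite oner_eq0.
have cs : (c *: Gamma)^T = c *: Gamma by rewrite linearZ /= Gs.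
have cw w : (c *: Gamma) *m w = c *: (Gamma *m w) by rewrite scalemxAl.
have cle u : c * (u^T *m Gamma *m u) 0 0 <= (u^T *m (c *: Gamma) *m u) 0 0.
  by rewrite -scalemxAr -scalemxAl [leRHS]mxE.
have [+ _] := gauss_density_gap cs c0 w0 (cw _) cle.
rewrite ddot_trace -scalemxAl mulmxV ?spd_unitmx// mxtraceZ mxtrace1.
by rewrite [c * _]mulrC divff// mulf_neq0 ?pnatr_eq0 -?lt0n// gt_eqF.
Qed.

(** For the pair (I, Gamma) the equation w = m Gamma w says that w is an eigenvector of Gamma^-1 for
    m. *)
Lemma gauss_density_gap_id : exists l : R, is_min_eigenvalue (invmx Gamma) l /\
  is_spectral_gap p 1%:M (k%:R * l / \tr (invmx Gamma)).
Proof.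
have [m [w [m0 w0 Lw mle]]] := spd_min_eigen k_gt0 spd1 Gamma_spd.
have [Gs Gp] := Gamma_spd; have uG := spd_unitmx.
exists m; split => //; last first.
  by rewrite -[invmx _]mul1mx -ddot_trace; have [] := gauss_density_gap (trmx1 _ _) m0 w0 Lw mle.
split=> [|l' /eigenvalueP[v vl v0]].
  apply/eigenvalueP; exists w^T; last first.
    by apply: contra_neq w0 => w0; rewrite -[w]trmxK w0 trmx0.
  have -> : w^T *m invmx Gamma = (m *: (Gamma *m w))^T *m invmx Gamma by rewrite -Lw mul1mx.
  by rewrite linearZ /= trmx_mul Gs -scalemxAl mulmxK.
have v0' : v^T != 0 by apply: contra_neq v0 => v0; rewrite -[v]trmxK v0 trmx0.
(* Writing v = v Gamma^-1 Gamma = l' v Gamma turns v v^T into l' times the form of Gamma at v^T,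
   which is positive and cancels. *)
have := mle v^T; rewrite trmxK mulmx1 -{3}[v](mulmxKV uG) vl.
by rewrite -!scalemxAl [leRHS]mxE ler_pM2r//; have := Gp _ v0'; rewrite trmxK.
Qed.

End gauss_gap.

Theorem theorem2p7 (R : realType) (k : nat) (k_gt0 : (0 < k)%N)
    (mu : 'cV[R]_k) (Gamma : 'M[R]_k) (Gamma_spd : spd Gamma) :
  let p := gauss_density mu Gamma in
  let Sigma := score_var p in
  [/\ Sigma = invmx Gamma,
      invmx Sigma = Gamma
    & exists gap : 'M[R]_k -> R,
      [/\ forall Lambda, spd Lambda -> is_spectral_gap p Lambda (gap Lambda),
          forall Lambda, spd Lambda -> gap Lambda <= gap Gamma,
          forall c : R, 0 < c -> gap (c *: Gamma) = gap Gamma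
        & exists lambda1 : R, is_min_eigenvalue Sigma lambda1 /\
            gap Gamma / gap 1%:M = \tr Sigma / (k%:R * lambda1)]].
Proof.
have [A [AG detA cov]] := spd_cholesky Gamma_spd.
move=> p Sigma; have SG : Sigma = invmx Gamma by exact: score_var_gauss_density AG detA cov.
split; [exact: SG|by rewrite SG invmxK|].
(* The spectral gap is a relation; choice turns it into a function, with the dummy value 0 off the
   positive definite matrices, and uniqueness then evaluates it. *)
have [gap gapP] : {gap : 'M[R]_k -> R & forall Lambda, spd Lambda ->
    is_spectral_gap p Lambda (gap Lambda) /\ gap Lambda <= 1}.
  apply: (@choice _ _ (fun Lambda r => spd Lambda -> is_spectral_gap p Lambda r /\ r <= 1)).
  move=> Lambda; have [/(gauss_density_has_gap mu k_gt0 Gamma_spd)[r rP]|nL] := pselect (spd Lambda).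
    by exists r.
  by exists 0.
have gapE Lambda r : spd Lambda -> is_spectral_gap p Lambda r -> gap Lambda = r.
  by move=> /gapP[+ _]; exact: is_spectral_gap_unique.
have gapc c : 0 < c -> gap (c *: Gamma) = 1.
  move=> c0; apply: gapE; first exact: spd_scale.
  exact: gauss_density_gap_scale.
have gap1 : gap Gamma = 1 by rewrite -[Gamma]scale1r gapc.
exists gap; split=> [L /gapP[]//|L /gapP[]|c c0|].
- by rewrite gap1.
- by rewrite gap1 gapc.
have [l [lmin lgap]] := gauss_density_gap_id mu k_gt0 Gamma_spd.
exists l; rewrite SG; split=> //.
(* The optimal gap is 1, so the ratio is the inverse of the gap at the identity. *)
by rewrite gap1 (gapE _ _ (spd1 R k) lgap) div1r invf_div.
Qed.
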